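(* Let $0<p<1$ and $\alpha>0$. There is a constant $C$ (independent of $f$ and $n$) such that for every $f$ with $f,f^{(\alpha)}\in L_1(\mathbb{T})$ and every $n\in\mathbb{N}$, $$\|f^{(\alpha)}-T_n^{(\alpha)}\|_p\leq C\rho_{\alpha,p}(n)\left(E_n(f^{(\alpha)})_p+\left(\frac1{n^{1-p}}\sum_{\nu=n+1}^\infty\frac{E_\nu(f^{(\alpha)})_p^p}{\nu^{p}}\right)^{1/p}\right),$$ where $T_n\in\mathcal{T}_n$ is such that $\|f-T_n\|_p=E_n(f)_p$ and $$\rho_{\alpha,p}(n)=\begin{cases} 1, & \alpha\in\mathbb{N}\ \text{or}\ \alpha\notin\mathbb{N}\ \text{and}\ \alpha>\frac1p-1,\\ \log^{\frac1p}(n+1), & \alpha=\frac1p-1\notin\mathbb{N},\\ n^{\frac1p-1-\alpha}, & \alpha\notin\mathbb{N}\ \text{and}\ \alpha<\frac1p-1.\end{cases}$$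
   Context: $\mathbb{T}\cong[0,2\pi)$; $L_p(\mathbb{T})$, $0<p<\infty$, is the space of measurable complex $2\pi$-periodic functions with $\|f\|_p=\left(\frac1{2\pi}\int_{\mathbb{T}}|f(x)|^p\,dx\right)^{1/p}<\infty$. $\mathbb{N}$ is the set of positive integers. $\mathcal{T}_n$ is the set of trigonometric polynomials of order at most $n$, and $E_n(f)_p=\inf_{T\in\mathcal{T}_n}\|f-T\|_p$. For $f\in L_1(\mathbb{T})$ and $\alpha\in\mathbb{R}$ the Weyl derivative $f^{(\alpha)}$ (fractional integral if $\alpha<0$) is given by $f^{(\alpha)}(x)\sim\sum_{k\in\mathbb{Z}\setminus\{0\}}(ik)^\alpha\widehat{f}_k e^{ikx}$, where $(ik)^\alpha=|k|^\alpha e^{i\frac{\alpha\pi}{2}\operatorname{sign}k}$ and $\widehat f_k=\frac1{2\pi}\int_0^{2\pi}f(x)e^{-ikx}dx$; $f^{(\alpha)}\in L_1(\mathbb{T})$ means that this series is the Fourier series of a function in $L_1(\mathbb{T})$, denoted $f^{(\alpha)}$. *)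

(* Defs.v *)
From HB Require Import structures.
From mathcomp Require Import all_boot all_order all_algebra.
From mathcomp Require Import complex.
From mathcomp Require Import all_classical all_reals all_analysis.
Set Implicit Arguments.
Unset Strict Implicit.
Unset Printing Implicit Defensive.
Import Order.TTheory GRing.Theory Num.Theory.
Import numFieldNormedType.Exports.
Local Open Scope classical_set_scope.
Local Open Scope ring_scope.
Local Open Scope complex_scope.

(* Elements of L_p(T) are represented by everywhere-defined 2pi-periodic
   functions f : R -> R[i]; statements are then made for all representatives. *)

Definition circle (R : realType) : set R := `[0, pi *+ 2[%classic.

(* e^(i t) *)
Definition cis (R : realType) (t : R) : R[i] := cos t +i* sin t.

(* There is no sigma-algebra on R[i] in the library: measurability is that of
   the real and imaginary parts. *)
Definition cmeasurable (R : realType) (f : R -> R[i]) : Prop :=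
  measurable_fun setT (fun x : R => complex.Re (f x)) /\
  measurable_fun setT (fun x : R => complex.Im (f x)).

(* Extended-real valued, so that it makes sense for every f. *)
Definition normLp (R : realType) (p : R) (f : R -> R[i]) : \bar R :=
  ((((pi *+ 2)^-1)%:E *
    \int[@lebesgue_measure R]_(x in @circle R) ((Normc.normc (f x)) `^ p)%:E)
   `^ p^-1)%E.

Definition in_Lp (R : realType) (p : R) (f : R -> R[i]) : Prop :=
  [/\ cmeasurable f, periodic f (pi *+ 2) & (normLp p f < +oo)%E].

(* T(x) = \sum_(-n <= k <= n) c_k e^(ikx), reindexed by k = j - n. *)
Definition trig_poly (R : realType) (n : nat) : set (R -> R[i]) :=
  [set T : R -> R[i] | exists c : int -> R[i], forall x : R,
     T x = \sum_(j < n.*2.+1) c (j%:Z - n%:Z) * cis ((j%:Z - n%:Z)%:~R * x)].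

Definition best_approx (R : realType) (p : R) (n : nat) (f : R -> R[i]) :
    \bar R :=
  ereal_inf [set normLp p (f \- T) | T in @trig_poly R n].

Definition cintegral (R : realType) (f : R -> R[i]) : R[i] :=
  (\int[@lebesgue_measure R]_(x in @circle R) complex.Re (f x)) +i*
  (\int[@lebesgue_measure R]_(x in @circle R) complex.Im (f x)).

Definition fourier_coef (R : realType) (f : R -> R[i]) (k : int) : R[i] :=
  ((pi *+ 2)^-1)%:C * cintegral (fun x => f x * cis (- (k%:~R * x))).

(* (ik)^alpha, with the branch fixed by the sign of k; used for k != 0 only. *)
Definition ik_pow (R : realType) (alpha : R) (k : int) : R[i] :=
  (`|k%:~R| `^ alpha)%:C * cis (alpha * pi / 2 * (sgz k)%:~R).

(* "g is (a representative of) f^(alpha), and it belongs to L_1": the formal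
   series of f^(alpha), which has no term k = 0, is the Fourier series of g. *)
Definition weyl_derivative (R : realType) (alpha : R) (f g : R -> R[i]) :
    Prop :=
  in_Lp 1 g /\
  forall k : int, fourier_coef g k =
    if k == 0 then 0 else ik_pow alpha k * fourier_coef f k.

(* Num.nat contains 0, which is irrelevant here as alpha > 0. *)
Definition rho (R : realType) (alpha p : R) (n : nat) : R :=
  if (alpha \is a Num.nat) || (p^-1 - 1 < alpha) then 1
  else if alpha == p^-1 - 1 then ln (n.+1)%:R `^ p^-1
  else n%:R `^ (p^-1 - 1 - alpha).

(* Main.v *)
Require Import Defs.
From mathcomp Require Import all_boot all_order all_algebra.
From mathcomp Require Import complex ring lra zify.
From mathcomp Require Import all_classical all_reals all_analysis.
From mathcomp Require Import measurable_realfun.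
(* Only quasi-norms are available in L_p, so everything is estimated through
   [Ip p f], the integral of [|f|^p] over the circle, which is subadditive.
   A smooth multiplier at scale [m] has a kernel concentrated near 0 (summation
   by parts against a power of [1 - e^(ix)]), and convolving two trigonometric
   polynomials of degree [< L] costs at most [L^(1-p)] (quadrature on [L] nodes).
   Cutting the multiplier [(ik)^alpha] into dyadic pieces this gives the Bernstein
   inequality with factor [n^alpha * rho alpha p n], and a bound
   [C n^(gp+p-1) N^(1-p)] for the high-pass multiplier [(1 - eta(|k|/n)) (ik)^g] on
   polynomials of degree [N], when [gp + p - 1 < 0].
   Let [U k] be almost best approximants of [f^(alpha)] of degree [2^k n] and
   [Q k = U (k+1) - U k]. If the sum over the [nu]'s is finite, Nikol'skii's
   inequality makes the series of the [Q k] converge in L_1, and by uniqueness of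
   Fourier coefficients the high-pass parts of [f] and [f^(alpha)] are the sums of
   those of the [Q k]; their low-pass parts have degree [n]. This produces [W] of
   degree [n] with [f - W] and [f^(alpha) - W^(alpha)] both controlled, and the
   Bernstein inequality for [W - T], together with [|f - T|_p <= |f - W|_p],
   concludes. *)

Set Implicit Arguments.
Unset Strict Implicit.
Unset Printing Implicit Defensive.
Import Order.TTheory GRing.Theory Num.Theory.
Import numFieldNormedType.Exports.
Local Open Scope classical_set_scope.
Local Open Scope ring_scope.

(** * Finite differences of products and of powers *)

Section FiniteDifferences.
Variable R : realType.
Implicit Types (f g : R -> R) (x y : R).

(** For [p < 1] the [L_p] quasi-norm does not control Fourier coefficients, so a low-frequency part
    of [f] admits no estimate there. [W] is therefore made to let such parts cancel: it has the true
    coefficients of [f], weighted by [eta], completed by [1 - eta] times the integrated coefficients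
    of [U 0]. The coefficients of [f^(alpha) - W^(alpha)] are then those of [f^(alpha) - U 0] times
    [1 - eta], and those of [f - W] carry a further [(ik)^(-alpha)]. [rho] stems from Bernstein
    alone. A piece of [(ik)^alpha] at scale [2^l] has a kernel with [int |K|^p] of order
    [2^(l (alpha p + p - 1))], and the sum over [l] depends on the sign of [alpha - (1/p - 1)];
    small scales hurt because [(ik)^alpha] is singular at 0. For natural [alpha] it is a power of
    [k] up to a unimodular constant, and translating the frequencies avoids the small scales. The
    tail sum over [nu] pays for the loss [(2^k n)^(1 - p)] in convolving at degree [2^k n]: Cauchy
    condensation matches the two. *)

Definition fdiff f x := f (x + 1) - f x.
Definition ndiff i f := iter i fdiff f.

Lemma ndiffSr i f : ndiff i.+1 f = ndiff i (fdiff f).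
Proof. by rewrite /ndiff iterSr. Qed.

Lemma ndiffS i f x : ndiff i.+1 f x = ndiff i f (x + 1) - ndiff i f x.
Proof. by []. Qed.

Lemma ndiffD i f g x : ndiff i (f \+ g) x = ndiff i f x + ndiff i g x.
Proof. by elim: i x => [//|i IH] x; rewrite !ndiffS !IH; ring. Qed.

Lemma ndiffB i f g x : ndiff i (f \- g) x = ndiff i f x - ndiff i g x.
Proof. by elim: i x => [//|i IH] x; rewrite !ndiffS !IH; ring. Qed.

Lemma ndiff_scale i f c d x :
  ndiff i (fun x => c * f (x + d)) x = c * ndiff i f (x + d).
Proof.
by elim: i x => [//|i IH] x; rewrite !ndiffS !IH (addrAC x 1 d) mulrBr.
Qed.

Lemma ndiff_eq0 i f x : (forall t, (t <= i)%N -> f (x + t%:R) = 0) ->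
  ndiff i f x = 0.
Proof.
elim: i x => [|i IH] x f0; first by have := f0 0%N isT; rewrite addr0.
rewrite ndiffS IH => [|t ti]; last by rewrite -addrA nat1r f0.
by rewrite IH ?subrr// => t ti; rewrite f0// leqW.
Qed.

(* The factor [w] only has to be smooth where [f] does not vanish. *)
Lemma ndiffM_le q f w (A B M : R) : 0 <= A -> 0 <= B -> 0 <= M ->
  (forall i x, (i <= q)%N -> `|ndiff i f x| <= A * M ^+ i) ->
  (forall x i t, f x != 0 -> (t + i <= q)%N ->
     `|ndiff i w (x + t%:R)| <= B * M ^+ i) ->
  forall x, `|ndiff q (fun x => f x * w x) x| <= 2 ^+ q * (A * B) * M ^+ q.
Proof.
elim: q f w A B => [|q IH] f w A B A0 B0 M0 fA wB x.
  rewrite !expr0 mul1r mulr1 /ndiff /=.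
  have [->|fx] := eqVneq (f x) 0; first by rewrite mul0r normr0 mulr_ge0.
  rewrite normrM ler_pM //.
    by have := fA 0%N x isT; rewrite expr0 mulr1.
  by have := wB x 0%N 0%N fx isT; rewrite expr0 mulr1 addr0.
rewrite ndiffSr.
have -> : fdiff (fun x => f x * w x) =
    (fun x => fdiff f x * w (x + 1)) \+ (fun x => f x * fdiff w x).
  by apply/funext => y /=; rewrite /fdiff; ring.
rewrite ndiffD (le_trans (ler_normD _ _))//.
have -> : 2 ^+ q.+1 * (A * B) * M ^+ q.+1 =
   2 ^+ q * ((A * M) * B) * M ^+ q + 2 ^+ q * (A * (B * M)) * M ^+ q.
  by rewrite !exprS; ring.
apply: lerD.
  apply: (IH (fdiff f) (fun x => w (x + 1))) => //; first exact: mulr_ge0.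
    by move=> i y iq; rewrite -ndiffSr (le_trans (fA _ _ _))// exprS mulrA.
  move=> y i t fy tiq.
  have -> : ndiff i (fun x => w (x + 1)) (y + t%:R) = ndiff i w (y + t%:R + 1).
    have := ndiff_scale i w 1 1 (y + t%:R).
    by under [X in ndiff i X _]funext do rewrite mul1r; rewrite mul1r.
  (* [fdiff f] may live one step to the left of [f]; the offset [t] in the hypothesis on [w] is the
     room for this, one unit being used up per difference. *)
  have : f y != 0 \/ f (y + 1) != 0.
    apply/orP; apply: contraNT fy; rewrite negb_or !negbK => /andP[/eqP a /eqP b].
    by rewrite /fdiff a b subrr.
  case=> fy'.
    by rewrite -addrA natr1 wB// addSn.
  by rewrite addrAC wB// (leq_trans tiq).
apply: IH => //; first exact: mulr_ge0.
  by move=> i y iq; apply: fA; exact: leqW.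
move=> y i t fy tiq; rewrite -ndiffSr (le_trans (wB _ _ _ _ _))// ?addnS//.
by rewrite exprS mulrA.
Qed.

Lemma is_derive_ndiff_powR i (g x : R) : 0 < x ->
  is_derive x 1 (ndiff i (@powR R ^~ g)) (g * ndiff i (@powR R ^~ (g - 1)) x).
Proof.
elim: i x => [|i IH] x x0; first exact: is_derive1_powR.
have x1 : 0 < x + 1 by rewrite addr_gt0.
have IH0 := IH _ x0.
have IH1 := IH _ x1.
have sh : is_derive x 1 (fun y : R => y + 1) 1.
  by apply: is_derive_eq; rewrite addr0.
have H : is_derive x 1 (ndiff i (@powR R ^~ g) \o (fun y => y + 1))
   (1 *: (g * ndiff i (@powR R ^~ (g - 1)) (x + 1))).
  by rewrite scale1r -[X in is_derive _ _ _ X]mulr1; exact: is_derive1_comp.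
have K := is_deriveB H IH0.
have -> : ndiff i.+1 (@powR R ^~ g) =
  ndiff i (@powR R ^~ g) \o (fun y => y + 1) - ndiff i (@powR R ^~ g).
  by apply/funext => y.
apply: is_derive_eq; rewrite scale1r ndiffS; ring.
Qed.

Lemma powR_le_range (g c : R) : 1 <= c -> exists2 C, 0 < C &
  forall m x, 0 < m -> m <= x <= c * m -> x `^ g <= C * m `^ g.
Proof.
move=> c1; have c0 : 0 < c by rewrite (lt_le_trans _ c1).
have [g0|g0] := leP 0 g.
  exists (c `^ g); first exact: powR_gt0.
  move=> m x m0 /andP[mx xm]; rewrite -powRM ?(ltW m0) ?(ltW c0)//.
  by apply: ge0_ler_powR => //; rewrite nnegrE ?mulr_ge0 ?(ltW c0) ?(ltW m0)// (le_trans (ltW m0)).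
exists 1 => // m x m0 /andP[mx _]; rewrite mul1r.
rewrite -[g]opprK powRN (powRN m) lef_pV2 ?posrE ?powR_gt0 ?(lt_le_trans m0)//.
apply: ge0_ler_powR => //; first by rewrite oppr_ge0 ltW.
  by rewrite nnegrE ltW.
by rewrite nnegrE (le_trans (ltW m0)).
Qed.

(** By the mean value theorem a difference is a derivative at a nearby point, which lowers the
    exponent by 1 and so gains [m^-1]; hence the induction over all [g]. Keeping [x + i] below
    [c * m] makes the powers comparable to [m ^ g] for either sign of [g]. *)
Lemma ndiff_powR_le i (g c : R) : 1 <= c -> exists2 C, 0 < C &
  forall m x, 1 <= m -> m <= x -> x + i%:R <= c * m ->
    `|ndiff i (@powR R ^~ g) x| <= C * m `^ g * m^-1 ^+ i.
Proof.
move=> c1; elim: i g => [|i IH] g.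
  have [C C0 H] := powR_le_range g c1.
  exists C => // m x m1 mx xc; have m0 : 0 < m by rewrite (lt_le_trans _ m1).
  by rewrite expr0 mulr1 /ndiff /= ger0_norm ?powR_ge0// H// mx -[x]addr0.
have [C C0 H] := IH (g - 1).
(* The [+ 1] keeps the constant positive when [g = 0]. *)
exists ((`|g| + 1) * C); first by rewrite mulr_gt0// ltr_wpDl.
move=> m x m1 mx xc; have m0 : 0 < m by rewrite (lt_le_trans _ m1).
have x0 : 0 < x by rewrite (lt_le_trans m0).
rewrite ndiffS.
have [|||y] := @MVT_segment R (ndiff i (@powR R ^~ g))
  (fun y => g * ndiff i (@powR R ^~ (g - 1)) y) x (x + 1).
- by rewrite lerDl.
- move=> y; rewrite in_itv/= => /andP[xy _]; apply: is_derive_ndiff_powR.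
  exact: lt_trans xy.
- apply: derivable_within_continuous => y; rewrite in_itv /= => /andP[xy _].
  apply: ex_derive; apply: is_derive_ndiff_powR; exact: lt_le_trans xy.
rewrite in_itv /= => /andP[xy yx] ->.
rewrite addrAC subrr add0r mulr1 normrM.
have := H m y m1 (le_trans mx xy).
have -> : y + i%:R <= c * m.
  by rewrite (le_trans _ xc)// -nat1r addrA lerD2r.
move=> /(_ isT) h.
have -> : (`|g| + 1) * C * m `^ g * m^-1 ^+ i.+1 =
   (`|g| + 1) * (C * m `^ (g - 1) * m^-1 ^+ i).
  have -> : m `^ (g - 1) = m `^ g / m.
    by rewrite powRB ?powRr1 ?(ltW m0)// (gt_eqF m0) implybT.
  by rewrite exprS; ring.
by rewrite ler_pM ?lerDl// mulr_ge0 ?powR_ge0.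
Qed.

End FiniteDifferences.

(** * Smooth cutoffs and bumps at scale [m] *)

Section Cutoff.
Variable R : realType.
Implicit Types (x : R) (m i q c : nat).

(** The indicator of [x < m] averaged [q] times over [m] unit shifts, a discrete spline: each
    average makes one more difference small, of size [2 / m]. *)
Fixpoint cutoff q m x : R :=
  if q is q'.+1 then m%:R^-1 * \sum_(l < m) cutoff q' m (x - l%:R)
  else (x < m%:R)%R%:R.

Lemma cutoff_ge0 q m x : 0 <= cutoff q m x.
Proof.
by elim: q x => [|q IH] x /=; rewrite ?ler0n// mulr_ge0// sumr_ge0.
Qed.

Lemma cutoff_le1 q m x : cutoff q m x <= 1.
Proof.
elim: q x => [|q IH] x /=; first by rewrite lern1 leq_b1.
have [->|m0] := posnP m; first by rewrite big_ord0 mulr0.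
rewrite ler_pdivrMl ?ltr0n// mulr1 (le_trans (ler_sum _ (fun l _ => IH _)))//.
by rewrite big_const_ord iter_addr_0.
Qed.

Lemma cutoff_eq1 q m x : (0 < m)%N -> x < m%:R -> cutoff q m x = 1.
Proof.
move=> m0; elim: q x => [|q IH] x xm /=; first by rewrite xm.
rewrite (eq_bigr (fun=> 1)); last first.
  by move=> l _; rewrite IH// (le_lt_trans _ xm)// gerBl.
by rewrite big_const_ord iter_addr_0 mulVf// pnatr_eq0 -lt0n.
Qed.

(** Averaging over the shifts [0, ..., m - 1] moves the end of the support by [m - 1], not by [m].
    For [m = 1] the cutoff thus stays the indicator of [x < 1], which isolates the frequency 0. *)
Lemma cutoff_eq0 q m x : (0 < m)%N ->
  m%:R + q%:R * (m%:R - 1) <= x -> cutoff q m x = 0.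
Proof.
move=> m0; elim: q x => [|q IH] x xm /=.
  by move: xm; rewrite mul0r addr0 leNgt => /negbTE ->.
rewrite big1 ?mulr0// => l _; apply: IH.
rewrite lerBrDr (le_trans _ xm)// -natr1 mulrDl mul1r addrA lerD2l.
by rewrite lerBrDr natr1 ler_nat.
Qed.

(** Consecutive moving averages share all but two terms. *)
Lemma fdiff_cutoff q m x : (0 < m)%N ->
  fdiff (cutoff q.+1 m) x =
  m%:R^-1 * (cutoff q m (x + 1) - cutoff q m (x + (1 - m%:R))).
Proof.
move=> m0; rewrite /fdiff /= -mulrBr; congr (_ * _).
case: m m0 => // m _; rewrite big_ord_recl [X in _ - X]big_ord_recr /= subr0.
rewrite (eq_bigr (fun l : 'I_m => cutoff q m.+1 (x - l%:R))); last first.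
  by move=> l _; congr cutoff; rewrite /bump /= add1n -natr1; ring.
rewrite -natr1 (_ : x + (1 - (m%:R + 1)) = x - m%:R); ring.
Qed.

Lemma ndiff_cutoff_le i q m x : (0 < m)%N -> (i <= q)%N ->
  `|ndiff i (cutoff q m) x| <= (2 * m%:R^-1) ^+ i.
Proof.
move=> m0; elim: i q x => [|i IH] q x iq.
  by rewrite expr0 /ndiff /= ger0_norm ?cutoff_ge0// cutoff_le1.
case: q iq => // q iq; rewrite ndiffSr.
have -> : fdiff (cutoff q.+1 m) =
  (fun x => m%:R^-1 * cutoff q m (x + 1)) \-
  (fun x => m%:R^-1 * cutoff q m (x + (1 - m%:R))).
  by apply/funext => y; rewrite fdiff_cutoff// mulrBr.
rewrite ndiffB !ndiff_scale -mulrBr normrM ger0_norm ?invr_ge0//.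
rewrite exprS mulrAC mulrC ler_wpM2r ?invr_ge0//.
by rewrite (le_trans (ler_normB _ _))// mulr2n mulrDl mul1r lerD// IH.
Qed.

(** A bump at scale [m]. For [c = 2] and dyadic [m] these bumps telescope; for [c > q + 1] there is
    an interval where the bump equals 1, used to reproduce a multiplier exactly. *)
Definition plateau q c m x : R := cutoff q (c * m) x - cutoff q m x.

Lemma plateau_low q c m x : (0 < m)%N -> (0 < c)%N -> x < m%:R ->
  plateau q c m x = 0.
Proof.
move=> m0 c0 xm; rewrite /plateau !cutoff_eq1 ?subrr ?muln_gt0 ?c0//.
by rewrite (lt_le_trans xm)// ler_nat leq_pmull.
Qed.

Lemma plateau_high q c m x : (0 < m)%N -> (0 < c)%N ->
  (q.+1 * (c * m))%:R <= x -> plateau q c m x = 0.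
Proof.
move=> m0 c0 xm; have h k : (0 < k)%N -> k%:R + q%:R * (k%:R - 1) <= (q.+1 * k)%:R :> R.
  by move=> k0; rewrite mulSn natrD natrM lerD2l ler_wpM2l// gerBl.
have cm0 : (0 < c * m)%N by rewrite muln_gt0 c0.
rewrite /plateau !cutoff_eq0 ?subrr//; apply: le_trans xm; last exact: h.
by rewrite (le_trans (h _ m0))// ler_nat leq_mul2l leq_pmull.
Qed.

Lemma plateau_eq1 q c m x : (0 < m)%N -> (0 < c)%N ->
  (q.+1 * m)%:R <= x < (c * m)%:R -> plateau q c m x = 1.
Proof.
move=> m0 c0 /andP[mx xm].
rewrite /plateau cutoff_eq1 ?muln_gt0 ?c0// cutoff_eq0 ?subr0//.
by apply: le_trans mx; rewrite mulSn natrD natrM lerD2l ler_wpM2l ?gerBl.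
Qed.

Lemma plateau_norm_le1 q c m x : `|plateau q c m x| <= 1.
Proof.
have := cutoff_ge0 q m x; have := cutoff_le1 q m x.
have := cutoff_ge0 q (c * m) x; have := cutoff_le1 q (c * m) x.
by rewrite /plateau ler_norml => *; lra.
Qed.

Lemma ndiff_plateau_le i q c m x : (0 < m)%N -> (0 < c)%N -> (i <= q)%N ->
  `|ndiff i (plateau q c m) x| <= 2 ^+ q.+1 * m%:R^-1 ^+ i.
Proof.
move=> m0 c0 iq.
have -> : plateau q c m = cutoff q (c * m) \- cutoff q m by [].
rewrite ndiffB (le_trans (ler_normB _ _))//.
have h : (2 * (c * m)%:R^-1) ^+ i <= (2 * m%:R^-1 : R) ^+ i.
  rewrite lerXn2r ?nnegrE ?mulr_ge0 ?invr_ge0// ler_wpM2l//.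
  by rewrite lef_pV2 ?posrE ?ltr0n ?muln_gt0 ?c0// ler_nat leq_pmull.
apply: (@le_trans _ _ (2 * (2 * m%:R^-1) ^+ i)).
  rewrite mulr2n mulrDl mul1r lerD ?ndiff_cutoff_le//.
  by rewrite (le_trans _ h)// ndiff_cutoff_le ?muln_gt0 ?c0.
rewrite exprMn mulrA -exprS ler_wpM2r ?exprn_ge0 ?invr_ge0//.
by rewrite ler_weXn2l// ler1n.
Qed.

Lemma plateau_powR_le q c (g : R) : (0 < c)%N -> exists2 A, 0 < A &
  forall m, (0 < m)%N ->
  (forall x, `|plateau q c m x * x `^ g| <= A * m%:R `^ g) /\
  (forall x, `|ndiff q (fun x => plateau q c m x * x `^ g) x| <=
     A * m%:R `^ g * m%:R^-1 ^+ q).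
Proof.
(* [d] allows for the support, up to [(q + 1) * c * m], and for the [q] further points sampled by
   the differences. *)
move=> c0; pose d : R := (q.+1 * c)%:R + q%:R.
have d1 : 1 <= d by rewrite /d -natrD ler1n addn_gt0 muln_gt0 c0.
have supp m x : (0 < m)%N -> plateau q c m x != 0 -> m%:R <= x <= (q.+1 * c)%:R * m%:R.
  move=> m0 b; apply/andP; split.
    by rewrite leNgt; apply: contra b => /plateau_low ->.
  rewrite -natrM -mulnA leNgt; apply: contra b => /ltW/plateau_high -> //.
have [B B0 HB] := powR_le_range g d1.
(* A single constant for all orders up to [q]: the sum of those of each order. *)
have [C C0 HC] : exists2 C, 0 < C & forall i (m : R) x, (i <= q)%N -> 1 <= m -> m <= x ->
    x + i%:R <= d * m -> `|ndiff i (@powR R ^~ g) x| <= C * m `^ g * m^-1 ^+ i.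
  elim: (q) => [|n [C C0 H]].
    have [C C0 H] := ndiff_powR_le 0 g d1.
    by exists C => // i m x; rewrite leqn0 => /eqP ->; exact: H.
  have [D D0 H'] := ndiff_powR_le n.+1 g d1.
  exists (C + D); first exact: addr_gt0.
  move=> i m x; rewrite leq_eqVlt => /predU1P[->|iq] m1 mx xm.
    rewrite (le_trans (H' _ _ m1 mx xm))// -!mulrA ler_wpM2r ?lerDr ?(ltW C0)//.
    by rewrite mulr_ge0 ?powR_ge0// exprn_ge0// invr_ge0 (le_trans _ m1).
  rewrite (le_trans (H _ _ _ iq m1 mx xm))// -!mulrA ler_wpM2r ?lerDl ?(ltW D0)//.
  by rewrite mulr_ge0 ?powR_ge0// exprn_ge0// invr_ge0 (le_trans _ m1).
exists (B + 2 ^+ q * (2 ^+ q.+1 * C)).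
  by rewrite addr_gt0// !mulr_gt0 ?exprn_gt0.
move=> m m0; have m0' : 0 < m%:R :> R by rewrite ltr0n.
split=> x.
  have [->|b] := eqVneq (plateau q c m x) 0.
    by rewrite mul0r normr0 mulr_ge0 ?powR_ge0// ltW// addr_gt0// !mulr_gt0 ?exprn_gt0.
  rewrite normrM (ger0_norm (powR_ge0 _ _)).
  rewrite (le_trans (ler_piMl (powR_ge0 _ _) (plateau_norm_le1 _ _ _ _)))//.
  have /andP[mx xm] := supp _ _ m0 b.
  rewrite (le_trans (HB _ _ m0' _))//.
    by rewrite mx (le_trans xm)// ler_pM2r// lerDl.
  by rewrite ler_wpM2r ?powR_ge0// lerDl !mulr_ge0// ltW.
apply: (@le_trans _ _ (2 ^+ q * (2 ^+ q.+1 * (C * m%:R `^ g)) * m%:R^-1 ^+ q)).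
  apply: ndiffM_le.
  - exact: exprn_ge0.
  - by rewrite mulr_ge0 ?powR_ge0 ?(ltW C0).
  - by rewrite invr_ge0.
  - by move=> i y iq; rewrite ndiff_plateau_le.
  - move=> y i t by0 tiq; have /andP[my ym] := supp _ _ m0 by0.
    apply: HC => //.
    + exact: leq_trans (leq_addl _ _) tiq.
    + by rewrite ler1n.
    + by rewrite (le_trans my)// lerDl.
    + rewrite -addrA -natrD mulrDl lerD// (le_trans (_ : _ <= q%:R))// ?ler_nat//.
      by rewrite ler_peMr// ler1n.
rewrite !mulrA ler_wpM2r ?exprn_ge0 ?invr_ge0// ler_wpM2r ?powR_ge0//.
by rewrite lerDr ltW.
Qed.

End Cutoff.

(** * The complex modulus and [e^(it)] *)

Local Notation nc := (@Normc.normc _).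

Section ComplexModulus.
Variable R : realType.
Implicit Types z : R[i].

Lemma nc_ge0 z : 0 <= nc z.
Proof. by case: z => a b; exact: sqrtr_ge0. Qed.

Lemma ncE z : nc z = Num.sqrt (complex.Re z ^+ 2 + complex.Im z ^+ 2).
Proof. by case: z. Qed.

Lemma nc_sum I (s : seq I) (P : pred I) (F : I -> R[i]) :
  nc (\sum_(i <- s | P i) F i) <= \sum_(i <- s | P i) nc (F i).
Proof.
elim/big_ind2: _ => [|x a y b xa yb|//]; first by rewrite Normc.normc0.
by rewrite (le_trans (le_normcD _ _))// lerD.
Qed.

Lemma ncX z n : nc (z ^+ n) = nc z ^+ n.
Proof.
elim: n => [|n IH]; first by rewrite !expr0 Normc.normc1.
by rewrite !exprS Normc.normcM IH.
Qed.

Lemma nc_real (a : R) : nc a%:C%C = `|a|.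
Proof. by rewrite ncE /= expr0n addr0 sqrtr_sqr. Qed.

Lemma Re_le_nc z : `|complex.Re z| <= nc z.
Proof. by rewrite ncE -sqrtr_sqr ler_sqrt ?addr_ge0 ?sqr_ge0// lerDl sqr_ge0. Qed.

Lemma Im_le_nc z : `|complex.Im z| <= nc z.
Proof. by rewrite ncE -sqrtr_sqr ler_sqrt ?addr_ge0 ?sqr_ge0// lerDr sqr_ge0. Qed.

Lemma nc_le_ReIm z : nc z <= `|complex.Re z| + `|complex.Im z|.
Proof.
rewrite ncE -[leRHS]ger0_norm ?addr_ge0// -sqrtr_sqr ler_sqrt ?sqr_ge0//.
rewrite sqrrD !real_normK ?num_real// -addrA lerD2l lerDr.
by rewrite mulrn_wge0// mulr_ge0.
Qed.

Lemma Re_add z z' : complex.Re (z + z') = complex.Re z + complex.Re z'.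
Proof. by case: z z' => [a b] [c d]. Qed.
Lemma Im_add z z' : complex.Im (z + z') = complex.Im z + complex.Im z'.
Proof. by case: z z' => [a b] [c d]. Qed.
Lemma Re_mul z z' : complex.Re (z * z') =
  complex.Re z * complex.Re z' - complex.Im z * complex.Im z'.
Proof. by case: z z' => [a b] [c d]. Qed.
Lemma Im_mul z z' : complex.Im (z * z') =
  complex.Re z * complex.Im z' + complex.Im z * complex.Re z'.
Proof. by case: z z' => [a b] [c d]. Qed.

Lemma complex_eq z z' : complex.Re z = complex.Re z' ->
  complex.Im z = complex.Im z' -> z = z'.
Proof. by case: z z' => [a b] [c d] /= -> ->. Qed.

Lemma cisD (s t : R) : cis (s + t) = cis s * cis t.
Proof. by apply: complex_eq; rewrite /= ?cosD ?sinD //; ring. Qed.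

Lemma cis0 : cis 0 = 1 :> R[i].
Proof. by rewrite /cis cos0 sin0. Qed.

Lemma nc_cis (t : R) : nc (cis t) = 1.
Proof. by rewrite /= cos2Dsin2 sqrtr1. Qed.

Lemma cis_neq0 (t : R) : cis t != 0.
Proof.
apply/eqP => /(congr1 nc); rewrite nc_cis Normc.normc0 => /eqP.
by rewrite oner_eq0.
Qed.

Lemma cisN (t : R) : cis (- t) = (cis t)^-1.
Proof.
apply: (mulfI (cis_neq0 t)); rewrite -cisD subrr cis0 mulfV//.
exact: cis_neq0.
Qed.

Lemma cisX (t : R) n : cis t ^+ n = cis (n%:R * t).
Proof.
elim: n => [|n IH]; first by rewrite expr0 mul0r cis0.
by rewrite exprS IH -nat1r mulrDl mul1r cisD.
Qed.

Lemma cis2pi : cis (pi *+ 2) = 1 :> R[i].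
Proof. by rewrite /cis cos2pi sin2pi. Qed.

Lemma cisD2pi (t : R) : cis (t + pi *+ 2) = cis t.
Proof. by rewrite cisD cis2pi mulr1. Qed.

Lemma cos_half_sin (x : R) : 2 - 2 * cos x = (2 * sin (x / 2)) ^+ 2.
Proof.
have {1}-> : x = (x / 2) *+ 2 by rewrite mulr2n; field.
by rewrite cos_mulr2n exprMn sin2cos2; ring.
Qed.

Lemma nc_1Bcis (x : R) : nc (1 - cis x) ^+ 2 = 2 - 2 * cos x.
Proof.
rewrite ncE sqr_sqrtr ?addr_ge0 ?sqr_ge0//= !add0r sqrrN sqrrB expr1n mul1r.
by rewrite sin2cos2; ring.
Qed.

Lemma cis_eq1 (x : R) : 0 < x < pi *+ 2 -> cis x != 1.
Proof.
move=> /andP[x0 x2]; apply/eqP => /(congr1 (@complex.Re _)) /= c1.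
have := cos_half_sin x; rewrite c1 mulr1 subrr => /esym/eqP.
rewrite sqrf_eq0 mulf_eq0 pnatr_eq0 /= => /eqP s0.
have := @sin_gt0_pi _ (x / 2); rewrite s0 ltxx divr_gt0//=.
by rewrite ltr_pdivrMr// mulr_natr => /(_ x2).
Qed.

End ComplexModulus.

(** * Subadditivity of powers with exponent at most 1 *)

Section PowR.
Variable R : realType.
Implicit Types (a b p x y : R).

(** Divided by [(a + b) ^ p], this is [t <= t ^ p] on [0, 1] applied to the two shares of
    [a + b]. *)
Lemma powR_leD p a b : 0 < p -> p <= 1 -> 0 <= a -> 0 <= b ->
  (a + b) `^ p <= a `^ p + b `^ p.
Proof.
move=> p0 p1 a0 b0.
have [s0|s0] := eqVneq (a + b) 0.
  by rewrite s0 powR0 ?gt_eqF// addr_ge0// powR_ge0.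
have s1 : 0 < a + b by rewrite lt0r s0 addr_ge0.
have h t : 0 <= t <= a + b -> t / (a + b) <= (t / (a + b)) `^ p.
  move=> /andP[]; rewrite le_eqVlt => /predU1P[<- _|t0 t1].
    by rewrite mul0r powR_ge0.
  by rewrite ger1_powR// divr_gt0//= ler_pdivrMr// mul1r.
have : 1 <= (a / (a + b)) `^ p + (b / (a + b)) `^ p.
  rewrite -[X in X <= _](mulfV s0) mulrDl lerD// h//.
    by rewrite a0 lerDl.
  by rewrite b0 lerDr.
rewrite !powRM ?invr_ge0 ?(ltW s1)// -mulrDl.
move/(ler_wpM2r (powR_ge0 (a + b) p)); rewrite mul1r -mulrA.
by rewrite -powRM ?invr_ge0 ?(ltW s1)// mulVf// powR1 mulr1.
Qed.

Lemma powR_le_sum p I (s : seq I) (F : I -> R) : 0 < p -> p <= 1 ->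
  (forall i, 0 <= F i) ->
  (\sum_(i <- s) F i) `^ p <= \sum_(i <- s) F i `^ p.
Proof.
move=> p0 p1 F0; elim: s => [|i s IH].
  by rewrite !big_nil powR0 ?gt_eqF.
rewrite !big_cons (le_trans (powR_leD p0 p1 _ _))//; first exact: sumr_ge0.
by rewrite lerD2l.
Qed.

Lemma le_powR p x y : 0 <= p -> 0 <= x -> x <= y -> x `^ p <= y `^ p.
Proof.
move=> p0 x0 xy; apply: ge0_ler_powR => //; rewrite nnegrE//.
exact: le_trans xy.
Qed.

End PowR.

(** * Measurability and continuity of complex functions *)

Section ComplexFunctions.
Variable R : realType.
Implicit Types (f g : R -> R[i]) (p : R).

Lemma cmeasurableD f g : cmeasurable f -> cmeasurable g ->
  cmeasurable (fun x => f x + g x).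
Proof.
move=> [f1 f2] [g1 g2]; split.
  by under eq_fun do rewrite Re_add; exact: measurable_funD.
by under eq_fun do rewrite Im_add; exact: measurable_funD.
Qed.

Lemma cmeasurableM f g : cmeasurable f -> cmeasurable g ->
  cmeasurable (fun x => f x * g x).
Proof.
move=> [f1 f2] [g1 g2]; split.
  under eq_fun do rewrite Re_mul.
  by apply: measurable_funB; exact: measurable_funM.
under eq_fun do rewrite Im_mul.
by apply: measurable_funD; exact: measurable_funM.
Qed.

Lemma cmeasurable_cst (c : R[i]) : cmeasurable (fun _ : R => c).
Proof. by split; exact: measurable_cst. Qed.

Lemma cmeasurableN f : cmeasurable f -> cmeasurable (fun x => - f x).
Proof.
move=> mf; have := cmeasurableM (cmeasurable_cst (- 1)) mf.
by under eq_fun do rewrite mulN1r.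
Qed.

Lemma cmeasurableB f g : cmeasurable f -> cmeasurable g ->
  cmeasurable (fun x => f x - g x).
Proof. by move=> mf mg; apply: cmeasurableD => //; exact: cmeasurableN. Qed.

Lemma cmeasurable_sum I (s : seq I) (F : I -> R -> R[i]) :
  (forall i, cmeasurable (F i)) -> cmeasurable (fun x => \sum_(i <- s) F i x).
Proof.
move=> mF; elim: s => [|i s IH].
  under eq_fun do rewrite big_nil; exact: cmeasurable_cst.
by under eq_fun do rewrite big_cons; exact: cmeasurableD.
Qed.

Lemma measurable_nc f : cmeasurable f -> measurable_fun setT (fun x => nc (f x)).
Proof.
move=> [f1 f2].
under eq_fun do rewrite ncE -powR12_sqrt ?addr_ge0 ?sqr_ge0//.
apply: (measurableT_comp (measurable_powR _)).
by apply: measurable_funD; exact: measurable_funX.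
Qed.

Lemma measurable_nc_powR p f : cmeasurable f ->
  measurable_fun setT (fun x => (nc (f x) `^ p)%:E).
Proof.
move=> mf; apply/measurable_EFinP.
exact: (measurableT_comp (measurable_powR _) (measurable_nc mf)).
Qed.

Definition ccontinuous f :=
  continuous (fun x => complex.Re (f x)) /\
  continuous (fun x => complex.Im (f x)).

Lemma ccontinuous_measurable f : ccontinuous f -> cmeasurable f.
Proof. by case=> f1 f2; split; exact: continuous_measurable_fun. Qed.

Lemma ccontinuousD f g : ccontinuous f -> ccontinuous g ->
  ccontinuous (fun x => f x + g x).
Proof.
move=> [f1 f2] [g1 g2]; split => x.
  by under eq_fun do rewrite Re_add; apply: continuousD; [exact: f1|exact: g1].
by under eq_fun do rewrite Im_add; apply: continuousD; [exact: f2|exact: g2].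
Qed.

Lemma ccontinuousM f g : ccontinuous f -> ccontinuous g ->
  ccontinuous (fun x => f x * g x).
Proof.
move=> [f1 f2] [g1 g2]; split => x.
  under eq_fun do rewrite Re_mul.
  by apply: cvgB; apply: cvgM;
    solve [exact: f1|exact: g1|exact: f2|exact: g2].
under eq_fun do rewrite Im_mul.
by apply: cvgD; apply: cvgM;
  solve [exact: f1|exact: g1|exact: f2|exact: g2].
Qed.

Lemma ccontinuous_cst (c : R[i]) : ccontinuous (fun _ : R => c).
Proof. by split => x; exact: cst_continuous. Qed.

Lemma ccontinuous_sum I (s : seq I) (F : I -> R -> R[i]) :
  (forall i, ccontinuous (F i)) -> ccontinuous (fun x => \sum_(i <- s) F i x).
Proof.
move=> mF; elim: s => [|i s IH].
  under eq_fun do rewrite big_nil; exact: ccontinuous_cst.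
by under eq_fun do rewrite big_cons; exact: ccontinuousD.
Qed.

Lemma ccontinuous_cis (a b : R) : ccontinuous (fun x => cis (a * x + b)).
Proof.
split => x /=.
  apply: (@continuous_comp _ _ _ (fun x => a * x + b) cos); last exact: continuous_cos.
  by apply: continuousD; [exact: mulrl_continuous|exact: cst_continuous].
apply: (@continuous_comp _ _ _ (fun x => a * x + b) sin); last exact: continuous_sin.
by apply: continuousD; [exact: mulrl_continuous|exact: cst_continuous].
Qed.

Lemma ccontinuous_horner (P : {poly R[i]}) f : ccontinuous f ->
  ccontinuous (fun x => P.[f x]).
Proof.
move=> cf; elim/poly_ind: P => [|P c IH].
  by under eq_fun do rewrite horner0; exact: ccontinuous_cst.
under eq_fun do rewrite hornerMXaddC.
by apply: ccontinuousD (ccontinuous_cst c); exact: ccontinuousM.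
Qed.

Lemma continuous_powR_ge0 p : 0 < p -> forall f : R -> R, continuous f ->
  (forall x, 0 <= f x) -> continuous (fun x => f x `^ p).
Proof.
move=> p0 f cf f0 x.
have [fx0|fx0] := eqVneq (f x) 0; last first.
  apply: (@continuous_comp _ _ _ f (@powR R ^~ p)); first exact: cf.
  apply: differentiable_continuous; apply/derivable1_diffP.
  by apply: derivable_powR; rewrite in_itv/= andbT lt0r fx0 f0.
rewrite /continuous_at fx0 powR0 ?gt_eqF//.
apply/cvgrPdist_lt => e e0.
have : 0 < e `^ p^-1 by rewrite powR_gt0.
move: (cf x); rewrite /continuous_at fx0 => /cvgrPdist_lt h /h.
apply: filterS => t; rewrite !sub0r !normrN ger0_norm ?f0// => ft.
rewrite ger0_norm ?powR_ge0//.
have -> : e = (e `^ p^-1) `^ p.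
  by rewrite -powRrM mulVf ?gt_eqF// powRr1// ltW.
by apply: gt0_ltr_powR => //; rewrite nnegrE ?f0// powR_ge0.
Qed.

Lemma continuous_nc_powR p f : 0 < p -> ccontinuous f ->
  continuous (fun x => nc (f x) `^ p).
Proof.
move=> p0 [f1 f2]; apply: continuous_powR_ge0 => //; last by move=> x; exact: nc_ge0.
under eq_fun do rewrite ncE -powR12_sqrt ?addr_ge0 ?sqr_ge0//.
apply: continuous_powR_ge0 => //.
  by move=> x; apply: cvgD; under eq_fun do rewrite expr2; apply: cvgM;
    solve [exact: f1|exact: f2].
by move=> x; rewrite addr_ge0 ?sqr_ge0.
Qed.

End ComplexFunctions.

(** * Integrals over the circle and translation invariance *)

Section CircleIntegrals.
Variable R : realType.
Implicit Types (f g : R -> R[i]) (p : R).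
Notation mu := (@lebesgue_measure R).
Notation twopi := (pi *+ 2 : R).

Lemma twopi_gt0 : 0 < twopi.
Proof. by rewrite mulrn_wgt0// pi_gt0. Qed.

Lemma measurable_circle : measurable (@circle R).
Proof. exact: measurable_itv. Qed.

Lemma circle_measure : mu (@circle R) = twopi%:E.
Proof.
rewrite /circle lebesgue_measure_itv /= lte_fin twopi_gt0.
by rewrite -EFinD subr0.
Qed.

Definition Ip p f : \bar R := (\int[mu]_(x in @circle R) (nc (f x) `^ p)%:E)%E.

Lemma Ip_ge0 p f : (0 <= Ip p f)%E.
Proof. by apply: integral_ge0 => x _; rewrite lee_fin powR_ge0. Qed.

Lemma le_Ip p f g : 0 <= p -> cmeasurable f -> cmeasurable g ->
  (forall x, nc (f x) <= nc (g x)) -> (Ip p f <= Ip p g)%E.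
Proof.
move=> p0 mf mg fg; apply: ge0_le_integral => //.
- exact: measurable_circle.
- by move=> x _; rewrite lee_fin powR_ge0.
- exact: measurable_funTS (measurable_nc_powR p mf).
- exact: measurable_funTS (measurable_nc_powR p mg).
- by move=> x _; rewrite lee_fin le_powR// nc_ge0.
Qed.

Lemma eq_Ip p f g : (forall x, nc (f x) = nc (g x)) -> Ip p f = Ip p g.
Proof. by move=> fg; apply: eq_integral => x _; rewrite fg. Qed.

Lemma IpD p f g : 0 < p -> p <= 1 -> cmeasurable f -> cmeasurable g ->
  (Ip p (fun x => f x + g x)%R <= Ip p f + Ip p g)%E.
Proof.
move=> p0 p1 mf mg; rewrite -ge0_integralD//; first last.
- exact: measurable_funTS (measurable_nc_powR p mg).
- by move=> x _; rewrite lee_fin powR_ge0.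
- exact: measurable_funTS (measurable_nc_powR p mf).
- by move=> x _; rewrite lee_fin powR_ge0.
- exact: measurable_circle.
apply: ge0_le_integral => //.
- exact: measurable_circle.
- by move=> x _; rewrite lee_fin powR_ge0.
- exact: measurable_funTS (measurable_nc_powR p (cmeasurableD mf mg)).
- by apply: emeasurable_funD; exact: measurable_funTS (measurable_nc_powR p _).
- move=> x _; rewrite -EFinD lee_fin (le_trans _ (powR_leD p0 p1 _ _)) ?nc_ge0//.
  by rewrite le_powR ?(ltW p0) ?nc_ge0// le_normcD.
Qed.

Lemma IpN p f : Ip p (fun x => - f x) = Ip p f.
Proof. by apply: eq_Ip => x; rewrite normcN. Qed.

Lemma Ip0 p : 0 < p -> Ip p (fun=> 0) = 0%E.
Proof.
move=> p0; rewrite /Ip; under eq_integral do rewrite Normc.normc0 powR0 ?gt_eqF//.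
exact: integral0.
Qed.

Lemma IpB p f g : 0 < p -> p <= 1 -> cmeasurable f -> cmeasurable g ->
  (Ip p (fun x => f x - g x)%R <= Ip p f + Ip p g)%E.
Proof.
by move=> p0 p1 mf mg; rewrite -(IpN p g); apply: IpD => //; exact: cmeasurableN.
Qed.

Lemma Ip_sum p I (s : seq I) (F : I -> R -> R[i]) : 0 < p -> p <= 1 ->
  (forall i, cmeasurable (F i)) ->
  (Ip p (fun x => \sum_(i <- s) F i x)%R <= \sum_(i <- s) Ip p (F i))%E.
Proof.
move=> p0 p1 mF; elim: s => [|i s IH].
  by rewrite big_nil (@eq_Ip _ _ (fun=> 0)) ?Ip0// => x; rewrite big_nil.
rewrite big_cons (@eq_Ip _ _ (fun x => F i x + \sum_(j <- s) F j x)); last first.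
  by move=> x; rewrite big_cons.
apply: (le_trans (IpD p0 p1 (mF i) (cmeasurable_sum s mF))).
exact: leeD.
Qed.

Lemma IpZ p f (c : R[i]) : cmeasurable f ->
  Ip p (fun x => c * f x) = ((nc c `^ p)%:E * Ip p f)%E.
Proof.
move=> mf; rewrite /Ip -ge0_integralZl_EFin//.
- apply: eq_integral => x _; rewrite Normc.normcM powRM ?nc_ge0//.
- exact: measurable_circle.
- by move=> x _; rewrite lee_fin powR_ge0.
- exact: measurable_funTS (measurable_nc_powR p mf).
- exact: powR_ge0.
Qed.

Lemma continuous_circle_integrable (h : R -> R) : continuous h ->
  mu.-integrable (@circle R) (EFin \o h).
Proof.
move=> ch; apply: (@integrableS _ _ _ mu `[0, twopi]%classic (@circle R)) => //.
- exact: measurable_circle.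
- by move=> x; rewrite /circle /= !in_itv /= => /andP[-> /ltW ->].
- apply: continuous_compact_integrable; first exact: segment_compact.
  exact: continuous_subspaceT.
Qed.

Lemma Ip_lty p f : 0 < p -> ccontinuous f -> (Ip p f < +oo)%E.
Proof.
move=> p0 cf; apply: integrable_lty.
  exact: measurable_circle.
by apply: continuous_circle_integrable; exact: continuous_nc_powR.
Qed.

Lemma FTC_derive (h H : R -> R) (a b : R) : a < b ->
  (forall x : R, is_derive x (1 : R) H (h x)) -> continuous h ->
  (\int[mu]_(x in `[a, b]) (h x)%:E)%E = (H b - H a)%:E.
Proof.
move=> ab dH ch; rewrite EFinB; apply: continuous_FTC2 => //.
- exact: continuous_subspaceT.
- have cH x : {for x, continuous H}.
    apply: differentiable_continuous; apply/derivable1_diffP.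
    by have [] := dH x.
  split.
  + by move=> x _; have [] := dH x.
  + by apply: cvg_at_right_filter; exact: cH.
  + by apply: cvg_at_left_filter; exact: cH.
- by move=> x _; rewrite derive1E; have [] := dH x.
Qed.

Lemma integral_shift (h : R -> R) (t a b : R) : continuous h -> a < b ->
  (\int[mu]_(x in `[a, b]) (h (x + t))%:E =
   \int[mu]_(x in `[(a + t)%R, (b + t)%R]) (h x)%:E)%E.
Proof.
move=> ch ab.
have d x : is_derive x (1 : R) (fun y : R => y + t) 1.
  by apply: is_derive_eq; rewrite addr0.
have d1 : derive1 (fun y : R => y + t) = cst 1.
  by apply/funext => x; rewrite derive1E; have [] := d x.
have c x : {for x, continuous (fun y : R => y + t)}.
  by apply: differentiable_continuous; apply/derivable1_diffP; have [] := d x.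
rewrite (@integration_by_substitution_increasing _ (fun y => y + t) h a b).
- by apply: eq_integral => x _; rewrite d1 /= mulr1.
- exact: ltW.
- by move=> x y _ _ xy; rewrite ltrD2r.
- by rewrite d1 => x _; exact: cst_continuous.
- by rewrite d1; exact: is_cvg_cst.
- by rewrite d1; exact: is_cvg_cst.
- split; first by move=> x _; have [] := d x.
  + by apply: cvg_at_right_filter; exact: c.
  + by apply: cvg_at_left_filter; exact: c.
- exact: continuous_subspaceT.
Qed.

Lemma integral_circle (h : R -> R) : continuous h ->
  (\int[mu]_(x in @circle R) (h x)%:E = \int[mu]_(x in `[0%R, twopi]) (h x)%:E)%E.
Proof.
move=> ch; apply: integral_itv_bndo_bndc.
by apply/measurable_EFinP/measurable_funTS; exact: continuous_measurable_fun.
Qed.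

Lemma integral_itv_cat (h : R -> R) (a b c : R) : continuous h ->
  (forall x, 0 <= h x) -> a <= b -> b <= c ->
  (\int[mu]_(x in `[a, c]) (h x)%:E = \int[mu]_(x in `[a, b]) (h x)%:E +
   \int[mu]_(x in `[b, c]) (h x)%:E)%E.
Proof.
move=> ch h0 ab bc.
have mh D : measurable_fun D (EFin \o h).
  by apply/measurable_EFinP/measurable_funTS; exact: continuous_measurable_fun.
have -> : `[a, c]%classic = `[a, b[%classic `|` `[b, c]%classic :> set R.
  by rewrite -itv_bndbnd_setU// bnd_simp.
rewrite ge0_integral_setU//=.
- by rewrite (integral_itv_bndo_bndc (mh _)).
- exact: mh.
- by move=> x _; rewrite lee_fin.
- apply/disj_setPS => x [] /=; rewrite !in_itv /= => /andP[_ xb] /andP[bx _].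
  by move: (lt_le_trans xb bx); rewrite ltxx.
Qed.

Lemma circle_shift (h : R -> R) (t : R) : continuous h ->
  (forall x, 0 <= h x) -> periodic h twopi -> 0 <= t <= twopi ->
  (\int[mu]_(x in @circle R) (h (x + t))%:E =
   \int[mu]_(x in @circle R) (h x)%:E)%E.
Proof.
move=> ch h0 ph /andP[t0 t2].
rewrite integral_circle; last first.
  move=> x; apply: (@continuous_comp _ _ _ (fun y : R => y + t) h); last exact: ch.
  by apply: cvgD; [exact: cvg_id|exact: cvg_cst].
rewrite integral_circle// integral_shift ?twopi_gt0// add0r.
(* The window is now [[t, twopi + t]]; cut at [twopi], its end piece moves back by a period onto
   [[0, t]]. *)
rewrite (@integral_itv_cat _ _ twopi)//; last by rewrite lerDl.
rewrite [RHS](@integral_itv_cat _ _ t)// addeC; congr (_ + _)%E.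
have [<-|t1] := eqVneq 0 t; first by rewrite addr0 !set_itv1 !integral_set1.
have := @integral_shift h twopi 0 t ch.
rewrite add0r (addrC t) => <-; last by rewrite lt0r eq_sym t1.
by apply: eq_integral => x _; rewrite ph.
Qed.

(** With [u = y / 2] and [u cos u <= sin u], one gets [sin y = 2 sin u cos u >= 2 u cos^2 u = u (1 +
    cos y)], and [cos y >= 0] on this range. *)
Lemma sin_ge_half (y : R) : 0 <= y <= pi / 2 -> y / 2 <= sin y.
Proof.
move=> /andP[y0 y1].
have h (u : R) : 0 <= u <= pi / 2 -> u * cos u <= sin u.
  move=> /andP[u0 u1].
  have [|||c] := @MVT_segment R (fun u => sin u - u * cos u) (fun u => u * sin u) 0 u.
  - exact: u0.
  - by move=> x _; apply: is_derive_eq; rewrite /GRing.scale /=; ring.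
  - apply: continuous_subspaceT => x; apply: cvgB; first exact: continuous_sin.
    by apply: cvgM; [exact: cvg_id|exact: continuous_cos].
  rewrite in_itv /= => /andP[c0 cu]; rewrite sin0 mul0r !subr0 => e.
  rewrite -subr_ge0 e !mulr_ge0// sin_ge0_pi// c0 (le_trans cu)// (le_trans u1)//.
  by rewrite ler_pdivrMr// ler_pMr ?pi_gt0// ler1n.
pose u := y / 2.
have yu : y = u *+ 2 by rewrite /u mulr2n; field.
have u01 : 0 <= u <= pi / 2.
  by rewrite /u; apply/andP; split; lra.
have := h _ u01; have c0 : 0 <= cos y.
  by apply: cos_ge0_pihalf; rewrite y1 (le_trans _ y0)// oppr_le0 divr_ge0// pi_ge0.
have cu : 0 <= cos u.
  case/andP: u01 => u0 u1; apply: cos_ge0_pihalf.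
  by rewrite u1 (le_trans _ u0)// oppr_le0 divr_ge0// pi_ge0.
move/(ler_wpM2r cu) => H.
have -> : y / 2 = u by [].
have c2 : cos y = cos u ^+ 2 *+ 2 - 1 by rewrite yu cos_mulr2n.
have u0 : 0 <= u by case/andP: u01.
rewrite yu sin_mulr2n; nra.
Qed.

Lemma cos_quadratic (x : R) : 0 <= x <= pi -> (x / 2) ^+ 2 <= 2 - 2 * cos x.
Proof.
move=> /andP[x0 x1]; rewrite cos_half_sin.
have : x / 2 / 2 <= sin (x / 2).
  by apply: sin_ge_half; rewrite divr_ge0//= ler_pM2r.
by move=> h; rewrite lerXn2r ?nnegrE ?divr_ge0//; lra.
Qed.

(** Since [2 - 2 cos x >= (x / 2)^2] up to [pi], the weight lies below an arctangent density of
    width [1 / m], centred at 0 or, past [pi], at [twopi]. *)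
Lemma integral_kernel_weight (m : R) : 0 < m ->
  (\int[mu]_(x in @circle R) ((1 + m ^+ 2 * (2 - 2 * cos x))^-1)%:E <=
   (2 * pi / m)%:E)%E.
Proof.
move=> m0; pose a := m / 2; have a0 : 0 < a by rewrite divr_gt0.
(* Both densities are added, so that a single antiderivative [V] serves the whole circle. *)
pose v (x : R) := (1 + (a * x) ^+ 2)^-1 + (1 + (a * (twopi - x)) ^+ 2)^-1.
pose V (x : R) := a^-1 * atan (a * x) - a^-1 * atan (a * (twopi - x)).
have dV (x : R) : is_derive x (1 : R) V (v x).
  have d1 : is_derive x (1 : R) (fun y => a * y) a.
    by apply: is_derive_eq; rewrite /GRing.scale /=; ring.
  have d2 : is_derive x (1 : R) (fun y => a * (twopi - y)) (- a).
    by apply: is_derive_eq; rewrite /GRing.scale /=; ring.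
  have e1 := @is_derive1_comp _ _ _ _ _ _ (is_derive1_atan (a * x)) d1.
  have e2 := @is_derive1_comp _ atan (fun y : R => a * (twopi - y)) _ _ _
    (is_derive1_atan (a * (twopi - x))) d2.
  have := is_deriveB (is_deriveZ a^-1 e1) (is_deriveZ a^-1 e2).
  have -> : (a^-1 *: (atan \o (fun y : R => a * y)) -
    a^-1 *: (atan \o (fun y : R => a * (twopi - y)))) = V.
    by apply/funext => y.
  move=> d3; apply: (@is_derive_eq _ _ _ _ _ _ _ _ d3).
  rewrite /v /GRing.scale /=; field.
  rewrite (gt_eqF a0) !gt_eqF//; by rewrite ltr_pwDl// sqr_ge0.
have pos (y : R) : 1 + y ^+ 2 != 0 by rewrite gt_eqF// ltr_pwDl// sqr_ge0.
have cv : continuous v.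
  move=> x; apply: cvgD; apply: cvgV => //; apply: cvgD; try exact: cvg_cst.
    apply: (@continuous_comp _ _ _ (fun y : R => a * y) (fun y => y ^+ 2));
    last exact: exprn_continuous.
    exact: mulrl_continuous.
  apply: (@continuous_comp _ _ _ (fun y : R => a * (twopi - y)) (fun y => y ^+ 2)); last exact: exprn_continuous.
  by apply: cvgM; [exact: cvg_cst|apply: cvgB; [exact: cvg_cst|exact: cvg_id]].
have cpos x : 0 < 1 + m ^+ 2 * (2 - 2 * cos x).
  by rewrite ltr_pwDl// mulr_ge0 ?sqr_ge0// cos_half_sin sqr_ge0.
have mw : measurable_fun setT (fun x : R => ((1 + m ^+ 2 * (2 - 2 * cos x))^-1)%:E).
  apply/measurable_EFinP; apply: continuous_measurable_fun => x.
  apply: cvgV; first by rewrite gt_eqF.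
  apply: cvgD; first exact: cvg_cst.
  apply: cvgM; first exact: cvg_cst.
  apply: cvgB; first exact: cvg_cst.
  by apply: cvgM; [exact: cvg_cst|exact: continuous_cos].
apply: (@le_trans _ _ (\int[mu]_(x in @circle R) (v x)%:E)%E).
  apply: ge0_le_integral => //.
  - exact: measurable_circle.
  - by move=> x _; rewrite lee_fin invr_ge0 ltW.
  - exact: measurable_funTS mw.
  - by apply/measurable_EFinP/measurable_funTS; exact: continuous_measurable_fun.
  move=> x; rewrite /circle /= in_itv /= => /andP[x0 x2]; rewrite lee_fin /v.
  have h y : 0 <= y <= pi -> cos y = cos x ->
      (1 + m ^+ 2 * (2 - 2 * cos x))^-1 <= (1 + (a * y) ^+ 2)^-1.
    move=> yy yx; have py : 0 < 1 + (a * y) ^+ 2 by rewrite ltr_pwDl// sqr_ge0.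
    rewrite lef_pV2 ?posrE// lerD2l.
    have := cos_quadratic yy; rewrite yx => H.
    have -> : (a * y) ^+ 2 = m ^+ 2 * (y / 2) ^+ 2 by rewrite /a; field.
    by rewrite ler_wpM2l ?sqr_ge0.
  have vp (y : R) : 0 <= (1 + y ^+ 2)^-1 by rewrite invr_ge0 addr_ge0 ?sqr_ge0.
  have [xp|xp] := leP x pi.
    by rewrite (le_trans (h x _ _)) ?x0// lerDl vp.
  rewrite (le_trans (h (twopi - x) _ _)) ?lerDr ?vp//.
    rewrite subr_ge0 (ltW x2)/= mulr2n; lra.
  by rewrite addrC cosD2pi cosN.
rewrite integral_circle// (FTC_derive twopi_gt0 dV cv) lee_fin.
rewrite /V subrr subr0 !mulr0 atan0 mulr0 subr0 sub0r opprK -mulrDr.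
have -> : 2 * pi / m = a^-1 * (pi / 2 + pi / 2) by rewrite /a; field; rewrite gt_eqF.
by rewrite ler_pM2l ?invr_gt0// lerD// ltW// atan_ltpi2.
Qed.

End CircleIntegrals.

(** * Kernels of smooth multipliers *)

Section Kernels.
Variable R : realType.
Implicit Types (f g : R -> R[i]) (p : R) (P A : {poly R[i]}).
Notation mu := (@lebesgue_measure R).
Notation twopi := (pi *+ 2 : R).

Lemma ccontinuous_cis1 : ccontinuous (@cis R).
Proof.
have := @ccontinuous_cis R 1 0.
by under [X in ccontinuous X]funext do rewrite mul1r addr0.
Qed.

Lemma ccontinuous_horner_cis P : ccontinuous (fun x : R => P.[cis x]).
Proof. exact: ccontinuous_horner ccontinuous_cis1. Qed.

(** The two bounds combine to [|f| w^r <= 2^r B] with [w = 1 + m^2 |1 - e^(ix)|^2]. At the power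
    [p], [r p >= 1] leaves a factor [1 / w], whose integral is of order [1 / m]. *)
Lemma Ip_kernel p (r : nat) (m B : R) f : 0 < p -> 1 <= r%:R * p ->
  0 < m -> cmeasurable f ->
  (forall x, nc (f x) <= B) ->
  (forall x, nc (f x) * nc (1 - cis x) ^+ r.*2 * m ^+ r.*2 <= B) ->
  (Ip p f <= (((2 ^+ r * B) `^ p) * (2 * pi / m))%:E)%E.
Proof.
move=> p0 rp m0 mf fB fB'.
have B0 : 0 <= B by rewrite (le_trans (nc_ge0 (f 0))).
have cpos (x : R) : 1 <= 1 + m ^+ 2 * (2 - 2 * cos x).
  by rewrite lerDl mulr_ge0 ?sqr_ge0// cos_half_sin sqr_ge0.
have cpos' (x : R) : 0 < 1 + m ^+ 2 * (2 - 2 * cos x).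
  exact: lt_le_trans (cpos x).
have mw : measurable_fun setT (fun x : R => (1 + m ^+ 2 * (2 - 2 * cos x))^-1).
  apply: continuous_measurable_fun => x.
  apply: cvgV; first by rewrite gt_eqF.
  apply: cvgD; first exact: cvg_cst.
  apply: cvgM; first exact: cvg_cst.
  apply: cvgB; first exact: cvg_cst.
  by apply: cvgM; [exact: cvg_cst|exact: continuous_cos].
have key (x : R) : nc (f x) `^ p <=
    (2 ^+ r * B) `^ p * (1 + m ^+ 2 * (2 - 2 * cos x))^-1.
  set w := 1 + _; have w1 : 1 <= w := cpos x.
  have w0 : 0 < w := cpos' x.
  have h : nc (f x) * w ^+ r <= 2 ^+ r * B.
    (* [w] is at most twice the larger of its two summands, and each summand meets one of the two
       hypotheses. *)
    have [u1|u1] := leP (m ^+ 2 * (2 - 2 * cos x)) 1.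
      rewrite mulrC ler_pM ?nc_ge0 ?exprn_ge0 ?(ltW w0)//.
      by rewrite lerXn2r ?nnegrE ?(ltW w0)// /w; lra.
    have : w ^+ r <= (2 * (m ^+ 2 * (2 - 2 * cos x))) ^+ r.
      by rewrite lerXn2r ?nnegrE ?(ltW w0)//; rewrite /w; lra.
    rewrite -nc_1Bcis !exprMn => /(ler_wpM2l (nc_ge0 (f x)))/le_trans; apply.
    have := fB' x; rewrite -addnn !exprD => /(ler_wpM2l (exprn_ge0 r (ler0n _ 2))).
    by congr (_ <= _); ring.
  rewrite ler_pdivlMr//.
  apply: (@le_trans _ _ (nc (f x) `^ p * (w ^+ r) `^ p)).
    rewrite ler_wpM2l ?powR_ge0// -powR_mulrn ?(ltW w0)// -powRrM.
    exact: le1r_powR.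
  rewrite -powRM ?nc_ge0 ?exprn_ge0 ?(ltW w0)//.
  by rewrite le_powR ?(ltW p0)// mulr_ge0 ?nc_ge0// exprn_ge0 ?(ltW w0).
apply: (@le_trans _ _ (\int[mu]_(x in @circle R) (((2 ^+ r * B) `^ p)%:E *
    ((1 + m ^+ 2 * (2 - 2 * cos x))^-1)%:E))%E).
  apply: ge0_le_integral => //.
  - exact: measurable_circle.
  - by move=> x _; rewrite lee_fin powR_ge0.
  - exact: measurable_funTS (measurable_nc_powR p mf).
  - apply: measurable_funTS; apply/measurable_EFinP.
    by apply: measurable_funM => //; exact: measurable_cst.
  - by move=> x _; rewrite -EFinM lee_fin.
rewrite ge0_integralZl_EFin ?powR_ge0//.
- by rewrite EFinM lee_wpmul2l ?lee_fin ?powR_ge0// integral_kernel_weight.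
- exact: measurable_circle.
- by move=> x _; rewrite lee_fin invr_ge0 ltW.
- by apply: measurable_funTS; apply/measurable_EFinP.
Qed.

Lemma nc_horner_le P n (B : R) (z : R[i]) : (size P <= n)%N ->
  (forall k, nc P`_k <= B) -> nc z = 1 -> nc P.[z] <= n%:R * B.
Proof.
move=> sP PB z1; rewrite (horner_coef_wide _ sP) (le_trans (nc_sum _ _ _))//.
apply: (@le_trans _ _ (\sum_(i < n) B)); last first.
  by rewrite sumr_const card_ord mulr_natl.
by apply: ler_sum => i _; rewrite Normc.normcM ncX z1 expr1n mulr1.
Qed.

Definition rpoly n (a : R -> R) : {poly R[i]} := \poly_(k < n) (a k%:R)%:C%C.

(** Multiplication by [1 - X] takes backward differences of the coefficients, hence the argument
    [k - i]. As [a] vanishes outside [[0, n)], the truncation creates no boundary terms. *)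
Lemma coef_diff_rpoly n (a : R -> R) i k :
  (forall x, x < 0 -> a x = 0) -> (forall x, n%:R <= x -> a x = 0) ->
  ((1 - 'X) ^+ i * rpoly n a)`_k = (ndiff i a (k%:R - i%:R))%:C%C.
Proof.
move=> a0 an; elim: i k => [|i IH] k.
  rewrite expr0 mul1r coef_poly subr0 /ndiff /=.
  by case: ltnP => // nk; rewrite an// ler_nat.
rewrite exprS -mulrA mulrBl mul1r coefB coefXM !IH ndiffS.
have -> : k%:R - i.+1%:R + 1 = k%:R - i%:R :> R by rewrite -natr1; ring.
case: k => [|k] /=; last first.
  by rewrite rmorphB /= -!natr1 opprD addrACA subrr addr0.
rewrite (@ndiff_eq0 _ i a (0 - i.+1%:R)) ?subr0// => t ti; apply: a0.
by rewrite add0r addrC subr_lt0 ltr_nat ltnS.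
Qed.

(** The plain bound on [a] and the bound on its differences of order [2 r] feed the kernel estimate;
    [(c + r.*2) * m] bounds the number of coefficients in both cases. *)
Lemma Ip_rpoly p r (c m n : nat) (a : R -> R) (A : R) :
  0 < p -> 1 <= r%:R * p -> (0 < m)%N -> (n <= c * m)%N -> 0 <= A ->
  (forall x, x < 0 -> a x = 0) -> (forall x, n%:R <= x -> a x = 0) ->
  (forall x, `|a x| <= A) ->
  (forall x, `|ndiff r.*2 a x| <= A * m%:R^-1 ^+ r.*2) ->
  (Ip p (fun x => (rpoly n a).[cis x]) <=
   ((2 ^+ r * ((c + r.*2) * m)%:R * A) `^ p * (2 * pi / m%:R))%:E)%E.
Proof.
move=> p0 rp m0 nc' A0 a0 an aA aD; rewrite -mulrA.
have m0' : 0 < m%:R :> R by rewrite ltr0n.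
apply: Ip_kernel => //.
- exact: ccontinuous_measurable (ccontinuous_horner_cis _).
- move=> x; apply: nc_horner_le.
  + rewrite (leq_trans (size_poly _ _))// (leq_trans nc')// leq_mul2r.
    by rewrite leq_addr orbT.
  + move=> k; rewrite coef_poly; case: ifP => _; first by rewrite nc_real.
    by rewrite Normc.normc0.
  + exact: nc_cis.
move=> x; have -> : nc (rpoly n a).[cis x] * nc (1 - cis x) ^+ r.*2 =
    nc ((1 - 'X) ^+ r.*2 * rpoly n a).[cis x].
  rewrite hornerM Normc.normcM horner_exp ncX mulrC.
  by rewrite !hornerE.
rewrite -ler_pdivlMr ?exprn_gt0// -mulrA -exprVn.
apply: nc_horner_le.
- rewrite (leq_trans (size_polyMleq _ _))//.
  have s1 : (size ((1 - 'X : {poly R[i]}) ^+ r.*2) <= r.*2.+1)%N.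
    rewrite (leq_trans (size_poly_exp_leq _ _))//.
    have -> : size (1 - 'X : {poly R[i]}) = 2.
      by rewrite -opprB size_polyN size_XsubC.
    by rewrite mul1n.
  have := leq_add s1 (size_poly n (fun k => (a k%:R)%:C%C)).
  rewrite addSn mulnDl => /(leq_sub2r 1); rewrite !subn1 /= => /leq_trans; apply.
  by rewrite addnC leq_add// leq_pmulr.
- by move=> k; rewrite coef_diff_rpoly// nc_real.
- exact: nc_cis.
Qed.

(** The kernel has height of order [m ^ (g + 1)] on an arc of length [1 / m] and decays beyond it,
    whence the exponent [g p + p - 1]. *)
Lemma Ip_plateau_kernel p (g : R) r c : 0 < p -> 1 <= r%:R * p -> (0 < c)%N ->
  exists2 C : R, 0 < C & forall m, (0 < m)%N ->
  (Ip p (fun x => (rpoly (r.*2.+1 * (c * m))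
      (fun x => plateau r.*2 c m x * x `^ g)).[cis x])%R <=
   (C * m%:R `^ (g * p + p - 1))%:E)%E.
Proof.
move=> p0 rp c0; have [A A0 HA] := plateau_powR_le r.*2 g c0.
pose C := (2 ^+ r * (r.*2.+1 * c + r.*2)%:R * A) `^ p * (2 * pi).
have pi0 : 0 < 2 * pi :> R by rewrite mulr_gt0 ?pi_gt0.
exists C.
  by rewrite mulr_gt0// powR_gt0// !mulr_gt0 ?exprn_gt0// ltr0n ltn_addr// muln_gt0.
move=> m m0; have [H1 H2] := HA m m0.
have m0' : 0 < m%:R :> R by rewrite ltr0n.
have := @Ip_rpoly p r (r.*2.+1 * c)%N m (r.*2.+1 * (c * m))%N _
  (A * m%:R `^ g) p0 rp m0 _ _ _ _ H1 H2.
move=> /(_ _ _ _ _)/le_trans; apply.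
- by rewrite mulnA.
- by rewrite mulr_ge0 ?powR_ge0 ?(ltW A0).
- by move=> x x0; rewrite plateau_low ?mul0r// (lt_trans x0).
- by move=> x xm; rewrite plateau_high ?mul0r.
rewrite lee_fin /C natrM.
have -> : 2 ^+ r * ((r.*2.+1 * c + r.*2)%:R * m%:R) * (A * m%:R `^ g) =
  (2 ^+ r * (r.*2.+1 * c + r.*2)%:R * A) * (m%:R * m%:R `^ g) :> R by ring.
rewrite powRM ?mulr_ge0 ?powR_ge0 ?exprn_ge0 ?(ltW A0)//.
rewrite (powRM _ (ltW m0') (powR_ge0 _ _)) -powRrM.
rewrite powRB ?powRD ?powRr1 ?(ltW m0') ?(gt_eqF m0') ?implybT//.
rewrite le_eqVlt; apply/orP; left; apply/eqP; field.
by rewrite (gt_eqF m0').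
Qed.

End Kernels.

(** * Convolution of polynomials by quadrature *)

Section Convolution.
Variable R : realType.
Implicit Types (f g : R -> R[i]) (p : R) (P A : {poly R[i]}).
Notation mu := (@lebesgue_measure R).
Notation twopi := (pi *+ 2 : R).

Lemma sume_const_ord (x : \bar R) n : (0 <= x)%E ->
  (\sum_(i < n) x = n%:R%:E * x)%E.
Proof.
move=> x0; elim: n => [|n IH]; first by rewrite big_ord0 mul0e.
by rewrite big_ord_recr/= IH -natr1 EFinD ge0_muleDl ?mul1e ?lee_fin.
Qed.

Lemma Ip_shift p f (t : R) : 0 < p -> ccontinuous f -> periodic f twopi ->
  0 <= t <= twopi -> Ip p (fun x => f (x + t)) = Ip p f.
Proof.
move=> p0 cf pf t01.
apply: (@circle_shift R (fun x => nc (f x) `^ p)) => //.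
- exact: continuous_nc_powR.
- by move=> x; exact: powR_ge0.
- by move=> x; rewrite pf.
Qed.

Lemma sum_cis_root (L k k' : nat) : (k < L)%N -> (k' < L)%N ->
  \sum_(l < L) (cis (twopi / L%:R) ^+ k' / cis (twopi / L%:R) ^+ k) ^+ l =
  if k == k' then L%:R else 0 :> R[i].
Proof.
move=> kL k'L; set u := cis _.
have L0 : 0 < L%:R :> R by rewrite ltr0n (leq_ltn_trans _ kL).
have u0 : u != 0 := cis_neq0 _.
have uX n : u ^+ n != 0 by rewrite expf_neq0.
have uL : u ^+ L = 1.
  by rewrite /u cisX mulrCA mulfV ?gt_eqF// mulr1 cis2pi.
have [->|kk'] := eqVneq k k'.
  rewrite (eq_bigr (fun=> 1)); first by rewrite sumr_const card_ord.
  by move=> l _; rewrite divff// expr1n.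
have x1 : u ^+ k' / u ^+ k != 1.
  have low i j : (i < j)%N -> (j < L)%N -> u ^+ j != u ^+ i.
    move=> ij jL; rewrite -(subnKC (ltnW ij)) exprD -subr_eq0.
    rewrite -[X in _ - X]mulr1 -mulrBr mulf_neq0// subr_eq0 /u cisX cis_eq1//.
    have d0 : (0 < j - i)%N by rewrite subn_gt0.
    rewrite mulrA; apply/andP; split.
      by rewrite divr_gt0// mulr_gt0 ?ltr0n ?twopi_gt0.
    rewrite ltr_pdivrMr// mulrC ltr_pM2l ?twopi_gt0// ltr_nat.
    by rewrite (leq_ltn_trans (leq_subr _ _)).
  rewrite -subr_eq0 -(divff (uX k)) -mulrBl mulf_neq0 ?invr_eq0// subr_eq0.
  have [kk|kk|] := ltngtP k k'; [exact: low| |by move=> h; rewrite h eqxx in kk'].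
  by rewrite eq_sym low.
apply/eqP; rewrite -(inj_eq (mulfI (_ : u ^+ k' / u ^+ k - 1 != 0))) ?subr_eq0//.
rewrite -subrX1 mulr0 exprMn exprVn -!exprM -!(mulnC L) !exprM uL !expr1n.
by rewrite invr1 mulr1 subrr.
Qed.

(** The normalised convolution of [A] and [P], as functions of [e^(ix)], when [L] bounds their
    sizes. *)
Definition hadamard L A P : {poly R[i]} := \poly_(k < L) (A`_k * P`_k).

(** Exponents below [L] are separated by the [L]-th roots of unity, so summing over the nodes keeps
    only equal frequencies. The convolution integral becomes a finite sum, to which p-subadditivity
    applies. *)
Lemma quadrature (L : nat) A P (x s : R) :
  (size A <= L)%N -> (size P <= L)%N ->
  \sum_(l < L) P.[cis (s + l%:R * (twopi / L%:R))] *
     A.[cis (x - (s + l%:R * (twopi / L%:R)))] =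
  L%:R * (hadamard L A P).[cis x].
Proof.
move=> sA sP; set u := cis (twopi / L%:R).
rewrite (eq_bigr (fun l : 'I_L => \sum_(k' < L) \sum_(k < L)
   (P`_k' * A`_k * cis x ^+ k * (cis s ^+ k' / cis s ^+ k)) *
   (u ^+ k' / u ^+ k) ^+ l)); last first.
  move=> l _; rewrite (horner_coef_wide _ sA) (horner_coef_wide _ sP).
  rewrite big_distrlr /=; apply: eq_bigr => k' _; apply: eq_bigr => k _.
  rewrite !cisD !cisN !cisD -!cisX -/u.
  rewrite invfM !exprMn !exprVn -!exprM !(mulnC l).
  ring.
rewrite exchange_big /=.
rewrite (eq_bigr (fun k' : 'I_L => L%:R * (P`_k' * A`_k' * cis x ^+ k'))); last first.
  move=> k' _; rewrite exchange_big /=.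
  rewrite (bigD1 k')//= -mulr_sumr sum_cis_root// eqxx divff ?expf_neq0 ?cis_neq0//.
  rewrite mulr1 big1 ?addr0 1?mulrC// => k kk'.
  by rewrite -mulr_sumr sum_cis_root// val_eqE (negbTE kk') mulr0.
rewrite -mulr_sumr /hadamard horner_poly; congr (_ * _).
by apply: eq_bigr => k _; rewrite (mulrC P`_k).
Qed.

Lemma integral_sum_Ip I (s : seq I) p (G : I -> R -> R[i]) (c : \bar R) :
  (0 <= c)%E -> c \is a fin_num -> (forall i, cmeasurable (G i)) ->
  (\int[mu]_(x in @circle R) (\sum_(i <- s) (nc (G i x) `^ p)%:E * c) =
   \sum_(i <- s) (Ip p (G i) * c))%E.
Proof.
move=> c0 cfin mG.
have mGp i : measurable_fun (@circle R) (fun x => (nc (G i x) `^ p)%:E).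
  exact: measurable_funTS (measurable_nc_powR p (mG i)).
have Gp0 i x : (0 <= (nc (G i x) `^ p)%:E)%E by rewrite lee_fin powR_ge0.
rewrite ge0_integral_sum.
- apply: eq_bigr => i _; rewrite ge0_integralZr//.
  + exact: measurable_circle.
  + exact: mGp.
- exact: measurable_circle.
- by move=> i; rewrite -(fineK cfin); apply: emeasurable_funM;
    [exact: mGp|exact: measurable_cst].
- by move=> i x _; exact: mule_ge0.
Qed.

Lemma Ip_horner_shift p P (a b : R) : 0 < p -> 0 <= a <= twopi ->
  Ip p (fun x => P.[cis (x + a + b)]) = Ip p (fun x => P.[cis (x + b)]).
Proof.
move=> p0 a2; apply: (@Ip_shift p (fun x => P.[cis (x + b)])) => //.
- apply: ccontinuous_horner; have := @ccontinuous_cis R 1 b.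
  by under [X in ccontinuous X]funext do rewrite mul1r.
- by move=> x; rewrite addrAC cisD2pi.
Qed.

(* The quadrature formula holds for every shift [s] of the nodes; averaging over
   [s] replaces the sum over the nodes by the integral of [|P|^p]. *)
Lemma Ip_hadamard p (L : nat) A P : 0 < p -> p <= 1 -> (0 < L)%N ->
  (size A <= L)%N -> (size P <= L)%N ->
  (((twopi * L%:R `^ p)%:E * Ip p (fun x => (hadamard L A P).[cis x])%R) <=
   L%:R%:E * (Ip p (fun x => A.[cis x])%R * Ip p (fun x => P.[cis x])%R))%E.
Proof.
move=> p0 p1 L0 sA sP.
have L0' : 0 < L%:R :> R by rewrite ltr0n.
have mhc (Q : {poly R[i]}) : cmeasurable (fun x : R => Q.[cis x]).
  exact: ccontinuous_measurable (ccontinuous_horner_cis Q).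
have finA : Ip p (fun x => A.[cis x]) \is a fin_num.
  by rewrite ge0_fin_numE ?Ip_ge0// Ip_lty//; exact: ccontinuous_horner_cis.
pose t (l : 'I_L) : R := l%:R * (twopi / L%:R).
have t01 l : 0 <= t l <= twopi.
  rewrite /t mulr_ge0 ?divr_ge0 ?(ltW (twopi_gt0 R))//=.
  rewrite mulrCA ler_piMr ?(ltW (twopi_gt0 R))// ler_pdivrMr// mul1r.
  by rewrite ler_nat ltnW.
have pt s : s \in @circle R -> (((L%:R `^ p)%:E *
     Ip p (fun x => (hadamard L A P).[cis x])%R) <=
     \sum_(l < L) (nc (P.[cis (s + t l)]) `^ p)%:E * Ip p (fun x => A.[cis x])%R)%E.
  rewrite inE /circle /= in_itv /= => /andP[s0 s2].
  have <- : nc (L%:R : R[i]) = L%:R.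
    by rewrite -(rmorph_nat (real_complex R)) nc_real ger0_norm.
  rewrite -IpZ//.
  rewrite (@eq_Ip _ _ _ (fun x => \sum_(l < L) (fun x => P.[cis (s + t l)] *
     A.[cis (x - (s + t l))]) x)); last by move=> x /=; rewrite quadrature.
  have shA (l : 'I_L) : ccontinuous (fun x => A.[cis (x - (s + t l))]).
    apply: ccontinuous_horner.
    have := @ccontinuous_cis R 1 (- (s + t l)).
    by under [X in ccontinuous X]funext do rewrite mul1r.
  apply: (le_trans (Ip_sum _ p0 p1 _)) => [l|].
    apply: ccontinuous_measurable; apply: ccontinuousM => //.
    exact: ccontinuous_cst.
  apply: lee_sum => l _; rewrite IpZ; last exact: ccontinuous_measurable.
  have /andP[tl0 tl2] := t01 l.
  (* Translation invariance is stated for shifts in [[0, twopi]], so each of the two negative shifts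
     is completed by a period. *)
  have -> : Ip p (fun x => A.[cis (x - (s + t l))]) =
    Ip p (fun x => A.[cis (x + (twopi - t l) + (twopi - s))]).
    apply: eq_Ip => x; congr (nc _); congr (_.[_]).
    rewrite -(cisD2pi (x - _)) -(cisD2pi (x - _ + _)); congr cis; ring.
  rewrite (Ip_horner_shift A _ p0); last by rewrite subr_ge0 tl2/= gerBl.
  have -> : Ip p (fun x => A.[cis (x + (twopi - s))]) = Ip p (fun x => A.[cis (x + (twopi - s) + 0)]).
    by apply: eq_Ip => x; rewrite addr0.
  rewrite (Ip_horner_shift A _ p0); last by rewrite subr_ge0 (ltW s2)/= gerBl.
  by have -> : Ip p (fun x => A.[cis (x + 0)]) = Ip p (fun x => A.[cis x]);
    [apply: eq_Ip => x; rewrite addr0|].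
have mP l : cmeasurable (fun s : R => P.[cis (s + t l)]).
  apply: ccontinuous_measurable; apply: ccontinuous_horner.
  have := @ccontinuous_cis R 1 (t l).
  by under [X in ccontinuous X]funext do rewrite mul1r.
have H0 : (0 <= (L%:R `^ p)%:E * Ip p (fun x => (hadamard L A P).[cis x])%R)%E.
  by rewrite mule_ge0 ?Ip_ge0// lee_fin powR_ge0.
apply: (@le_trans _ _ (\int[mu]_(s in @circle R) ((L%:R `^ p)%:E *
     Ip p (fun x => (hadamard L A P).[cis x])%R))%E).
  rewrite integral_cst; last exact: measurable_circle.
  by rewrite [X in (_ <= _ * X)%E]circle_measure [leRHS]muleC muleA -EFinM.
apply: (@le_trans _ _ (\int[mu]_(s in @circle R) (\sum_(l < L)
    (nc (P.[cis (s + t l)]) `^ p)%:E * Ip p (fun x => A.[cis x])%R))%E).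
  apply: ge0_le_integral => //.
  - exact: measurable_circle.
  - apply: measurable_funTS; apply: emeasurable_sum => l.
    by rewrite -(fineK finA); apply: emeasurable_funM; [exact: measurable_nc_powR|exact: measurable_cst].
  - by move=> s sc; apply: pt; rewrite inE.
have A0 : (0 <= Ip p (fun x => A.[cis x]))%E by exact: Ip_ge0.
rewrite (integral_sum_Ip _ p (G := fun l s => P.[cis (s + t l)]) A0 finA mP).
have tl l : Ip p (fun x => P.[cis (x + t l)]) = Ip p (fun x => P.[cis x]).
  have := Ip_horner_shift P 0 p0 (t01 l).
  by under [X in Ip p X = _ -> _]funext do rewrite addr0;
     under [X in _ = Ip p X -> _]funext do rewrite addr0.
rewrite (eq_bigr (fun=> (Ip p (fun x => A.[cis x])%R * Ip p (fun x => P.[cis x])%R)%E)).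
  by rewrite sume_const_ord ?mule_ge0 ?Ip_ge0.
by move=> l _; rewrite tl; exact: muleC.
Qed.

End Convolution.

(** * Trigonometric polynomials given by their coefficients *)

Section TrigPolynomials.
Variable R : realType.
Implicit Types (p x : R) (n : nat) (c d h : int -> R[i]) (k : int).
Notation twopi := (pi *+ 2 : R).

Definition tp n c (x : R) : R[i] :=
  \sum_(j < n.*2.+1) c (j%:Z - n%:Z) * cis ((j%:Z - n%:Z)%:~R * x).

Definition tpoly n c : {poly R[i]} := \poly_(j < n.*2.+1) c (j%:Z - n%:Z).

Lemma tp_horner n c x : tp n c x = cis (- (n%:R * x)) * (tpoly n c).[cis x].
Proof.
rewrite /tpoly horner_poly mulr_sumr; apply: eq_bigr => j _.
rewrite cisX mulrCA -cisD; congr (_ * cis _).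
by rewrite rmorphB /= -!pmulrn; ring.
Qed.

(** The factor [e^(-inx)] is unimodular: all [Ip] estimates pass to ordinary polynomials in
    [e^(ix)]. *)
Lemma nc_tp n c x : nc (tp n c x) = nc (tpoly n c).[cis x].
Proof. by rewrite tp_horner Normc.normcM nc_cis mul1r. Qed.

Lemma ccontinuous_tp n c : ccontinuous (tp n c).
Proof.
apply: ccontinuous_sum => j; apply: ccontinuousM; first exact: ccontinuous_cst.
have := @ccontinuous_cis R ((j%:Z - n%:Z)%:~R) 0.
by under [X in ccontinuous X]funext do rewrite addr0.
Qed.

Lemma cmeasurable_tp n c : cmeasurable (tp n c).
Proof. exact: ccontinuous_measurable (ccontinuous_tp n c). Qed.

Lemma Ip_tp_lty p n c : 0 < p -> (Ip p (tp n c) < +oo)%E.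
Proof. by move=> p0; apply: Ip_lty => //; exact: ccontinuous_tp. Qed.

Lemma Ip_tp_fin p n c : 0 < p -> Ip p (tp n c) \is a fin_num.
Proof. by move=> p0; rewrite ge0_fin_numE ?Ip_ge0// Ip_tp_lty. Qed.

Lemma index_range n (j : 'I_(n.*2.+1)) : (`|j%:Z - n%:Z| <= n)%N.
Proof. by have := ltn_ord j; lia. Qed.

Lemma eq_tp n c d : (forall k, (`|k| <= n)%N -> c k = d k) -> tp n c = tp n d.
Proof.
move=> cd; apply/funext => x; apply: eq_bigr => j _; rewrite cd//.
exact: index_range.
Qed.

Lemma tpD n c d x : tp n (fun k => c k + d k) x = tp n c x + tp n d x.
Proof. by rewrite -big_split; apply: eq_bigr => j _; rewrite mulrDl. Qed.

Lemma tpZ n (z : R[i]) c x : tp n (fun k => z * c k) x = z * tp n c x.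
Proof. by rewrite mulr_sumr; apply: eq_bigr => j _; rewrite mulrA. Qed.

Lemma tpB n c d x : tp n (fun k => c k - d k) x = tp n c x - tp n d x.
Proof.
rewrite -[X in _ = _ + X]mulN1r -tpZ -tpD; congr (tp _ _ _).
by apply/funext => k; rewrite mulN1r.
Qed.

Lemma tp_sum n I (s : seq I) (C : I -> int -> R[i]) x :
  tp n (fun k => \sum_(i <- s) C i k) x = \sum_(i <- s) tp n (C i) x.
Proof.
by rewrite exchange_big; apply: eq_bigr => j _; rewrite mulr_suml.
Qed.

Lemma tp_widenS n c x : (forall k, (n < `|k|)%N -> c k = 0) ->
  tp n.+1 c x = tp n c x.
Proof.
move=> c0; rewrite /tp doubleS big_ord_recl big_ord_recr /=.
rewrite !c0 ?mul0r ?add0r ?addr0; [|rewrite /bump; lia|lia].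
apply: eq_bigr => j _; rewrite /bump /= add1n.
by have -> : (j.+1%:Z - n.+1%:Z)%R = (j%:Z - n%:Z)%R by lia.
Qed.

Lemma tp_widen m n c : (forall k, (n < `|k|)%N -> c k = 0) -> (n <= m)%N ->
  tp m c = tp n c.
Proof.
move=> c0 nm; rewrite -(subnK nm); elim: (m - n)%N => [//|i IH].
rewrite addSn; apply/funext => x; rewrite tp_widenS ?IH// => k ik.
by apply: c0; rewrite (leq_ltn_trans _ ik)// leq_addl.
Qed.

(** [tp n c] only reads [c] on [[-n, n]]; clearing the rest allows the degree to be widened. *)
Definition truncate n c k : R[i] := if (`|k| <= n)%N then c k else 0.

Lemma truncate0 n c k : (n < `|k|)%N -> truncate n c k = 0.
Proof. by rewrite /truncate ltnNge => /negbTE ->. Qed.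

Lemma tp_truncate n c : tp n (truncate n c) = tp n c.
Proof. by apply: eq_tp => k kn; rewrite /truncate kn. Qed.

Lemma trig_polyP n (T : R -> R[i]) : trig_poly n T ->
  exists2 c, T = tp n c & forall k, (n < `|k|)%N -> c k = 0.
Proof.
move=> [c Tc]; exists (truncate n c); last exact: truncate0.
by rewrite tp_truncate; apply/funext.
Qed.

Lemma size_tpoly n c : (size (tpoly n c) <= n.*2.+1)%N.
Proof. exact: size_poly. Qed.

(** With [L = 2 n + 1] nodes there are [L] terms against the normalisation [L ^ p], hence the loss
    [L ^ (1 - p)]; the factor [twopi >= 1] is dropped. *)
Lemma Ip_tp_mul p n h c (K : R) : 0 < p -> p <= 1 -> 0 <= K ->
  (Ip p (tp n h) <= K%:E)%E ->
  (Ip p (tp n (fun k => h k * c k)%R) <=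
   (K * n.*2.+1%:R `^ (1 - p))%:E * Ip p (tp n c))%E.
Proof.
move=> p0 p1 K0 hK.
have L0 : 0 < n.*2.+1%:R :> R by rewrite ltr0n.
have := Ip_hadamard p0 p1 (ltn0Sn _) (size_tpoly n h) (size_tpoly n c).
have -> : hadamard n.*2.+1 (tpoly n h) (tpoly n c) =
    tpoly n (fun k => h k * c k).
  apply/polyP => i; rewrite !coef_poly; case: ifP => // ->//.
rewrite -!(eq_Ip p (nc_tp n _)) => H.
have pos : 0 < twopi * n.*2.+1%:R `^ p by rewrite mulr_gt0 ?twopi_gt0 ?powR_gt0.
rewrite -(@lee_pmul2l _ (twopi * n.*2.+1%:R `^ p)%:E) ?lte_fin//.
apply: (le_trans H).
apply: (@le_trans _ _ (n.*2.+1%:R%:E * (K%:E * Ip p (tp n c)))%E).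
  by rewrite lee_wpmul2l// lee_wpmul2r ?Ip_ge0.
rewrite !muleA -!EFinM lee_wpmul2r ?Ip_ge0// lee_fin.
rewrite -mulrA (mulrCA (_ `^ p)) -powRD; last by rewrite addrC subrK oner_eq0.
rewrite addrC subrK powRr1 ?(ltW L0)//.
have : 1 <= twopi by rewrite mulr2n; have := pi_ge2 R; lra.
by move=> h1; rewrite (mulrC _ K) ler_peMl// mulr_ge0// ltW.
Qed.

Lemma Ip_tp_rpoly p n (N : nat) (a : R -> R) :
  (forall x, x < 0 -> a x = 0) -> (forall x, N%:R <= x -> a x = 0) ->
  (N <= n.+1)%N ->
  Ip p (tp n (fun k => (a k%:~R)%:C%C)) = Ip p (fun x => (rpoly N a).[cis x]).
Proof.
move=> a0 aN Nn; apply: eq_Ip => x; rewrite nc_tp.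
have -> : tpoly n (fun k => (a k%:~R)%:C%C) = 'X^n * rpoly N a.
  apply/polyP => i; rewrite coefXnM !coef_poly.
  have [il|il] := ltnP i n.
    rewrite a0; last by rewrite ltrz0; lia.
    by rewrite if_same.
  have e : (i%:Z - n%:Z)%:~R = (i - n)%:R :> R.
    by rewrite subzn// -pmulrn.
  rewrite e; case: ltnP => i1; case: ltnP => i2 //.
    by rewrite aN// ler_nat.
  by exfalso; move: i1 i2 Nn; rewrite -addnn; lia.
by rewrite hornerM hornerXn Normc.normcM ncX nc_cis expr1n mul1r.
Qed.

Lemma tp_opp n c x : tp n (fun k => c (- k)) x = tp n c (- x).
Proof.
rewrite /tp (reindex_inj rev_ord_inj) /=; apply: eq_bigr => j _.
have -> : - ((n.*2.+1 - j.+1)%N%:Z - n%:Z) = j%:Z - n%:Z :> int.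
  by have := ltn_ord j; lia.
have -> : ((n.*2.+1 - j.+1)%N%:Z - n%:Z) = - (j%:Z - n%:Z) :> int.
  by have := ltn_ord j; lia.
by rewrite rmorphN /= mulNr mulrN.
Qed.

(** For real coefficients, reflecting the frequencies is conjugation, so negative frequencies cost
    the same as positive ones. *)
Lemma nc_tp_opp n (a : int -> R) x :
  nc (tp n (fun k => (a (- k))%:C%C) x) = nc (tp n (fun k => (a k)%:C%C) x).
Proof.
rewrite (tp_opp n (fun k => (a k)%:C%C)).
have -> : tp n (fun k => (a k)%:C%C) (- x) =
    conjc (tp n (fun k => (a k)%:C%C) x).
  rewrite rmorph_sum; apply: eq_bigr => j _.
  by apply: complex_eq; rewrite /= mulrN cosN sinN; ring.
by rewrite !ncE; case: (tp _ _ _) => u v /=; rewrite sqrrN.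
Qed.

End TrigPolynomials.

(** * Dyadic decomposition of [(ik)^g] *)

Section Multipliers.
Variable R : realType.
Implicit Types (p x g alpha : R) (n r m : nat) (c d h : int -> R[i]) (k : int).

Lemma powR_gt1 (a t : R) : 1 < a -> 0 < t -> 1 < a `^ t.
Proof.
move=> a1 t0; rewrite /powR gt_eqF ?(lt_trans _ a1)//.
by rewrite expR_gt1 mulr_gt0// ln_gt0.
Qed.

Lemma Ip_cis p (t : R) (f : R -> R[i]) :
  Ip p (fun x => cis t * f x) = Ip p f.
Proof. by apply: eq_Ip => x; rewrite Normc.normcM nc_cis mul1r. Qed.

Definition ik_mult (b : R -> R) g k : R[i] := (b `|k%:~R|)%:C%C * ik_pow g k.

(** The phase of [(ik)^g] is constant on each side of 0, so each half is a one-sided real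
    multiplier. Where the base of the power is negative, [powR] returns a default value, which
    [b = 0] removes. *)
Lemma ik_multE (b : R -> R) g : (forall x, x <= 0 -> b x = 0) ->
  forall k, ik_mult b g k =
  cis (g * pi / 2) * ((b k%:~R * k%:~R `^ g)%:C)%C +
  cis (- (g * pi / 2)) * ((b (- k)%:~R * (- k)%:~R `^ g)%:C)%C.
Proof.
move=> b0 k; rewrite /ik_mult /ik_pow.
have [k0|k0|->] := ltgtP k 0.
- rewrite (b0 k%:~R) ?lerz0 ?(ltW k0)// mul0r rmorph0 mulr0 add0r.
  rewrite ltr0_norm ?ltrz0// ltr0_sgz// rmorphN1 mulrN1.
  by rewrite rmorphN /= mulrA -rmorphM /= mulrC.
- rewrite (b0 (- k)%:~R) ?lerz0 ?oppr_le0 ?(ltW k0)// mul0r rmorph0 mulr0 addr0.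
  by rewrite gtr0_norm ?ltr0z// gtr0_sgz// mulr1 mulrA -rmorphM /= mulrC.
- by rewrite oppr0 normr0 b0// rmorph0 !mul0r rmorph0 !mulr0 addr0.
Qed.

Lemma Ip_ik_plateau p g r : 0 < p -> p <= 1 -> 1 <= r%:R * p ->
  exists2 C : R, 0 < C & forall m n, (0 < m)%N ->
  (r.*2.+1 * (2 * m) <= n.+1)%N ->
  (Ip p (tp n (ik_mult (plateau r.*2 2 m) g)) <=
   (C * m%:R `^ (g * p + p - 1))%:E)%E.
Proof.
move=> p0 p1 rp; have [C C0 HC] := Ip_plateau_kernel g p0 rp (isT : 0 < 2)%N.
exists (C + C); first exact: addr_gt0.
move=> m n m0 mn; have m0' : 0 < m%:R :> R by rewrite ltr0n.
pose a x := plateau r.*2 2 m x * x `^ g.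
rewrite (@eq_Ip _ _ _ (fun x =>
    cis (g * pi / 2) * tp n (fun k => (a k%:~R)%:C%C) x +
    cis (- (g * pi / 2)) * tp n (fun k => (a (- k)%:~R)%:C%C) x)); last first.
  move=> x; rewrite -!tpZ -tpD; congr (nc (tp _ _ _)); apply/funext => k.
  by rewrite ik_multE// => y y0; rewrite plateau_low// (le_lt_trans y0).
have mt c z : cmeasurable (fun x => z * tp n c x).
  by apply: cmeasurableM; [exact: cmeasurable_cst|exact: cmeasurable_tp].
apply: (le_trans (IpD p0 p1 (mt _ _) (mt _ _))).
rewrite !Ip_cis (mulrDl C C) EFinD.
rewrite (eq_Ip _ (nc_tp_opp n (fun k => a k%:~R))).
rewrite (@Ip_tp_rpoly _ _ _ (r.*2.+1 * (2 * m)) a)//; first exact: leeD (HC _ m0) (HC _ m0).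
- by move=> x x0; rewrite /a plateau_low ?mul0r// (lt_trans x0).
- by move=> x xm; rewrite /a plateau_high ?mul0r.
Qed.

Definition window q (i j : nat) (x : R) : R :=
  cutoff q (2 ^ j) x - cutoff q (2 ^ i) x.

Lemma window_sum q (i j : nat) x : (i <= j)%N ->
  window q i j x = \sum_(i <= l < j) plateau q 2 (2 ^ l) x.
Proof.
move=> ij; rewrite /window -(telescope_sumr (fun l => cutoff q (2 ^ l) x) ij).
by apply: eq_bigr => l _; rewrite /plateau -expnS.
Qed.

(** p-subadditivity over the dyadic pieces; the ratio [2 ^ (g p + p - 1)] decides which end of the
    sum dominates. *)
Lemma Ip_ik_window p g r : 0 < p -> p <= 1 -> 1 <= r%:R * p ->
  exists2 C : R, 0 < C & forall i j n, (i <= j)%N ->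
  (r.*2.+1 * 2 ^ j <= n.+1)%N ->
  (Ip p (tp n (ik_mult (window r.*2 i j) g)) <=
   (C * \sum_(i <= l < j) (2 `^ (g * p + p - 1)) ^+ l)%:E)%E.
Proof.
move=> p0 p1 rp; have [C C0 HC] := Ip_ik_plateau g p0 p1 rp.
exists C => // i j n ij jn.
rewrite (@eq_Ip _ _ _ (fun x => \sum_(l <- index_iota i j)
    tp n (ik_mult (plateau r.*2 2 (2 ^ l)) g) x)); last first.
  move=> x; rewrite -tp_sum; congr (nc (tp _ _ _)); apply/funext => k.
  by rewrite /ik_mult window_sum// rmorph_sum mulr_suml.
apply: (le_trans (Ip_sum _ p0 p1 _)) => [l|]; first exact: cmeasurable_tp.
rewrite mulr_sumr -sumEFin big_seq [leRHS]big_seq; apply: lee_sum => l.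
rewrite mem_index_iota => /andP[_ lj].
apply: (le_trans (HC (2 ^ l)%N n _ _)); rewrite ?expn_gt0//.
  rewrite -expnS (leq_trans _ jn)// leq_mul2l leq_exp2l// lj orbT.
rewrite lee_fin natrX -(powR_mulrn l (ler0n _ 2)) -powRrM (mulrC l%:R) powRrM.
by rewrite powR_mulrn ?powR_ge0.
Qed.

Lemma geometric_sum_le (x : R) (i j : nat) : 0 < x -> x < 1 ->
  \sum_(i <= l < j) x ^+ l <= x ^+ i / (1 - x).
Proof.
move=> x0 x1; have h : 0 < 1 - x by rewrite subr_gt0.
rewrite ler_pdivlMr//; have [ij|ji] := leqP i j; last first.
  by rewrite big_geq ?(ltnW ji)// mul0r exprn_ge0 ?(ltW x0).
have -> : (\sum_(i <= l < j) x ^+ l) * (1 - x) = x ^+ i - x ^+ j.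
  rewrite -opprB -[in RHS]opprB -(telescope_sumr (fun l => x ^+ l) ij).
  rewrite mulrN mulr_suml; congr (- _); apply: eq_bigr => l _.
  by rewrite exprS; ring.
by rewrite gerBl exprn_ge0 ?ltW.
Qed.

Lemma geometric_sum_ge (x : R) (i j : nat) : 1 < x ->
  \sum_(i <= l < j) x ^+ l <= x ^+ j / (x - 1).
Proof.
move=> x1; have x0 : 0 < x by rewrite (lt_trans _ x1).
have h : 0 < x - 1 by rewrite subr_gt0.
rewrite ler_pdivlMr//; have [ij|ji] := leqP i j; last first.
  by rewrite big_geq ?(ltnW ji)// mul0r exprn_ge0 ?(ltW x0).
have -> : (\sum_(i <= l < j) x ^+ l) * (x - 1) = x ^+ j - x ^+ i.
  rewrite -(telescope_sumr (fun l => x ^+ l) ij).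
  rewrite mulr_suml; apply: eq_bigr => l _.
  by rewrite exprS; ring.
by rewrite gerBl exprn_ge0 ?ltW.
Qed.

Lemma dyadic_bounds n : (0 < n)%N ->
  exists2 j, (n < 2 ^ j)%N & (0 < j)%N /\ (2 ^ j <= 2 * n)%N.
Proof.
move=> n0; exists (trunc_log 2 n).+1; first by have /andP[] := trunc_log_bounds (isT : 1 < 2)%N n0.
by split => //; rewrite expnS leq_mul2l /= trunc_logP.
Qed.

Lemma power_window_bound p r n j : p <= 1 -> (0 < n)%N -> (2 ^ j <= 2 * n)%N ->
  (r.*2.+1 * 2 ^ j).*2.+1%:R `^ (1 - p) <=
  (8 * r.*2.+1)%:R `^ (1 - p) * n%:R `^ (1 - p) :> R.
Proof.
move=> p1 n0 jn; rewrite -powRM// le_powR ?subr_ge0// -natrM ler_nat.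
have : (r.*2.+1 * 2 ^ j <= r.*2.+1 * (2 * n))%N by rewrite leq_mul2l jn orbT.
have : (0 < r.*2.+1 * n)%N by rewrite muln_gt0.
lia.
Qed.

(* The Bernstein factor [n ^ alpha * rho alpha p n] is the size of the dyadic
   sum of the kernel quasi-norms, up to the factor [n ^ (1/p - 1)] lost in the
   convolution inequality. *)
Lemma dyadic_rho p alpha : 0 < p -> p < 1 -> 0 < alpha ->
  alpha \isn't a Num.nat \/ p^-1 - 1 < alpha ->
  exists2 C : R, 0 < C & forall n j, (0 < n)%N -> (2 ^ j <= 2 * n)%N ->
  n%:R `^ (1 - p) * \sum_(0 <= l < j) (2 `^ (alpha * p + p - 1)) ^+ l <=
  C * n%:R `^ (alpha * p) * rho alpha p n `^ p.
Proof.
move=> p0 p1 a0 an; set t := alpha * p + p - 1.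
(* The sign of [t] is that of [alpha - (1/p - 1)]: the sum is comparable to its last term, or
   bounded, or made of [j] terms equal to 1. These are the three cases of [rho]. *)
have te : t = p * (alpha - (p^-1 - 1)) by rewrite /t; field; rewrite gt_eqF.
have [at0|at0|at0] := ltgtP (p^-1 - 1) alpha.
- have t0 : 0 < t by rewrite te mulr_gt0// subr_gt0.
  have x1 : 1 < 2 `^ t by rewrite powR_gt1// ltr1n.
  exists (2 `^ t / (2 `^ t - 1)).
    by rewrite divr_gt0 ?powR_gt0// subr_gt0.
  move=> n j n0 jn; rewrite /rho at0 orbT powR1 mulr1.
  have n0' : 0 < n%:R :> R by rewrite ltr0n.
  have -> : alpha * p = (1 - p) + t by rewrite /t; ring.
  rewrite (@powRD _ _ (1 - p) t) ?(gt_eqF n0') ?implybT//.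
  rewrite [leRHS]mulrCA ler_wpM2l ?powR_ge0//.
  apply: (le_trans (geometric_sum_ge _ _ x1)).
  rewrite mulrAC ler_wpM2r ?invr_ge0 ?subr_ge0 ?(ltW x1)//.
  rewrite -powRM// -powR_mulrn ?powR_ge0// -powRrM mulrC powRrM powR_mulrn//.
  by rewrite le_powR ?(ltW t0)// -natrX -natrM ler_nat.
- have t0 : t < 0 by rewrite te pmulr_rlt0// subr_lt0.
  have x1 : 2 `^ t < 1.
    by rewrite -(opprK t) powRN invf_lt1 ?powR_gt0// powR_gt1 ?ltr1n ?oppr_gt0.
  case: an => [an|]; last by move/lt_trans => /(_ _ at0); rewrite ltxx.
  exists (1 - 2 `^ t)^-1; first by rewrite invr_gt0 subr_gt0.
  move=> n j n0 jn; rewrite /rho (negbTE an) (ltNge (p^-1 - 1)) (ltW at0) /= lt_eqF//.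
  have n0' : 0 < n%:R :> R by rewrite ltr0n.
  rewrite -powRrM -mulrA -powRD ?(gt_eqF n0') ?implybT//.
  have -> : alpha * p + (p^-1 - 1 - alpha) * p = 1 - p.
    by field; rewrite gt_eqF.
  rewrite mulrC ler_wpM2r ?powR_ge0//.
  apply: (le_trans (geometric_sum_le _ _ _ x1)); first exact: powR_gt0.
  by rewrite expr0 mul1r.
- have t0 : t = 0 by rewrite te at0 subrr mulr0.
  case: an => [an|]; last by rewrite at0 ltxx.
  have l2 : 0 < ln 2 :> R by rewrite ln_gt0// ltr1n.
  exists (2 / ln 2); first by rewrite divr_gt0.
  move=> n j n0 jn; rewrite /rho (negbTE an) at0 ltxx eqxx /=.
  have n0' : 0 < n%:R :> R by rewrite ltr0n.
  have l0 : 0 <= ln n.+1%:R :> R by rewrite ln_ge0// ler1n.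
  rewrite -(powRrM _ p^-1) mulVf ?gt_eqF// powRr1// -at0.
  have -> : (p^-1 - 1) * p = 1 - p by rewrite mulrBl mul1r mulVf ?gt_eqF.
  rewrite [leRHS]mulrAC [leRHS]mulrC ler_wpM2l ?powR_ge0//.
  rewrite t0 powRr0 (eq_bigr (fun=> 1)); last by move=> l _; rewrite expr1n.
  rewrite sumr_const_nat subn0 mulrAC ler_pdivlMr//.
  (* [j ln 2 <= ln (2 n) <= 2 ln (n + 1)], as [2 n <= (n + 1)^2]. *)
  have -> : j%:R * ln 2 = ln (2 ^ j)%:R :> R.
    by rewrite natrX lnXn// mulr_natl.
  have -> : 2 * ln n.+1%:R = ln (n.+1 ^ 2)%:R :> R.
    by rewrite natrX lnXn// mulr_natl.
  rewrite ler_ln ?posrE ?ltr0n ?expn_gt0// ler_nat (leq_trans jn)//.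
  by rewrite expnS expn1; lia.
Qed.

End Multipliers.

(** * Bernstein inequalities and the high-pass multiplier *)

Section BernsteinJackson.
Variable R : realType.
Implicit Types (p x g alpha : R) (n r m : nat) (c d h : int -> R[i]) (k : int).

Lemma ex_order p : 0 < p -> exists r : nat, 1 <= r%:R * p.
Proof.
move=> p0; exists (Num.Def.archi_bound p^-1).
rewrite -ler_pdivrMr// mul1r ltW//.
by rewrite archi_boundP// invr_ge0 ltW.
Qed.

Lemma norm_intr k : `|k%:~R| = (absz k)%:R :> R.
Proof. by rewrite -intr_norm -abszE. Qed.

Lemma window_eq q (i j : nat) k : (absz k < 2 ^ j)%N ->
  window q i j `|k%:~R : R| = 1 - cutoff q (2 ^ i) `|k%:~R : R|.
Proof.
by move=> kj; rewrite /window cutoff_eq1 ?expn_gt0// norm_intr ltr_nat.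
Qed.

(** On [1 <= |k| <= n] the window from scale 1 to scale [2^j > n] equals 1, so dyadic pieces
    reproduce the multiplier exactly. The condition on [alpha] sets aside the natural values for
    which the dyadic sum would lose more than [rho = 1]. *)
Lemma bernstein_dyadic p alpha : 0 < p -> p < 1 -> 0 < alpha ->
  alpha \isn't a Num.nat \/ p^-1 - 1 < alpha ->
  exists2 C : R, 0 < C & forall n c, (0 < n)%N ->
  (Ip p (tp n (fun k => ik_pow alpha k * c k)%R) <=
   (C * (n%:R `^ (alpha * p) * rho alpha p n `^ p))%:E * Ip p (tp n c))%E.
Proof.
move=> p0 p1 a0 an; have [r rp] := ex_order p0.
have [C C0 HC] := Ip_ik_window alpha p0 (ltW p1) rp.
have [D D0 HD] := dyadic_rho p0 p1 a0 an.
pose B : R := (8 * r.*2.+1)%:R `^ (1 - p).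
have B0 : 0 < B by rewrite powR_gt0// ltr0n muln_gt0.
exists (C * (B * D)); first by rewrite !mulr_gt0.
move=> n c n0; have [j nj [j0 jn]] := dyadic_bounds n0.
pose M := (r.*2.+1 * 2 ^ j)%N.
have nM : (n <= M)%N by rewrite (leq_trans (ltnW nj))// leq_pmull.
pose s := \sum_(0 <= l < j) (2 `^ (alpha * p + p - 1)) ^+ l.
have s0 : 0 <= s by apply: sumr_ge0 => l _; rewrite exprn_ge0 ?powR_ge0.
have Cs0 : 0 <= C * s by rewrite mulr_ge0// ltW.
have := Ip_tp_mul (truncate n c) p0 (ltW p1) Cs0 (HC 0%N j M isT (leqnSn _)).
have -> : tp M (truncate n c) = tp n c.
  by rewrite (tp_widen (@truncate0 _ n c) nM) tp_truncate.
have -> : tp M (fun k => ik_mult (window r.*2 0 j) alpha k * truncate n c k) =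
   tp n (fun k => ik_pow alpha k * c k).
  rewrite (@tp_widen _ _ n) //; last by move=> k nk; rewrite truncate0 ?mulr0.
  apply: eq_tp => k kn; rewrite /truncate kn; congr (_ * _); rewrite /ik_mult.
  rewrite window_eq; last by rewrite (leq_ltn_trans kn).
  (* At [k = 0] both sides vanish because [alpha > 0]; the cutoff at scale [2^0] is 0 from [|k| = 1]
     on. *)
  have [->|k0] := eqVneq k 0.
    by rewrite /ik_pow normr0 powR0 ?gt_eqF// mul0r mulr0.
  rewrite cutoff_eq0// ?subr0 ?mul1r// expn0 subrr mulr0 addr0 norm_intr.
  by rewrite ler1n absz_gt0.
move=> /le_trans; apply; rewrite lee_wpmul2r ?Ip_ge0// lee_fin.
rewrite -!mulrA ler_wpM2l ?(ltW C0)//.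
apply: (@le_trans _ _ (s * (B * n%:R `^ (1 - p)))).
  by rewrite ler_wpM2l//; exact: (power_window_bound r (ltW p1) n0 jn).
rewrite mulrCA ler_wpM2l ?(ltW B0)// mulrC mulrA.
exact: HD.
Qed.

(** Translating the frequencies multiplies by the unimodular [e^(isx)]. *)
Lemma nc_tp_shift n (M s : nat) d x : (forall k, (n < absz k)%N -> d k = 0) ->
  (n + s <= M)%N -> nc (tp M (fun k => d (k - s%:Z)) x) = nc (tp n d x).
Proof.
move=> d0 nsM; rewrite !nc_tp.
have -> : tpoly M (fun k => d (k - s%:Z)) = 'X^(M + s - n) * tpoly n d.
  apply/polyP => i; rewrite coefXnM !coef_poly.
  have [il|il] := ltnP i (M + s - n)%N.
    by rewrite d0 ?if_same//; lia.
  have -> : ((i - (M + s - n))%N%:Z - n%:Z) = (i%:Z - M%:Z - s%:Z) :> int by lia.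
  case: ltnP => i1; case: ltnP => i2 //; first by rewrite d0//; lia.
  by exfalso; move: il i1 i2 nsM; rewrite -!addnn; lia.
by rewrite hornerM hornerXn Normc.normcM ncX nc_cis expr1n mul1r.
Qed.

(* Frequencies are translated by [(q + 2) n], so that multiplication by the
   frequency becomes a smooth multiplier supported away from 0. *)
Lemma bernstein1 p : 0 < p -> p < 1 ->
  exists2 C : R, 0 < C & forall n c, (0 < n)%N ->
  (Ip p (tp n (fun k => (k%:~R)%:C%C * c k)%R) <=
   (C * n%:R `^ p)%:E * Ip p (tp n c))%E.
Proof.
move=> p0 p1; have [r rp] := ex_order p0; pose q := r.*2.
have [C C0 HC] := Ip_plateau_kernel 1 p0 rp (isT : 0 < q.+4)%N.
pose B : R := (3 * (q.+1 * q.+4))%:R `^ (1 - p).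
have B0 : 0 < B by rewrite powR_gt0// ltr0n !muln_gt0.
exists (C * B + q.+2%:R `^ p).
  by rewrite addr_gt0 ?mulr_gt0// powR_gt0// ltr0n.
move=> n c n0; have n0' : 0 < n%:R :> R by rewrite ltr0n.
(* For [|k| <= n] the translated frequency [k + s] lies between [(q + 1) n] and [(q + 3) n], where
   the plateau of ratio [q + 4] equals 1. *)
pose M := (q.+1 * (q.+4 * n))%N; pose s := (q.+2 * n)%N.
have nsM : (n + s <= M)%N.
  by rewrite /M /s -mulSn mulnA leq_mul2r; apply/orP; right; nia.
pose a x := plateau q q.+4 n x * x `^ 1.
pose c0 := truncate n c.
pose K : R := C * n%:R `^ (1 * p + p - 1).
have K0 : 0 <= K by rewrite mulr_ge0 ?powR_ge0 ?(ltW C0).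
have HK : (Ip p (tp M (fun k => (a k%:~R)%:C%C)) <= K%:E)%E.
  rewrite (@Ip_tp_rpoly _ _ _ M a)//; first exact: HC.
  - by move=> x x0; rewrite /a plateau_low ?mul0r// (lt_trans x0).
  - by move=> x xm; rewrite /a plateau_high ?mul0r.
have := Ip_tp_mul (fun k => c0 (k - s%:Z)) p0 (ltW p1) K0 HK.
pose e k := (k%:~R + s%:R)%:C%C * c0 k.
have -> : Ip p (tp M (fun k => c0 (k - s%:Z))) = Ip p (tp n c).
  rewrite (eq_Ip _ (fun x => nc_tp_shift x (@truncate0 _ n c) nsM)).
  by rewrite tp_truncate.
have -> : Ip p (tp M (fun k => (a k%:~R)%:C%C * c0 (k - s%:Z))) = Ip p (tp n e).
  have e0 k : (n < absz k)%N -> e k = 0 by move=> nk; rewrite /e /c0 truncate0 ?mulr0.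
  rewrite -(eq_Ip _ (fun x => nc_tp_shift x e0 nsM)).
  congr (Ip _ (tp _ _)); apply/funext => k; rewrite /e.
  have [kn|kn] := leqP (absz (k - s%:Z)) n; last by rewrite /c0 truncate0 ?mulr0.
  congr (_%:C%C * _); rewrite /a.
  have k1 : ((q.+1 * n)%N%:Z <= k) && (k < (q.+4 * n)%N%:Z).
    move: kn; rewrite /s !mulSn; move: n0; lia.
  have k0 : 0 <= k by case/andP: k1 => + _; apply: le_trans.
  rewrite plateau_eq1 ?powRr1 ?ler0z ?mul1r//.
    by rewrite rmorphB /= -!pmulrn subrK.
  by case/andP: k1 => k1 k2; rewrite !pmulrn ler_int ltr_int k1 k2.
move=> He.
(* [k = (k + s) - s]; the subtracted multiple of the polynomial gives the second summand of the
   constant. *)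
have -> : tp n (fun k => (k%:~R)%:C%C * c k) =
    (fun x => tp n e x - (s%:R)%:C%C * tp n c x).
  apply/funext => x; rewrite -tpZ -tpB; congr (_ x); apply: eq_tp => k kn.
  by rewrite /e /c0 /truncate kn rmorphD /= mulrDl addrK.
have mt z : cmeasurable (fun x => z * tp n c x).
  by apply: cmeasurableM; [exact: cmeasurable_cst|exact: cmeasurable_tp].
apply: (le_trans (IpB p0 (ltW p1) (cmeasurable_tp _ _) (mt _))).
rewrite IpZ; last exact: cmeasurable_tp.
rewrite mulrDl EFinD ge0_muleDl; last 2 first.
- by rewrite lee_fin !mulr_ge0 ?powR_ge0 ?(ltW C0) ?(ltW B0).
- by rewrite lee_fin mulr_ge0 ?powR_ge0.
apply: leeD; last first.
  by rewrite lee_wpmul2r ?Ip_ge0// lee_fin nc_real ger0_norm// /s natrM powRM.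
apply: (le_trans He); rewrite lee_wpmul2r ?Ip_ge0// lee_fin /K.
rewrite -!mulrA ler_wpM2l ?(ltW C0)//.
have -> : p = (1 * p + p - 1) + (1 - p) by ring.
rewrite [X in _ <= _ * X]powRD ?(gt_eqF n0') ?implybT//.
have -> : 1 * p + p - 1 + (1 - p) = p by ring.
rewrite [leRHS]mulrCA ler_wpM2l ?powR_ge0//.
rewrite /B -powRM// le_powR ?subr_ge0 ?(ltW p1)// -natrM ler_nat /M.
have : (0 < q.+1 * (q.+4 * n))%N by rewrite !muln_gt0.
rewrite -!mulnA; lia.
Qed.

Lemma bernstein_nat p m : 0 < p -> p < 1 ->
  exists2 C : R, 0 < C & forall n c, (0 < n)%N ->
  (Ip p (tp n (fun k => ((k%:~R)%:C%C ^+ m * c k)%R)) <=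
   (C * n%:R `^ (m%:R * p))%:E * Ip p (tp n c))%E.
Proof.
move=> p0 p1; have [D D0 HD] := bernstein1 p0 p1.
elim: m => [|m [C C0 HC]].
  exists 1 => // n c n0; rewrite mul0r powRr0 mulr1 mul1e.
  by rewrite (_ : (fun k => _) = c)//; apply/funext => k; rewrite expr0 mul1r.
exists (D * C); first exact: mulr_gt0.
move=> n c n0; have n0' : 0 < n%:R :> R by rewrite ltr0n.
rewrite (_ : (fun k => _) = (fun k => (k%:~R)%:C%C * ((k%:~R)%:C%C ^+ m * c k))); last first.
  by apply/funext => k; rewrite exprS mulrA.
apply: (le_trans (HD _ _ n0)).
apply: (@le_trans _ _ ((D * n%:R `^ p)%:E *
   ((C * n%:R `^ (m%:R * p))%:E * Ip p (tp n c)))%E).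
  by rewrite lee_wpmul2l ?HC// lee_fin mulr_ge0 ?powR_ge0 ?(ltW D0).
rewrite muleA -EFinM lee_wpmul2r ?Ip_ge0// lee_fin -nat1r mulrDl mul1r.
by rewrite powRD ?(gt_eqF n0') ?implybT// mulrACA.
Qed.

(** The jump of the phase across 0 is [(-1)^m], exactly the parity of [k^m]: for natural exponents
    the symbol is smooth at 0, which is why [rho = 1] there. *)
Lemma ik_pow_nat m k : (0 < m)%N ->
  ik_pow (m%:R : R) k = cis (m%:R * pi / 2) * (k%:~R)%:C%C ^+ m.
Proof.
move=> m0; rewrite /ik_pow -rmorphXn /= mulrC.
have [k0|k0|->] := ltgtP k 0.
- rewrite ltr0_norm ?ltrz0// ltr0_sgz// rmorphN1 mulrN1 powR_mulrn; last first.
    by rewrite oppr_ge0 lerz0 ltW.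
  rewrite exprNn rmorphM /= mulrA; congr (_ * _).
  have -> : cis (m%:R * pi / 2) = cis (- (m%:R * pi / 2)) * cis (m%:R * pi) :> R[i].
    by rewrite -cisD; congr cis; field.
  congr (_ * _); rewrite -cisX /cis cospi sinpi rmorphXn /= rmorphN1.
  by congr (_ ^+ _); apply: complex_eq; rewrite /= ?oppr0.
- by rewrite gtr0_norm ?ltr0z// gtr0_sgz// mulr1 powR_mulrn// ler0z ltW.
- by rewrite normr0 expr0n powR0 ?pnatr_eq0 -?lt0n// gtn_eqF//= !mulr0.
Qed.

Lemma bernstein p alpha : 0 < p -> p < 1 -> 0 < alpha ->
  exists2 C : R, 0 < C & forall n c, (0 < n)%N ->
  (Ip p (tp n (fun k => ik_pow alpha k * c k)%R) <=
   (C * (n%:R `^ (alpha * p) * rho alpha p n `^ p))%:E * Ip p (tp n c))%E.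
Proof.
move=> p0 p1 a0; have [an|an] := boolP (alpha \is a Num.nat); last first.
  by apply: bernstein_dyadic => //; left.
have [m am] := natrP an.
have m0 : (0 < m)%N by rewrite -(ltr0n R) -am.
have [C C0 HC] := bernstein_nat m p0 p1.
exists C => // n c n0; rewrite /rho an /= powR1 mulr1 {2}am.
rewrite (@eq_Ip _ _ _ (fun x => cis (m%:R * pi / 2) *
   tp n (fun k => (k%:~R)%:C%C ^+ m * c k) x)) ?Ip_cis; first exact: HC.
move=> x; rewrite -tpZ; congr (nc (tp _ _ _)); apply/funext => k.
by rewrite am ik_pow_nat// mulrA.
Qed.

(** The exponent is negative, so the lowest dyadic piece, at scale [2^i] comparable to [n],
    dominates; [N ^ (1 - p)] is the price of the convolution. The first condition on [i] keeps [2^i]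
    from being too small, the second keeps [i] from exceeding the top scale. *)
Lemma highpass p g r : 0 < p -> p <= 1 -> 1 <= r%:R * p -> g * p + p - 1 < 0 ->
  exists2 C : R, 0 < C & forall n N i c, (0 < n)%N -> (n <= N)%N ->
  (n < r.*2.+1 * 2 ^ i.+1)%N -> (2 ^ i <= n.+1)%N ->
  (Ip p (tp N (fun k => ((1 - cutoff r.*2 (2 ^ i) `|k%:~R|)%:C%C *
       ik_pow g k * c k)%R)) <=
   (C * (n%:R `^ (g * p + p - 1) * N%:R `^ (1 - p)))%:E * Ip p (tp N c))%E.
Proof.
move=> p0 p1 rp; set t := g * p + p - 1 => t0.
have [C C0 HC] := Ip_ik_window g p0 p1 rp.
pose B : R := (8 * r.*2.+1)%:R `^ (1 - p).
have B0 : 0 < B by rewrite powR_gt0// ltr0n muln_gt0.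
have x1 : 2 `^ t < 1.
  by rewrite -(opprK t) powRN invf_lt1 ?powR_gt0// powR_gt1 ?ltr1n ?oppr_gt0.
have x0 : 0 < 2 `^ t by rewrite powR_gt0.
(* [2^i > n / (2 (2 r + 1))] is raised to the negative power [t], and the geometric series is
   summed. *)
pose D : R := (r.*2.+1 * 2)%:R `^ (- t) / (1 - 2 `^ t).
have D0 : 0 < D by rewrite divr_gt0 ?powR_gt0 ?ltr0n ?muln_gt0// subr_gt0.
exists (C * (B * D)); first exact: mulr_gt0 C0 (mulr_gt0 B0 D0).
move=> n N i c n0 nN ni ni'.
have n0' : 0 < n%:R :> R by rewrite ltr0n.
have N0 : (0 < N)%N by rewrite (leq_trans n0).
have [j Nj [j0 jN]] := dyadic_bounds N0.
have ij : (i <= j)%N.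
  rewrite -(leq_exp2l i j (isT : 1 < 2)%N); apply: (leq_trans ni').
  by apply: leq_trans Nj; rewrite ltnS.
pose M := (r.*2.+1 * 2 ^ j)%N.
have NM : (N <= M)%N by rewrite (leq_trans (ltnW Nj))// leq_pmull.
pose s := \sum_(i <= l < j) (2 `^ t) ^+ l.
have s0 : 0 <= s by apply: sumr_ge0 => l _; rewrite exprn_ge0 ?powR_ge0.
have Cs0 : 0 <= C * s by rewrite mulr_ge0// ltW.
have := Ip_tp_mul (truncate N c) p0 p1 Cs0 (HC i j M ij (leqnSn _)).
have -> : tp M (truncate N c) = tp N c.
  by rewrite (tp_widen (@truncate0 _ N c) NM) tp_truncate.
rewrite (@tp_widen _ M N) //; last by move=> k nk; rewrite truncate0 ?mulr0.
rewrite (@eq_tp _ N _ (fun k => (1 - cutoff r.*2 (2 ^ i) `|k%:~R|)%:C%C * ik_pow g k * c k)); last first.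
  move=> k kn; rewrite /truncate kn; congr (_ * _); rewrite /ik_mult.
  by rewrite window_eq// (leq_ltn_trans kn).
move=> /le_trans; apply; rewrite lee_wpmul2r ?Ip_ge0// lee_fin.
rewrite -2!(mulrA C) -(mulrA B) ler_wpM2l ?(ltW C0)//.
apply: (@le_trans _ _ (s * (B * N%:R `^ (1 - p)))).
  by rewrite ler_wpM2l//; exact: (power_window_bound r p1 N0 jN).
rewrite mulrCA ler_wpM2l ?(ltW B0)//. rewrite (mulrA D) ler_wpM2r ?powR_ge0//.
apply: (le_trans (geometric_sum_le _ _ x0 x1)).
rewrite /D [leRHS]mulrAC ler_wpM2r ?invr_ge0 ?subr_ge0 ?(ltW x1)//.
rewrite -powR_mulrn ?(ltW x0)// -powRrM mulrC powRrM powR_mulrn//.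
pose u := - t; have u0 : 0 <= u by rewrite oppr_ge0 ltW.
have tu (y : R) : y `^ t = (y `^ u)^-1 by rewrite -powRN opprK.
rewrite !tu -/u.
have i0 : 0 < 2 ^+ i :> R by rewrite exprn_gt0.
rewrite ler_pdivlMr ?powR_gt0// mulrC ler_pdivrMr ?powR_gt0//.
rewrite -powRM ?(ltW i0)//; apply: le_powR => //.
by rewrite -natrX -natrM ler_nat -mulnA -expnS ltnW.
Qed.

End BernsteinJackson.

(** * Fourier coefficients of integrable functions *)

Section FourierCoefficients.
Variable R : realType.
Implicit Types (f g : R -> R[i]) (p x : R) (k : int).
Notation mu := (@lebesgue_measure R).
Notation twopi := (pi *+ 2 : R).

Definition L1 f := cmeasurable f /\ (Ip 1 f < +oo)%E.

Lemma Ip1E f : Ip 1 f = (\int[mu]_(x in @circle R) (nc (f x))%:E)%E.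
Proof. by apply: eq_integral => x _; rewrite powRr1 ?nc_ge0. Qed.

Lemma L1_Re f : L1 f ->
  mu.-integrable (@circle R) (EFin \o (fun x => complex.Re (f x))).
Proof.
move=> [mf]; rewrite Ip1E => fy; apply/integrableP; split.
  by apply/measurable_EFinP/measurable_funTS; have [] := mf.
apply: le_lt_trans fy; apply: ge0_le_integral => //=.
- exact: measurable_circle.
- apply/measurable_EFinP/measurableT_comp => //.
  by apply/measurable_funTS; have [] := mf.
- by apply/measurable_EFinP/measurable_funTS; exact: measurable_nc.
- by move=> x _; rewrite lee_fin Re_le_nc.
Qed.

Lemma L1_Im f : L1 f ->
  mu.-integrable (@circle R) (EFin \o (fun x => complex.Im (f x))).
Proof.
move=> [mf]; rewrite Ip1E => fy; apply/integrableP; split.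
  by apply/measurable_EFinP/measurable_funTS; have [] := mf.
apply: le_lt_trans fy; apply: ge0_le_integral => //=.
- exact: measurable_circle.
- apply/measurable_EFinP/measurableT_comp => //.
  by apply/measurable_funTS; have [] := mf.
- by apply/measurable_EFinP/measurable_funTS; exact: measurable_nc.
- by move=> x _; rewrite lee_fin Im_le_nc.
Qed.

Lemma in_Lp1_L1 f : in_Lp 1 f -> L1 f.
Proof.
move=> [mf _ fy]; split=> //; rewrite ltey; apply/negP => /eqP fi.
move: fy; rewrite /normLp -/(Ip 1 f) fi invr1 poweRe1 ?gt0_muley ?ltxx//.
  by rewrite lte_fin invr_gt0 twopi_gt0.
by rewrite lte_fin invr_gt0 twopi_gt0.
Qed.

Lemma L1D f g : L1 f -> L1 g -> L1 (fun x => f x + g x).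
Proof.
move=> [mf fy] [mg gy]; split; first exact: cmeasurableD.
exact: (le_lt_trans (IpD ltr01 (lexx 1) mf mg) (lte_add_pinfty fy gy)).
Qed.

Lemma L1M f g (B : R) : L1 f -> cmeasurable g -> (forall x, nc (g x) <= B) ->
  L1 (fun x => f x * g x).
Proof.
move=> [mf fy] mg gB; split; first exact: cmeasurableM.
have B0 : 0 <= B by apply: le_trans (gB 0); exact: nc_ge0.
apply: (@le_lt_trans _ _ (Ip 1 (fun x => B%:C%C * f x))).
  apply: le_Ip => //; first exact: cmeasurableM.
    by apply: cmeasurableM => //; exact: cmeasurable_cst.
  move=> x; rewrite !Normc.normcM nc_real ger0_norm// mulrC.
  by rewrite ler_wpM2r ?nc_ge0.
by rewrite IpZ// lte_mul_pinfty ?lee_fin ?powR_ge0.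
Qed.

Lemma L1Z f (z : R[i]) : L1 f -> L1 (fun x => z * f x).
Proof.
move=> Lf; have := @L1M f (fun=> z) (nc z) Lf (cmeasurable_cst z) (fun=> lexx _).
by under eq_fun do rewrite mulrC.
Qed.

Lemma L1B f g : L1 f -> L1 g -> L1 (fun x => f x - g x).
Proof.
move=> Lf Lg; have := L1D Lf (L1Z (-1) Lg).
by under eq_fun do rewrite mulN1r.
Qed.

Lemma L1_continuous f : ccontinuous f -> L1 f.
Proof. by move=> cf; split; [exact: ccontinuous_measurable|exact: Ip_lty]. Qed.

Lemma L1_cis f (a b : R) : L1 f -> L1 (fun x => f x * cis (a * x + b)).
Proof.
move=> Lf; apply: (@L1M _ _ 1) => //.
  exact: ccontinuous_measurable (ccontinuous_cis _ _).
by move=> x; rewrite nc_cis.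
Qed.

Lemma cintegralD f g : L1 f -> L1 g ->
  cintegral (fun x => f x + g x) = cintegral f + cintegral g.
Proof.
move=> Lf Lg; apply: complex_eq; rewrite /= ?Re_add ?Im_add /=.
  under eq_Rintegral do rewrite Re_add.
  by rewrite RintegralD//; [exact: measurable_circle|exact: L1_Re|exact: L1_Re].
under eq_Rintegral do rewrite Im_add.
by rewrite RintegralD//; [exact: measurable_circle|exact: L1_Im|exact: L1_Im].
Qed.

Lemma cintegralZ f (z : R[i]) : L1 f ->
  cintegral (fun x => z * f x) = z * cintegral f.
Proof.
move=> Lf; have mc := @measurable_circle R.
have iR (r : R) : mu.-integrable (@circle R) (EFin \o (fun x => r * complex.Re (f x))).
  by apply: (@integrableZl _ _ _ mu _ mc r (EFin \o _)); exact: L1_Re.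
have iI (r : R) : mu.-integrable (@circle R) (EFin \o (fun x => r * complex.Im (f x))).
  by apply: (@integrableZl _ _ _ mu _ mc r (EFin \o _)); exact: L1_Im.
apply: complex_eq; rewrite ?Re_mul ?Im_mul /=.
  under eq_Rintegral do rewrite Re_mul.
  by rewrite RintegralB// !RintegralZl//; solve [exact: L1_Re|exact: L1_Im].
under eq_Rintegral do rewrite Im_mul.
by rewrite RintegralD// !RintegralZl//; solve [exact: L1_Re|exact: L1_Im].
Qed.

Lemma cintegral0 : cintegral (fun=> 0 : R[i]) = 0 :> R[i].
Proof. by rewrite /cintegral !Rintegral_cst ?mul0r//; exact: measurable_circle. Qed.

Lemma L1_sum I (s : seq I) (F : I -> R -> R[i]) :
  (forall i, L1 (F i)) -> L1 (fun x => \sum_(i <- s) F i x).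
Proof.
move=> LF; elim: s => [|i s IH].
  under eq_fun do rewrite big_nil.
  by apply: L1_continuous; exact: ccontinuous_cst.
by under eq_fun do rewrite big_cons; exact: (L1D (LF i) IH).
Qed.

Lemma cintegral_sum I (s : seq I) (F : I -> R -> R[i]) :
  (forall i, L1 (F i)) ->
  cintegral (fun x => \sum_(i <- s) F i x) = \sum_(i <- s) cintegral (F i).
Proof.
move=> LF; elim: s => [|i s IH].
  by rewrite big_nil; under eq_fun do rewrite big_nil; exact: cintegral0.
under eq_fun do rewrite big_cons.
by rewrite big_cons cintegralD ?IH//; exact: L1_sum.
Qed.

Lemma nc_cintegral_le f : L1 f -> nc (cintegral f) <= 2 * fine (Ip 1 f).
Proof.
move=> Lf; have [mf fy] := Lf; rewrite (le_trans (nc_le_ReIm _))//=.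
have mc := @measurable_circle R.
have fin : Ip 1 f \is a fin_num by rewrite ge0_fin_numE ?Ip_ge0.
rewrite mulr2n mulrDl mul1r -lee_fin EFinD (EFinD (fine _)) fineK//.
have mn : measurable_fun (@circle R) (fun x => (nc (f x))%:E).
  by apply/measurable_EFinP/measurable_funTS; exact: measurable_nc.
have mRe : measurable_fun (@circle R) (fun x => (complex.Re (f x))%:E).
  by apply/measurable_EFinP/measurable_funTS; have [] := mf.
have mIm : measurable_fun (@circle R) (fun x => (complex.Im (f x))%:E).
  by apply/measurable_EFinP/measurable_funTS; have [] := mf.
apply: leeD; rewrite EFin_normr_Rintegral//; try solve [exact: L1_Re|exact: L1_Im].
  apply: le_trans.
    by apply: le_abse_integral => //; exact: mRe.
  rewrite Ip1E; apply: ge0_le_integral => //=.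
  - by apply/measurable_EFinP/measurableT_comp => //; exact/measurable_EFinP.
  - by move=> x _; rewrite lee_fin Re_le_nc.
apply: le_trans.
  by apply: le_abse_integral => //; exact: mIm.
rewrite Ip1E; apply: ge0_le_integral => //=.
- by apply/measurable_EFinP/measurableT_comp => //; exact/measurable_EFinP.
- by move=> x _; rewrite lee_fin Im_le_nc.
Qed.

Lemma cis_int2pi k : cis (k%:~R * twopi) = 1 :> R[i].
Proof.
case: (intP k) => [|n|n]; first by rewrite mul0r cis0.
  by rewrite -pmulrn -cisX cis2pi expr1n.
by rewrite rmorphN /= mulNr cisN -pmulrn -cisX cis2pi expr1n invr1.
Qed.

Lemma cintegral_cis k : cintegral (fun x => cis (k%:~R * x)) =
  if k == 0 then twopi%:C%C else 0.
Proof.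
have [->|k0] := eqVneq k 0.
  apply: complex_eq; rewrite /=.
    under eq_Rintegral do rewrite mul0r cos0.
    rewrite Rintegral_cst; last exact: measurable_circle.
    by rewrite [X in fine X]circle_measure mul1r.
  under eq_Rintegral do rewrite mul0r sin0.
  by rewrite Rintegral_cst ?mul0r//; exact: measurable_circle.
have kr : k%:~R != 0 :> R by rewrite intr_eq0.
have d (x : R) : is_derive x (1 : R) (fun y : R => k%:~R * y) k%:~R.
  by apply: is_derive_eq; rewrite /GRing.scale /=; ring.
have c (h : R -> R) : continuous h -> continuous (fun x : R => h (k%:~R * x)).
  move=> ch x; apply: (@continuous_comp _ _ _ (fun y : R => k%:~R * y) h); last exact: ch.
  exact: mulrl_continuous.
have [c1 s1] := cis_int2pi k.
have dS (x : R) : is_derive x (1 : R) (fun x => k%:~R^-1 * sin (k%:~R * x)) (cos (k%:~R * x)).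
  have e1 := @is_derive1_comp _ sin _ _ _ _ (is_derive_sin (k%:~R * x)) (d x).
  have := is_deriveZ (k%:~R^-1) e1; rewrite /GRing.scale /=.
  by rewrite mulrCA mulVf// mulr1.
have dC (x : R) : is_derive x (1 : R) (fun x => - k%:~R^-1 * cos (k%:~R * x)) (sin (k%:~R * x)).
  have e1 := @is_derive1_comp _ cos _ _ _ _ (is_derive_cos (k%:~R * x)) (d x).
  have := is_deriveZ (- k%:~R^-1) e1; rewrite /GRing.scale /=.
  by rewrite !mulNr mulrN opprK mulrCA mulVf// mulr1.
have eS := FTC_derive (twopi_gt0 R) dS (c _ (@continuous_cos R)).
have eC := FTC_derive (twopi_gt0 R) dC (c _ (@continuous_sin R)).
apply: complex_eq; rewrite /= /Rintegral integral_circle.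
- by rewrite eS /= s1 !mulr0 sin0 mulr0 subrr.
- exact/c/continuous_cos.
- by rewrite eC /= c1 !mulr0 cos0 subrr.
- exact/c/continuous_sin.
Qed.

Notation fc := (@fourier_coef R).

Lemma L1_fc f k : L1 f -> L1 (fun x => f x * cis (- (k%:~R * x))).
Proof.
move=> Lf; have := @L1_cis f (- k%:~R) 0 Lf.
by under eq_fun do rewrite addr0 mulNr.
Qed.

Lemma fcD f g k : L1 f -> L1 g -> fc (fun x => f x + g x) k = fc f k + fc g k.
Proof.
move=> Lf Lg; rewrite /fourier_coef -mulrDr; congr (_ * _).
rewrite -(cintegralD (L1_fc k Lf) (L1_fc k Lg)).
by congr cintegral; apply/funext => x; rewrite mulrDl.
Qed.

Lemma fcZ f (z : R[i]) k : L1 f -> fc (fun x => z * f x) k = z * fc f k.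
Proof.
move=> Lf; rewrite /fourier_coef mulrCA -(cintegralZ z (L1_fc k Lf)).
by congr (_ * cintegral _); apply/funext => x; rewrite mulrA.
Qed.

Lemma fcB f g k : L1 f -> L1 g -> fc (fun x => f x - g x) k = fc f k - fc g k.
Proof.
move=> Lf Lg.
have -> : (fun x => f x - g x) = (fun x => f x + (-1) * g x).
  by apply/funext => x; rewrite mulN1r.
by rewrite (fcD k Lf (L1Z (-1) Lg)) (fcZ (-1) k Lg) mulN1r.
Qed.

(** The factor 2 lost in treating real and imaginary parts apart is absorbed by [1 / (2 pi)]. *)
Lemma nc_fc_le f k : L1 f -> nc (fc f k) <= fine (Ip 1 f).
Proof.
move=> Lf; rewrite /fourier_coef Normc.normcM nc_real ger0_norm ?invr_ge0 ?(ltW (twopi_gt0 R))//.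
rewrite mulrC ler_pdivrMr ?twopi_gt0//.
rewrite (le_trans (nc_cintegral_le (L1_fc k Lf)))//.
rewrite (@eq_Ip _ 1 _ f); last by move=> x; rewrite Normc.normcM nc_cis mulr1.
rewrite mulrC ler_wpM2l ?fine_ge0 ?Ip_ge0// mulr2n.
by have := pi_ge2 R; lra.
Qed.

Lemma L1_tp n c : L1 (tp n c).
Proof. exact: L1_continuous (ccontinuous_tp n c). Qed.

Lemma fc_tp n c k : fc (tp n c) k = truncate n c k.
Proof.
have tp0 : twopi != 0 by rewrite gt_eqF ?twopi_gt0.
rewrite /fourier_coef.
have -> : (fun x => tp n c x * cis (- (k%:~R * x))) = (fun x =>
   \sum_(j < n.*2.+1) c (j%:Z - n%:Z) * cis ((j%:Z - n%:Z - k)%:~R * x)).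
  apply/funext => x; rewrite mulr_suml; apply: eq_bigr => j _.
  by rewrite -mulrA -cisD; congr (_ * cis _); rewrite !rmorphB /=; ring.
have Lc (a : R) : L1 (fun x => cis (a * x)).
  apply: L1_continuous; have := @ccontinuous_cis R a 0.
  by under [X in ccontinuous X]funext do rewrite addr0.
rewrite cintegral_sum; last by move=> j; exact: L1Z.
rewrite mulr_sumr (eq_bigr (fun j : 'I_n.*2.+1 =>
    if k == j%:Z - n%:Z then c (j%:Z - n%:Z) else 0)); last first.
  move=> j _; rewrite cintegralZ// cintegral_cis subr_eq0 eq_sym.
  case: ifP => _; last by rewrite !mulr0.
  by rewrite mulrCA -rmorphM /= mulVf// mulr1.
rewrite -big_mkcond /= /truncate; case: ifP => kn.
  have jn : (absz (k + n%:Z)%R < n.*2.+1)%N by move: kn; lia.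
  rewrite (bigD1 (Ordinal jn)) /=; last by apply/eqP; move: kn; lia.
  rewrite big1 ?addr0; first by congr c; move: kn; lia.
  move=> j /andP[/eqP kj /eqP jo]; exfalso; apply: jo; apply: val_inj => /=.
  by move: kn kj; lia.
rewrite big1// => j /eqP kj; exfalso; move: kn kj; have := ltn_ord j; lia.
Qed.

End FourierCoefficients.

(** * Uniqueness of Fourier coefficients *)

Section Uniqueness.
Variable R : realType.
Implicit Types (f g h : R -> R[i]) (p x t : R) (k : int).
Notation mu := (@lebesgue_measure R).
Notation twopi := (pi *+ 2 : R).
Notation fc := (@fourier_coef R).

(** Unordered lists of terms, repetitions allowed, make products free of degree bookkeeping. *)
Definition expsum (s : seq (int * R[i])) (x : R) : R[i] :=
  \sum_(i <- s) i.2 * cis (i.1%:~R * x).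

Lemma expsumD s1 s2 x : expsum (s1 ++ s2) x = expsum s1 x + expsum s2 x.
Proof. exact: big_cat. Qed.

Lemma expsumM s1 s2 x : expsum [seq (i.1 + j.1, i.2 * j.2) | i <- s1, j <- s2] x =
  expsum s1 x * expsum s2 x.
Proof.
rewrite /expsum big_allpairs_dep big_distrlr /=.
apply: eq_bigr => i _; apply: eq_bigr => j _.
by rewrite rmorphD /= mulrDl cisD; ring.
Qed.

Definition trig_real (u : R -> R) := exists s, forall x, (u x)%:C%C = expsum s x.

Lemma trig_real_cst (a : R) : trig_real (fun=> a).
Proof.
exists [:: (0, a%:C%C)] => x.
by rewrite /expsum big_seq1 /= mul0r cis0 mulr1.
Qed.

Lemma trig_realD u v : trig_real u -> trig_real v ->
  trig_real (fun x => u x + v x).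
Proof. by move=> [s us] [t vt]; exists (s ++ t) => x; rewrite rmorphD /= us vt expsumD. Qed.

Lemma trig_realM u v : trig_real u -> trig_real v ->
  trig_real (fun x => u x * v x).
Proof.
move=> [s us] [t vt]; exists [seq (i.1 + j.1, i.2 * j.2) | i <- s, j <- t] => x.
by rewrite expsumM -us -vt -rmorphM.
Qed.

Lemma trig_realX u n : trig_real u -> trig_real (fun x => u x ^+ n).
Proof.
move=> tu; elim: n => [|n IH].
  by under [X in trig_real X]funext do rewrite expr0; exact: trig_real_cst.
by under [X in trig_real X]funext do rewrite exprS; exact: trig_realM.
Qed.

Lemma trig_real_cos (a : R) : trig_real (fun x => cos (x - a)).
Proof.
exists [:: (1, (2^-1)%:C%C * cis (- a)); (-1, (2^-1)%:C%C * cis a)] => x.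
rewrite /expsum big_cons big_seq1 /= -!mulrA -!cisD !mulNr !mul1r.
have -> : - a + x = x - a by rewrite addrC.
have -> : a - x = - (x - a) by ring.
by apply: complex_eq; rewrite /= cosN ?sinN; field.
Qed.

Lemma cintegral_expsum h s : L1 h -> (forall k, fc h k = 0) ->
  cintegral (fun x => h x * expsum s x) = 0.
Proof.
move=> Lh h0.
have Lc (a : R) : L1 (fun x => h x * cis (a * x)).
  have := L1_cis a 0 Lh.
  by under [X in L1 X]funext do rewrite addr0.
have -> : (fun x => h x * expsum s x) =
    (fun x => \sum_(i <- s) i.2 * (h x * cis (i.1%:~R * x))).
  by apply/funext => x; rewrite mulr_sumr; apply: eq_bigr => i _; rewrite mulrCA.
rewrite (cintegral_sum s (fun i => L1Z i.2 (Lc i.1%:~R))).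
rewrite big1// => i _; rewrite (cintegralZ i.2 (Lc _)).
have := h0 (- i.1); rewrite /fourier_coef.
have -> : (fun x => h x * cis (- ((- i.1)%:~R * x))) = (fun x => h x * cis (i.1%:~R * x)).
  by apply/funext => x; rewrite rmorphN /= mulNr opprK.
move=> /eqP; rewrite mulf_eq0 => /orP[/eqP/(congr1 (@complex.Re _))/= /eqP|/eqP ->]; last by rewrite mulr0.
by rewrite invr_eq0 gt_eqF ?twopi_gt0.
Qed.

(* Polynomials of [t], bounded by 1 on [0, 1], approximating the indicator of
   [t < 1/2]. *)
Definition step n t : R := (1 - t ^+ n) ^+ (2 ^ n).

Lemma step01 n t : 0 <= t <= 1 -> 0 <= step n t <= 1.
Proof.
move=> /andP[t0 t1]; have h : 0 <= 1 - t ^+ n <= 1.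
  by rewrite subr_ge0 exprn_ile1//= gerBl exprn_ge0.
case/andP: h => h0 h1; rewrite /step exprn_ge0//= exprn_ile1//.
Qed.

Lemma bernoulli (y : R) n : -1 <= y -> 1 + n%:R * y <= (1 + y) ^+ n.
Proof.
move=> y1; elim: n => [|n IH]; first by rewrite mul0r addr0 expr0.
have y1' : 0 <= 1 + y by lra.
have := ler_wpM2l y1' IH; rewrite -exprS; apply: le_trans.
have -> : (1 + y) * (1 + n%:R * y) = 1 + n.+1%:R * y + n%:R * y ^+ 2.
  by rewrite -natr1; ring.
by rewrite lerDl mulr_ge0 ?sqr_ge0.
Qed.

Lemma step_ge n t : 0 <= t <= 1 -> 1 - (2 * t) ^+ n <= step n t.
Proof.
move=> /andP[t0 t1]; have := @bernoulli (- t ^+ n) (2 ^ n).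
by rewrite lerN2 exprn_ile1// => /(_ isT); rewrite natrX mulrN exprMn.
Qed.

(** [(1 - t^n) (1 + t^n) <= 1], and Bernoulli bounds [(1 + t^n)^(2^n)] below by [(2 t)^n]. *)
Lemma step_le n t : 0 < t <= 1 -> step n t <= (2 * t)^-1 ^+ n.
Proof.
move=> /andP[t0 t1].
have tn : 0 <= t ^+ n <= 1 by rewrite exprn_ge0 ?(ltW t0)//= exprn_ile1 ?(ltW t0).
have /andP[tn0 tn1] := tn.
have b : (2 * t) ^+ n <= (1 + t ^+ n) ^+ (2 ^ n).
  have := @bernoulli (t ^+ n) (2 ^ n).
  rewrite natrX exprMn (le_trans _ tn0) ?lerN10// => /(_ isT).
  by apply: le_trans; rewrite lerDr.
have tp : 0 < (2 * t) ^+ n by rewrite exprn_gt0// mulr_gt0.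
have s0 : 0 <= step n t by rewrite exprn_ge0// subr_ge0.
rewrite exprVn -[leRHS]mul1r ler_pdivlMr//.
apply: (@le_trans _ _ (step n t * (1 + t ^+ n) ^+ (2 ^ n))).
  by rewrite ler_wpM2l.
rewrite /step -exprMn -subr_sqr expr1n exprn_ile1//.
  by rewrite subr_ge0 exprn_ile1.
by rewrite gerBl sqr_ge0.
Qed.

Lemma step_cvg1 t : 0 <= t < 2^-1 -> step n t @[n --> \oo] --> (1 : R).
Proof.
move=> /andP[t0 t1].
have t2 : `|2 * t| < 1.
  by rewrite ger0_norm ?mulr_ge0// -ltr_pdivlMl// mulr1.
have t01 : 0 <= t <= 1 by rewrite t0 (le_trans (ltW t1))// invf_le1// ler1n.
apply: (@squeeze_cvgr _ _ _ _ (fun n => 1 - (2 * t) ^+ n) (fun=> 1)).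
- by apply: nearW => n; rewrite step_ge//=; have := step01 n t01 => /andP[].
- rewrite -[X in _ --> X]subr0; apply: cvgB; first exact: cvg_cst.
  exact: cvg_expr.
- exact: cvg_cst.
Qed.

Lemma step_cvg0 t : 2^-1 < t <= 1 -> step n t @[n --> \oo] --> (0 : R).
Proof.
move=> /andP[t1 t2]; have t0 : 0 < t by rewrite (lt_trans _ t1)// invr_gt0.
have h : `|(2 * t)^-1| < 1.
  rewrite ger0_norm ?invr_ge0 ?mulr_ge0 ?(ltW t0)//.
  by rewrite invf_lt1 ?mulr_gt0// -ltr_pdivrMl// mulr1.
apply: (@squeeze_cvgr _ _ _ _ (fun=> 0) (fun n => (2 * t)^-1 ^+ n)).
- apply: nearW => n; rewrite step_le ?t0//= andbT.
  by have := @step01 n t; rewrite (ltW t0) t2 => /(_ isT)/andP[].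
- exact: cvg_cst.
- exact: cvg_expr.
Qed.

Lemma arc_indicator (b x : R) : 0 < b < twopi -> 0 < x < twopi ->
  cos (x - b / 2) - cos (b / 2) = 2 * (sin (x / 2) * sin ((b - x) / 2)).
Proof.
move=> _ _; have -> : x - b / 2 = x / 2 - (b - x) / 2 by field.
have -> : b / 2 = x / 2 + (b - x) / 2 by field.
by rewrite cosB cosD; ring.
Qed.

(** On [(0, twopi)] the cosine centred at the midpoint [b / 2] exceeds [cos (b / 2)] exactly on the
    arc [(0, b)]; the affine map sends the difference into [0, 1], with this arc below 1/2. *)
Definition arc_step (b : R) n x :=
  step n (2^-1 + (- 4^-1) * (cos (x - b / 2) + - cos (b / 2))).

Lemma arc_arg01 (b x : R) : 0 <= 2^-1 + (- 4^-1) * (cos (x - b / 2) + - cos (b / 2)) <= 1.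
Proof.
have := cos_le1 (x - b / 2); have := cos_geN1 (x - b / 2).
have := cos_le1 (b / 2); have := cos_geN1 (b / 2) => *.
by apply/andP; split; lra.
Qed.

Lemma trig_real_arc_step (b : R) n : trig_real (arc_step b n).
Proof.
apply: trig_realX; apply: trig_realD; first exact: trig_real_cst.
have -> : (fun x => - (2^-1 + - 4^-1 * (cos (x - b / 2) - cos (b / 2))) ^+ n) =
  (fun x => (-1) * (2^-1 + - 4^-1 * (cos (x - b / 2) - cos (b / 2))) ^+ n).
  by apply/funext => x; rewrite mulN1r.
apply: trig_realM; first exact: trig_real_cst.
apply: trig_realX; apply: trig_realD; first exact: trig_real_cst.
apply: trig_realM; first exact: trig_real_cst.
by apply: trig_realD; [exact: trig_real_cos|exact: trig_real_cst].
Qed.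

Lemma arc_step_cvg (b x : R) : 0 < b < twopi -> 0 < x < twopi -> x != b ->
  arc_step b n x @[n --> \oo] --> ((x < b)%R%:R : R).
Proof.
move=> b01 x01 xb; have := arc_arg01 b x.
rewrite /arc_step arc_indicator//; set y := sin _; set z := sin _ => /andP[h0 h1].
have y0 : 0 < y.
  apply: sin_gt0_pi; case/andP: x01 => x0 x1.
  by rewrite divr_gt0//= ltr_pdivrMr// mulr_natr.
case/andP: x01 b01 => x0 x1 /andP[b0 b1].
have pm u : 0 < u < twopi -> 0 < sin (u / 2).
  move=> /andP[u0 u1]; apply: sin_gt0_pi.
  by rewrite divr_gt0//= ltr_pdivrMr// mulr_natr.
have [xltb|bltx|] := ltgtP x b; last by move=> e; rewrite e eqxx in xb.
- have z0 : 0 < z by apply: pm; rewrite subr_gt0 xltb /=; lra.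
  by apply: step_cvg1; rewrite h0 /=; nra.
- have z0 : z < 0.
    rewrite /z -(opprK (b - x)) mulNr sinN oppr_lt0 opprB; apply: pm.
    by rewrite subr_gt0 bltx /=; lra.
  by apply: step_cvg0; rewrite h1 andbT; nra.
Qed.

Lemma mem_itv_set (i : interval R) x : (x \in [set` i]) = (x \in i).
Proof. by apply/idP/idP => [/set_mem|xi]; [|exact: mem_set]. Qed.

Lemma ae_imp2 (P Q S : R -> Prop) : (forall x, P x -> Q x -> S x) ->
  {ae mu, forall x, P x} -> {ae mu, forall x, Q x} -> {ae mu, forall x, S x}.
Proof.
by move=> PQS; apply: (@filterS2 _ _ (ae_filter_ringOfSetsType mu)).
Qed.

Lemma ae_imp (P S : R -> Prop) : (forall x, P x -> S x) ->
  {ae mu, forall x, P x} -> {ae mu, forall x, S x}.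
Proof. by move=> PS; apply: (@filterS _ _ (ae_filter_ringOfSetsType mu)). Qed.

Lemma ae_neq (r : R) : {ae mu, forall x, x != r}.
Proof.
exists [set r]; split; [exact: measurable_set1|exact: lebesgue_measure_set1|].
by move=> x /= /negP; rewrite negbK => /eqP.
Qed.

Lemma trig_real_continuous v : trig_real v -> continuous v.
Proof.
move=> [s vs]; have -> : v = fun x => complex.Re (expsum s x).
  by apply/funext => x; rewrite -vs.
suff [] : ccontinuous (expsum s) by [].
apply: ccontinuous_sum => i; apply: ccontinuousM; first exact: ccontinuous_cst.
have := @ccontinuous_cis R i.1%:~R 0.
by under [X in ccontinuous X]funext do rewrite addr0.
Qed.

(** On the circle the polynomials [arc_step b n] are bounded by 1 and converge to the indicator of
    [x < b] except perhaps at 0 and [b]; dominated convergence applies. *)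
Lemma orthogonal_arc (u : R -> R) (b : R) :
  mu.-integrable (@circle R) (EFin \o u) ->
  (forall v, trig_real v -> (\int[mu]_(x in @circle R) (u x * v x)%:E = 0)%E) ->
  0 < b < twopi ->
  (\int[mu]_(x in @circle R) (u x * (x < b)%R%:R)%:E = 0)%E.
Proof.
move=> iu ou b01; have mc := @measurable_circle R.
have mu' : measurable_fun (@circle R) u by apply/measurable_EFinP; exact: measurable_int iu.
pose F n x := (u x * arc_step b n x)%:E.
have mF n : measurable_fun (@circle R) (F n).
  apply/measurable_EFinP; apply: measurable_funM => //.
  apply: measurable_funTS; apply: continuous_measurable_fun.
  exact: trig_real_continuous (trig_real_arc_step b n).
have mind : measurable_fun (@circle R) (fun x => (u x * (x < b)%R%:R)%:E).
  apply/measurable_EFinP; apply: measurable_funM => //.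
  have -> : (fun x : R => (x < b)%R%:R : R) = \1_(`]-oo, b[%classic).
    by apply/funext => x; rewrite indicE mem_itv_set in_itv.
  by apply: measurable_funTS; exact: measurable_indic.
have cv : {ae mu, forall x, (@circle R) x -> F n x @[n --> \oo] --> (u x * (x < b)%R%:R)%:E}.
  apply: ae_imp2 (ae_neq 0) (ae_neq b) => x x0 xb.
  rewrite /circle /= in_itv /= => /andP[x1 x2].
  apply: cvg_EFin; first by apply: nearW.
  apply: cvgM; first exact: cvg_cst.
  by apply: arc_step_cvg => //; rewrite lt0r x0 x1.
have dom : {ae mu, forall x n, (@circle R) x -> (`|F n x| <= `|(u x)%:E|)%E}.
  apply: aeW => x n _; rewrite /F /= lee_fin normrM ler_piMr//.
  have := step01 n (arc_arg01 b x); rewrite -/(arc_step b n x) => /andP[h0 h1].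
  by rewrite ger0_norm.
have [_ _] := @dominated_convergence _ _ _ mu _ mc F _ _ mF mind cv (integrable_abse iu) dom.
have -> : (fun n => \int[mu]_(x in @circle R) F n x)%E = (fun=> 0%E).
  by apply/funext => n; apply: ou; exact: trig_real_arc_step.
by move=> /cvg_lim <-//; rewrite lim_cst.
Qed.

(** Orthogonality to arcs makes the primitive of [u] vanish on [(0, twopi)]; Lebesgue
    differentiation recovers [u] almost everywhere. *)
Lemma orthogonal_ae0 (u : R -> R) :
  mu.-integrable (@circle R) (EFin \o u) ->
  (forall v, trig_real v -> (\int[mu]_(x in @circle R) (u x * v x)%:E = 0)%E) ->
  {ae mu, forall x, (@circle R) x -> u x = 0}.
Proof.
move=> iu ou; have mc := @measurable_circle R.
pose w := u \_ (@circle R).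
have lw := integrable_locally_restrict mc iu.
have iwT : mu.-integrable setT (EFin \o w).
  rewrite /w -restrict_EFin; apply/integrable_restrict => //=.
  by rewrite setTI.
have iw (y : R) : mu.-integrable [set` Interval (BLeft 0) (BRight y)] (EFin \o w).
  exact: integrableS iwT.
have Fz (b : R) : 0 < b < twopi -> (\int[mu]_(t in `[0%R, b]) w t)%R = 0.
  move=> b01; rewrite /Rintegral -(integral_itv_bndo_bndc (a := BLeft 0)); last first.
    apply/measurable_EFinP/measurable_funTS; apply/measurable_EFinP.
    exact: measurable_int iwT.
  suff -> : (\int[mu]_(x in `[0%R, b[) (w x)%:E =
      \int[mu]_(x in @circle R) (u x * (x < b)%R%:R)%:E)%E.
    by rewrite (orthogonal_arc iu ou b01).
  rewrite integral_mkcond [RHS]integral_mkcond; congr integral.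
  apply/funext => x; rewrite /patch /w /patch /circle !mem_itv_set !in_itv /=.
  case/andP: b01 => b0 b1.
  have [x0|x0] /= := leP 0 x => //.
  have [xb|xb] := ltP x b.
    by rewrite (lt_trans xb b1) mulr1.
  by rewrite mulr0 if_same.
apply: ae_imp2 (ae_neq 0) (FTC1 iw lw) => x x0 /= H.
rewrite /circle /= in_itv /= => /andP[x1 x2].
have x0' : 0 < x by rewrite lt0r x0.
have [|_ e] := H; first by rewrite lte_fin.
have wx : w x = u x by rewrite /w /patch /circle mem_itv_set in_itv /= x1 x2.
rewrite -wx -e derive1E (@near_eq_derive _ _ _ _ (cst 0)) ?derive_cst//.
near=> y; apply: Fz; apply/andP; split; near: y; [exact: lt_nbhsr|exact: lt_nbhsl].
Unshelve. all: by end_near. Qed.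

(** The test functions are real, so the real and imaginary parts of [h] can be treated
    separately. *)
Lemma fourier_unique h : L1 h -> (forall k, fc h k = 0) ->
  {ae mu, forall x, (@circle R) x -> h x = 0}.
Proof.
move=> Lh h0; have mc := @measurable_circle R.
have key v : trig_real v -> cintegral (fun x => h x * (v x)%:C%C) = 0.
  move=> [s vs]; rewrite -(cintegral_expsum s Lh h0).
  by congr cintegral; apply/funext => x; rewrite vs.
have bv v : trig_real v -> L1 (fun x => h x * (v x)%:C%C).
  move=> [s vs].
  have -> : (fun x => h x * (v x)%:C%C) =
      (fun x => \sum_(i <- s) i.2 * (h x * cis (i.1%:~R * x))).
    by apply/funext => x; rewrite vs mulr_sumr; apply: eq_bigr => i _; rewrite mulrCA.
  apply: L1_sum => i; apply: L1Z.
  have := L1_cis i.1%:~R 0 Lh.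
  by under [X in L1 X]funext do rewrite addr0.
have hR := orthogonal_ae0 (L1_Re Lh); have hI := orthogonal_ae0 (L1_Im Lh).
apply: ae_imp2 (hR _) (hI _) => [x r0 i0 cx|v tv|v tv].
- by apply: complex_eq => /=; [exact: r0|exact: i0].
- have := key v tv => /(congr1 (@complex.Re _)) /=.
  have -> : (fun x => complex.Re (h x * (v x)%:C%C)) = (fun x => complex.Re (h x) * v x).
    by apply/funext => x; rewrite Re_mul /= mulr0 subr0.
  have := @integrable_fin_num _ _ _ mu _ mc _ (L1_Re (bv v tv)).
  have -> : (EFin \o (fun x => complex.Re (h x * (v x)%:C%C))) =
      (fun x => (complex.Re (h x) * v x)%:E).
    by apply/funext => x; rewrite /= Re_mul /= mulr0 subr0.
  by move=> fin e; rewrite -(fineK fin) -[X in X%:E]/(Rintegral _ _ _) e.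
- have := key v tv => /(congr1 (@complex.Im _)) /=.
  have -> : (fun x => complex.Im (h x * (v x)%:C%C)) = (fun x => complex.Im (h x) * v x).
    by apply/funext => x; rewrite Im_mul /= mulr0 add0r.
  have := @integrable_fin_num _ _ _ mu _ mc _ (L1_Im (bv v tv)).
  have -> : (EFin \o (fun x => complex.Im (h x * (v x)%:C%C))) =
      (fun x => (complex.Im (h x) * v x)%:E).
    by apply/funext => x; rewrite /= Im_mul /= mulr0 add0r.
  by move=> fin e; rewrite -(fineK fin) -[X in X%:E]/(Rintegral _ _ _) e.
Qed.

End Uniqueness.

(** * Series of functions: almost everywhere, in [L_1] and in [L_p] *)

Section Series.
Variable R : realType.
Implicit Types (f g : R -> R[i]) (p x : R) (k : nat) (a : nat -> R[i]).
Notation mu := (@lebesgue_measure R).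
Notation twopi := (pi *+ 2 : R).
Notation fc := (@fourier_coef R).

Lemma cvg0_le (d : nat -> R) (e : R) : d N @[N --> \oo] --> (0 : R) ->
  (forall N, e <= d N) -> e <= 0.
Proof.
move=> d0 ed; rewrite leNgt; apply/negP => e0.
move/cvgrPdist_lt: d0 => /(_ _ e0)[N _ /(_ N (leqnn N))] /=.
have dN : 0 <= d N by rewrite (le_trans (ltW e0)).
by rewrite sub0r normrN ger0_norm// ltNge ed.
Qed.

Definition csum a (N : nat) : R[i] := \sum_(k < N) a k.

Lemma csum_split a J N : csum a (N + J) = csum a J + csum (fun k => a (k + J)%N) N.
Proof.
elim: N => [|N IH]; first by rewrite /csum big_ord0 addr0.
by rewrite addSn /csum !big_ord_recr /= addrA -IH.
Qed.

Definition ccvg a (z : R[i]) := nc (z - csum a N) @[N --> \oo] --> (0 : R).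

Lemma nc_triangle (z w : R[i]) : nc z <= nc (z - w) + nc w.
Proof. by rewrite -[X in nc X](subrK w) le_normcD. Qed.

(** p-subadditivity of the partial sums, passed to the limit; an infinite right-hand side is
    trivial. *)
Lemma nc_limit_le p a z : 0 < p -> p <= 1 -> ccvg a z ->
  ((nc z `^ p)%:E <= \sum_(0 <= k <oo) (nc (a k) `^ p)%:E)%E.
Proof.
move=> p0 p1 az; set B := (X in (_ <= X)%E).
have B0 : (0 <= B)%E by apply: nneseries_ge0 => k _ _; rewrite lee_fin powR_ge0.
have HB N : (((nc (csum a N)) `^ p)%:E <= B)%E.
  apply: (@le_trans _ _ (\sum_(0 <= k < N) (nc (a k) `^ p)%:E)%E); last first.
    by apply: nneseries_lim_ge => k _ _; rewrite lee_fin powR_ge0.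
  rewrite big_mkord sumEFin lee_fin (le_trans _ (powR_le_sum _ p0 p1 _))//.
    by rewrite le_powR ?(ltW p0) ?nc_ge0// nc_sum.
  by move=> k; exact: nc_ge0.
case: B B0 HB => [b||//] B0 HB; last by rewrite leey.
rewrite lee_fin in B0.
have bp y : 0 <= y -> y `^ p <= b -> y <= b `^ p^-1.
  move=> y0 yb; have -> : y = (y `^ p) `^ p^-1.
    by rewrite -powRrM mulfV ?gt_eqF// powRr1.
  by rewrite le_powR ?powR_ge0// invr_ge0 ltW.
have : nc z <= b `^ p^-1.
  rewrite leNgt; apply/negP => lt; have e0 : 0 < nc z - b `^ p^-1 by rewrite subr_gt0.
  move/cvgrPdist_lt: az => /(_ _ e0)[N _ /(_ N (leqnn N))] /=.
  rewrite sub0r normrN ger0_norm ?nc_ge0// ltNge => /negP; apply.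
  rewrite lerBlDr (le_trans (nc_triangle z (csum a N)))// lerD2l.
  by apply: bp; [exact: nc_ge0|have := HB N; rewrite lee_fin].
move=> zb; rewrite lee_fin (le_trans (le_powR (ltW p0) (nc_ge0 z) zb))//.
by rewrite -powRrM mulVf ?gt_eqF// powRr1.
Qed.

Definition clim a : R[i] :=
  (limn (fun N => complex.Re (csum a N)) +i* limn (fun N => complex.Im (csum a N)))%C.

Lemma Re_csum a N : complex.Re (csum a N) = \sum_(0 <= k < N) complex.Re (a k).
Proof.
rewrite big_mkord /csum; elim/big_ind2: _ => // x y z w <- <-.
by rewrite Re_add.
Qed.

Lemma Im_csum a N : complex.Im (csum a N) = \sum_(0 <= k < N) complex.Im (a k).
Proof.
rewrite big_mkord /csum; elim/big_ind2: _ => // x y z w <- <-.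
by rewrite Im_add.
Qed.

Lemma cvg_series_le (u : nat -> R) (v : nat -> R) :
  (forall k, `|u k| <= v k) -> (\sum_(0 <= k <oo) (v k)%:E < +oo)%E ->
  cvgn (fun N => \sum_(0 <= k < N) u k).
Proof.
move=> uv vy; have v0 k : 0 <= v k by rewrite (le_trans _ (uv k)).
apply: (@normed_cvg _ R^o u).
apply: nondecreasing_is_cvgn.
  apply/nondecreasing_seqP => N.
  change (\sum_(0 <= k < N) `|u k| <= \sum_(0 <= k < N.+1) `|u k|).
  by rewrite [leRHS]big_nat_recr//= lerDl.
have s0 : (0 <= \sum_(0 <= k <oo) (v k)%:E)%E.
  by apply: nneseries_ge0 => k _ _; rewrite lee_fin.
exists (fine (\sum_(0 <= k <oo) (v k)%:E)%E) => _ [N _ <-].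
rewrite -lee_fin fineK ?ge0_fin_numE//.
apply: (@le_trans _ _ (\sum_(0 <= k < N) (v k)%:E)%E); last first.
  by apply: nneseries_lim_ge => k _ _; rewrite lee_fin.
by rewrite sumEFin lee_fin; apply: ler_sum => k _; exact: uv.
Qed.

Lemma clim_cvg a : (\sum_(0 <= k <oo) (nc (a k))%:E < +oo)%E ->
  [/\ complex.Re (csum a N) @[N --> \oo] --> complex.Re (clim a),
      complex.Im (csum a N) @[N --> \oo] --> complex.Im (clim a) &
      ccvg a (clim a)].
Proof.
move=> ay.
have cR : complex.Re (csum a N) @[N --> \oo] --> complex.Re (clim a).
  apply: (_ : cvgn (fun N => complex.Re (csum a N))).
  under [X in cvgn X]funext do rewrite Re_csum.
  by apply: cvg_series_le ay => k; exact: Re_le_nc.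
have cI : complex.Im (csum a N) @[N --> \oo] --> complex.Im (clim a).
  apply: (_ : cvgn (fun N => complex.Im (csum a N))).
  under [X in cvgn X]funext do rewrite Im_csum.
  by apply: cvg_series_le ay => k; exact: Im_le_nc.
split => //; rewrite /ccvg.
apply: (@squeeze_cvgr _ _ _ _ (fun=> 0) (fun N =>
   `|complex.Re (clim a) - complex.Re (csum a N)| +
   `|complex.Im (clim a) - complex.Im (csum a N)|)).
- apply: nearW => N; rewrite nc_ge0 /= (le_trans (nc_le_ReIm _))//.
  by rewrite Re_add Im_add; case: (csum a N) => u v; exact: lexx.
- exact: cvg_cst.
- rewrite -[X in _ --> X]addr0; apply: cvgD.
    by rewrite -(normr0 R) -(subrr (complex.Re (clim a))); apply: cvg_norm; apply: cvgB => //; exact: cvg_cst.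
  by rewrite -(normr0 R) -(subrr (complex.Im (clim a))); apply: cvg_norm; apply: cvgB => //; exact: cvg_cst.
Qed.

Lemma Ip_ae_le p f (b : R -> \bar R) : cmeasurable f ->
  measurable_fun (@circle R) b -> (forall x, (0 <= b x)%E) ->
  {ae mu, forall x, (@circle R) x -> ((nc (f x) `^ p)%:E <= b x)%E} ->
  (Ip p f <= \int[mu]_(x in @circle R) b x)%E.
Proof.
move=> mf mb b0 fb; apply: ae_ge0_le_integral => //.
- exact: measurable_circle.
- by move=> x _; rewrite lee_fin powR_ge0.
- exact: measurable_funTS (measurable_nc_powR p mf).
Qed.

Lemma measurable_nc_series p (G : nat -> R -> R[i]) :
  (forall k, cmeasurable (G k)) ->
  measurable_fun setT (fun x => \sum_(0 <= k <oo) (nc (G k x) `^ p)%:E)%E.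
Proof.
move=> mG; apply: (emeasurable_fun_cvg
   (fun N x => \sum_(0 <= k < N) (nc (G k x) `^ p)%:E)%E).
  by move=> N; apply: emeasurable_sum => k; exact: measurable_nc_powR.
by move=> x _; apply: is_cvg_nneseries => k _ _; rewrite lee_fin powR_ge0.
Qed.

Lemma Ip_series_tail p (G : nat -> R -> R[i]) f (J : nat) : 0 < p -> p <= 1 ->
  (forall k, cmeasurable (G k)) -> cmeasurable f ->
  {ae mu, forall x, (@circle R) x -> ccvg (fun k => G k x) (f x)} ->
  (Ip p (fun x => f x - csum (fun k => G k x) J)%R <=
   \sum_(J <= k <oo) Ip p (G k))%E.
Proof.
move=> p0 p1 mG mf cf.
rewrite -(@nneseries_addn _ (fun k => Ip p (G k)) J) => [|k]; last exact: Ip_ge0.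
rewrite /Ip -integral_nneseries//; first last.
- by move=> k x _; rewrite lee_fin powR_ge0.
- by move=> k; exact: measurable_funTS (measurable_nc_powR p (mG _)).
- exact: measurable_circle.
apply: Ip_ae_le.
- by apply: cmeasurableB => //; exact: cmeasurable_sum.
- exact: measurable_funTS (measurable_nc_series p (fun k => mG (k + J)%N)).
- by move=> x; apply: nneseries_ge0 => k _ _; rewrite lee_fin powR_ge0.
apply: ae_imp cf => x /[apply] cx.
apply: (nc_limit_le p0 p1 (a := fun k => G (k + J)%N x)).
rewrite /ccvg.
have -> : (fun N => nc (f x - csum (fun k => G k x) J - csum (fun k => G (k + J)%N x) N)) =
   (fun N => nc (f x - csum (fun k => G k x) (N + J))).
  by apply/funext => N; rewrite -addrA -opprD csum_split.
by rewrite (cvg_shiftn J (fun N => nc (f x - csum (fun k => G k x) N))).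
Qed.

(** Integrating term by term shows that the sum of the [|h k|^p] is finite almost everywhere, hence
    its terms tend to 0. *)
Lemma ae_cvg0_summable p (h : nat -> R -> R[i]) : 0 < p ->
  (forall k, cmeasurable (h k)) -> (\sum_(0 <= k <oo) Ip p (h k) < +oo)%E ->
  {ae mu, forall x, (@circle R) x -> nc (h N x) @[N --> \oo] --> (0 : R)}.
Proof.
move=> p0 mh hy; have mc := @measurable_circle R.
pose b x := (\sum_(0 <= k <oo) (nc (h k x) `^ p)%:E)%E.
have b0 x : (0 <= b x)%E by apply: nneseries_ge0 => k _ _; rewrite lee_fin powR_ge0.
have ib : mu.-integrable (@circle R) b.
  apply/integrableP; split; first exact: measurable_funTS (measurable_nc_series p mh).
  under eq_integral do rewrite gee0_abs//.
  rewrite integral_nneseries//.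
  - by move=> k; exact: measurable_funTS (measurable_nc_powR p (mh k)).
  - by move=> k x _; rewrite lee_fin powR_ge0.
have fin := @integrable_ae _ _ _ mu _ mc _ ib.
apply: ae_imp fin => x /[apply] bx.
have bfin : (b x < +oo)%E by rewrite -ge0_fin_numE.
have /cvg_series_cvg_0 t0 : cvgn (series (fun k => nc (h k x) `^ p)).
  apply: cvg_series_le bfin => k; by rewrite ger0_norm ?powR_ge0.
apply/cvgrPdist_lt => e e0; have ep : 0 < e `^ p by rewrite powR_gt0.
move/cvgrPdist_lt: t0 => /(_ _ ep); apply: filterS => N.
rewrite !sub0r !normrN !ger0_norm ?powR_ge0 ?nc_ge0// => hN.
rewrite ltNge; apply/negP => /(le_powR (ltW p0) (ltW e0)).
by rewrite leNgt hN.
Qed.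

Lemma cvg_tail_Ip p (h : nat -> R -> R[i]) (G : nat -> R -> R[i]) :
  (\sum_(0 <= k <oo) Ip p (G k) < +oo)%E ->
  (forall J, (Ip p (h J) <= \sum_(J <= k <oo) Ip p (G k))%E) ->
  fine (Ip p (h J)) @[J --> \oo] --> (0 : R).
Proof.
move=> Gy hG.
have t0 := nneseries_tail_cvg Gy (fun k _ => Ip_ge0 p (G k)).
have : (Ip p (h J) @[J --> \oo] --> 0)%E.
  apply: (@squeeze_cvge _ _ _ _ (fun=> 0%E) _ (fun J => (\sum_(J <= k <oo) Ip p (G k))%E)).
  - by apply: nearW => J; rewrite Ip_ge0 hG.
  - exact: cvg_cst.
  - exact: t0.
by move/fine_cvg.
Qed.

(** Convergence in [L_1] serves to identify the sum [L] of the series: it has the Fourier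
    coefficients of [g], hence equals [g] almost everywhere. The [L_p] bound then comes from
    pointwise convergence. *)
Lemma Ip_series p (G : nat -> R -> R[i]) g : 0 < p -> p <= 1 ->
  (forall k, L1 (G k)) -> (\sum_(0 <= k <oo) Ip 1 (G k) < +oo)%E -> L1 g ->
  (forall m, ccvg (fun k => fc (G k) m) (fc g m)) ->
  (Ip p g <= \sum_(0 <= k <oo) Ip p (G k))%E.
Proof.
move=> p0 p1 LG Gy Lg cg; have mc := @measurable_circle R.
have mG k : cmeasurable (G k) by have [] := LG k.
have [mg _] := Lg.
pose b x := (\sum_(0 <= k <oo) (nc (G k x) `^ 1)%:E)%E.
have b0 x : (0 <= b x)%E by apply: nneseries_ge0 => k _ _; rewrite lee_fin powR_ge0.
have mb : measurable_fun setT b := measurable_nc_series 1 mG.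
have ib : mu.-integrable (@circle R) b.
  apply/integrableP; split; first exact: measurable_funTS.
  under eq_integral do rewrite gee0_abs//.
  rewrite integral_nneseries//.
  - by move=> k; exact: measurable_funTS (measurable_nc_powR 1 (mG k)).
  - by move=> k x _; rewrite lee_fin powR_ge0.
pose A := [set x | (b x < +oo)%E].
have mA : measurable A.
  have := emeasurable_fun_infty_o (measurableT : measurable [set: R]) mb +oo%E.
  by rewrite setTI.
(* Restricting to the set [A] where the series of moduli is finite makes the series converge
   everywhere, so that its sum is a pointwise limit of measurable functions. *)
pose G' k x := ((\1_A x : R)%:C)%C * G k x.
have mG' k : cmeasurable (G' k).
  apply: cmeasurableM => //; split; first exact: measurable_indic.
  exact: measurable_cst.
have G'y x : (\sum_(0 <= k <oo) (nc (G' k x))%:E < +oo)%E.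
  rewrite /G' indicE; have [xA|xA] := boolP (x \in A).
    have := xA; rewrite inE => xA'; apply: le_lt_trans xA'.
    apply: lee_nneseries => k _; rewrite ?lee_fin ?nc_ge0//.
    by rewrite mul1r powRr1 ?nc_ge0.
  rewrite eseries0// => k _ _.
  by rewrite mul0r Normc.normc0.
pose L x := clim (fun k => G' k x).
have mL : cmeasurable L.
  split.
    apply: (measurable_fun_cvg (h := fun N x => complex.Re (csum (fun k => G' k x) N))).
      by move=> N; have [] := cmeasurable_sum (index_enum 'I_N) (fun k : 'I_N => mG' k).
    by move=> x _; have [] := clim_cvg (G'y x).
  apply: (measurable_fun_cvg (h := fun N x => complex.Im (csum (fun k => G' k x) N))).
    by move=> N; have [] := cmeasurable_sum (index_enum 'I_N) (fun k : 'I_N => mG' k).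
  by move=> x _; have [] := clim_cvg (G'y x).
have cL : {ae mu, forall x, (@circle R) x -> ccvg (fun k => G k x) (L x)}.
  have fin := @integrable_ae _ _ _ mu _ mc _ ib.
  apply: ae_imp fin => x /[apply] bx.
  have xA : x \in A by rewrite inE /A /= -ge0_fin_numE.
  have [_ _] := clim_cvg (G'y x); rewrite -/(L x).
  suff -> : (fun k => G' k x) = (fun k => G k x) by [].
  by apply/funext => k; rewrite /G' indicE xA mul1r.
have tail := Ip_series_tail _ ltr01 (lexx 1) mG mL cL.
have LL : L1 L.
  split=> //; apply: le_lt_trans Gy.
  have <- : Ip 1 (fun x => L x - csum (fun k => G k x) 0) = Ip 1 L.
    by apply: eq_Ip => x; rewrite /csum big_ord0 subr0.
  exact: tail.
have tail0 := cvg_tail_Ip Gy tail.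
pose S J x := csum (fun k => G k x) J.
have LS J : L1 (S J) by exact: (L1_sum (index_enum 'I_J) (fun k : 'I_J => LG k)).
have fcS J m : fc (S J) m = csum (fun k => fc (G k) m) J.
  elim: J => [|J IH].
    rewrite /S /csum big_ord0; under [X in fc X]funext do rewrite big_ord0.
    rewrite /fourier_coef; under [X in cintegral X]funext do rewrite mul0r.
    by rewrite cintegral0 mulr0.
  have -> : S J.+1 = (fun x => S J x + G J x).
    by apply/funext => x; rewrite /S /csum big_ord_recr.
  by rewrite (fcD m (LS J) (LG J)) IH [RHS]/csum big_ord_recr.
have eq m : fc (fun x => g x - L x) m = 0.
  apply: Normc.eq0_normc; apply/eqP; rewrite eq_le nc_ge0 andbT.
  rewrite (fcB m Lg LL).
  (* Both terms tend to 0, the first by hypothesis and the second by convergence in [L_1]; their sum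
     dominates a constant. *)
  have : (nc (fc g m - csum (fun k => fc (G k) m) J) +
     fine (Ip 1 (fun x => L x - S J x))) @[J --> \oo] --> (0 : R).
    by rewrite -[X in _ --> X]addr0; apply: cvgD; [exact: cg|exact: tail0].
  move=> /cvg0_le; apply => N.
  have -> : fc g m - fc L m = (fc g m - csum (fun k => fc (G k) m) N) +
      - (fc L m - fc (S N) m) by rewrite fcS; ring.
  rewrite (le_trans (le_normcD _ _))// lerD2l normcN -(fcB m LL (LS N)).
  exact: (nc_fc_le m (L1B LL (LS N))).
have ae0 := fourier_unique (L1B Lg LL) eq.
have cG : {ae mu, forall x, (@circle R) x -> ccvg (fun k => G k x) (g x)}.
  apply: ae_imp2 ae0 cL => x e0 cx xc.
  have -> : g x = L x by apply/eqP; rewrite -subr_eq0 e0.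
  exact: cx.
have <- : Ip p (fun x => g x - csum (fun k => G k x) 0) = Ip p g.
  by apply: eq_Ip => x; rewrite /csum big_ord0 subr0.
exact: (Ip_series_tail 0%N p0 p1 mG mg cG).
Qed.

(** Approximation in [L_p] alone does not bear on coefficients. Summable errors give [U k --> f]
    almost everywhere, so the [L_1] limit of the telescoping series is [f - U 0], and coefficients
    are continuous in [L_1]. *)
Lemma fc_cvg_approx p (U : nat -> R -> R[i]) f : 0 < p -> p <= 1 ->
  (forall k, L1 (U k)) -> L1 f ->
  (\sum_(0 <= k <oo) Ip p (fun x => f x - U k x)%R < +oo)%E ->
  (\sum_(0 <= k <oo) Ip 1 (fun x => U k.+1 x - U k x)%R < +oo)%E ->
  forall m, nc (fc f m - fc (U J) m) @[J --> \oo] --> (0 : R).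
Proof.
move=> p0 p1 LU Lf fU UU m.
have mU k : cmeasurable (U k) by have [] := LU k.
have [mf _] := Lf.
have tel J x : csum (fun k => U k.+1 x - U k x) J = U J x - U 0%N x.
  by rewrite /csum -(big_mkord xpredT (fun k => U k.+1 x - U k x)) telescope_sumr.
have ae0 := ae_cvg0_summable p0 (fun k => cmeasurableB mf (mU k)) fU.
have tail := @Ip_series_tail 1 (fun k x => U k.+1 x - U k x) (fun x => f x - U 0%N x) _
   ltr01 (lexx 1) (fun k => cmeasurableB (mU _) (mU _)) (cmeasurableB mf (mU _)).
have cf : {ae mu, forall x, (@circle R) x -> ccvg (fun k => U k.+1 x - U k x) (f x - U 0%N x)}.
  apply: ae_imp ae0 => x /[apply].
  rewrite /ccvg.
  have -> : (fun N => nc (f x - U 0%N x - csum (fun k => U k.+1 x - U k x) N)) =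
      (fun N => nc (f x - U N x)).
    by apply/funext => N; rewrite tel opprB addrA subrK.
  by [].
have tail0 := cvg_tail_Ip UU (fun J => tail J cf).
apply: (squeeze_cvgr _ _ tail0); last exact: cvg_cst.
apply: nearW => J; rewrite nc_ge0 andTb -(fcB m Lf (LU J)).
have e : (fun x => f x - U 0%N x - csum (fun k => U k.+1 x - U k x) J) = (fun x => f x - U J x).
  by apply/funext => x; rewrite tel opprB addrA subrK.
by rewrite e; exact: (nc_fc_le m (L1B Lf (LU J))).
Qed.

End Series.

(** * Near-best approximants and their dyadic blocks *)

Section Approximation.
Variable R : realType.
Implicit Types (f g h : R -> R[i]) (p x alpha : R) (k n : nat) (m : int).
Implicit Types (c : int -> R[i]) (u : nat -> int -> R[i]).
Notation mu := (@lebesgue_measure R).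
Notation twopi := (pi *+ 2 : R).
Notation fc := (@fourier_coef R).

Lemma normLp_ge0 p f : (0 <= normLp p f)%E.
Proof. exact: poweR_ge0. Qed.

Lemma Ip_normLp p f : 0 < p -> (Ip p f = twopi%:E * normLp p f `^ p)%E.
Proof.
move=> p0; rewrite /normLp -/(Ip p f) -poweRrM mulVf ?gt_eqF// poweRe1.
  by rewrite muleA -EFinM mulfV ?gt_eqF ?twopi_gt0// mul1e.
by rewrite mule_ge0 ?Ip_ge0// lee_fin invr_ge0 ltW ?twopi_gt0.
Qed.

Lemma normLp_le p f g : 0 < p -> (normLp p f <= normLp p g)%E -> (Ip p f <= Ip p g)%E.
Proof.
move=> p0 fg; rewrite (Ip_normLp f p0) (Ip_normLp g p0) lee_wpmul2l ?lee_fin ?(ltW (twopi_gt0 R))//.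
by rewrite gt0_ler_poweR ?(ltW p0)// in_itv /= ?normLp_ge0 ?leey.
Qed.

Lemma Ip_lty_L1 p f : 0 < p -> p <= 1 -> L1 f -> (Ip p f < +oo)%E.
Proof.
move=> p0 p1 [mf fy]; have mc := @measurable_circle R.
apply: (@le_lt_trans _ _ (\int[mu]_(x in @circle R) (1 + (nc (f x) `^ 1)%:E))%E).
  apply: ge0_le_integral => //.
  - by move=> x _; rewrite lee_fin powR_ge0.
  - exact: measurable_funTS (measurable_nc_powR p mf).
  - apply: emeasurable_funD; first exact: measurable_cst.
    exact: measurable_funTS (measurable_nc_powR 1 mf).
  - move=> x _; rewrite -EFinD lee_fin powRr1 ?nc_ge0//.
    have [f1|f1] := leP 1 (nc (f x)).
      by rewrite (le_trans (ler1_powR f1 p1))// lerDr.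
    rewrite -[leLHS]addr0 lerD ?nc_ge0//.
    have -> : 1 = 1 `^ p :> R by rewrite powR1.
    by rewrite le_powR ?(ltW p0) ?nc_ge0// ltW.
rewrite ge0_integralD//; first last.
- exact: measurable_funTS (measurable_nc_powR 1 mf).
- by move=> x _; rewrite lee_fin powR_ge0.
rewrite integral_cst// mul1e [X in (X + _)%E]circle_measure.
by rewrite lte_add_pinfty// ltry.
Qed.

Lemma normLp_lty p f : 0 < p -> p <= 1 -> L1 f -> (normLp p f < +oo)%E.
Proof.
move=> p0 p1 Lf; apply: poweR_lty; rewrite -/(Ip p f).
rewrite lte_mul_pinfty ?lee_fin ?invr_ge0 ?(ltW (twopi_gt0 R))//.
exact: Ip_lty_L1.
Qed.

Lemma best_approx_ge0 p n f : (0 <= best_approx p n f)%E.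
Proof. by apply: le_ereal_inf_tmp => _ [T _ <-]; exact: normLp_ge0. Qed.

Lemma best_approx_tp p n c f :
  (best_approx p n f <= normLp p (fun x => f x - tp n c x)%R)%E.
Proof. by apply: ereal_inf_lbound; exists (tp n c) => //; exists c. Qed.

Lemma best_approx_fin p n f : 0 < p -> p <= 1 -> L1 f ->
  best_approx p n f \is a fin_num.
Proof.
move=> p0 p1 Lf; rewrite ge0_fin_numE ?best_approx_ge0//.
apply: le_lt_trans (best_approx_tp p n (fun=> 0) f) _.
exact: (normLp_lty p0 p1 (L1B Lf (L1_tp n _))).
Qed.

Lemma best_approx_antitone p (n1 n2 : nat) f : (n1 <= n2)%N ->
  (best_approx p n2 f <= best_approx p n1 f)%E.
Proof.
move=> n12; apply: ereal_inf_le_tmp => _ [T /trig_polyP[c -> c0] <-].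
by exists (tp n1 c) => //; rewrite -(tp_widen c0 n12); exists c.
Qed.

Lemma near_best p n f (e : R) : 0 < p -> p <= 1 -> L1 f -> 0 < e ->
  exists2 c, (Ip p (fun x => f x - tp n c x)%R <=
    (twopi * fine (best_approx p n f) `^ p + e)%:E)%E &
    forall m, (n < absz m)%N -> c m = 0.
Proof.
move=> p0 p1 Lf e0; set b := fine _.
have bE : best_approx p n f = b%:E by rewrite fineK// best_approx_fin.
have b0 : 0 <= b by rewrite fine_ge0// best_approx_ge0.
(* [y] is chosen so that [twopi * y ^ p] is the required bound; being above the infimum, it is
   beaten by some polynomial. *)
pose y := (b `^ p + e / twopi) `^ p^-1.
have ye : 0 < e / twopi by rewrite divr_gt0 ?twopi_gt0.
have yp : y `^ p = b `^ p + e / twopi.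
  by rewrite /y -powRrM mulVf ?gt_eqF// powRr1// addr_ge0 ?powR_ge0 ?(ltW ye).
have by_ : b < y.
  rewrite ltNge; apply/negP => /(le_powR (ltW p0) (powR_ge0 _ _)).
  by rewrite yp gerDl leNgt ye.
have : (best_approx p n f < y%:E)%E by rewrite bE lte_fin by_.
move=> /ereal_inf_lt[_ [T /trig_polyP[c -> c0] <-] lt].
exists c => //; rewrite Ip_normLp//.
have -> : twopi * b `^ p + e = twopi * y `^ p.
  by rewrite yp mulrDr mulrCA mulfV ?gt_eqF ?twopi_gt0// mulr1.
rewrite EFinM lee_wpmul2l ?lee_fin ?(ltW (twopi_gt0 R))//.
rewrite -poweR_EFin gt0_ler_poweR ?(ltW p0)// ?in_itv /= ?normLp_ge0 ?leey ?(ltW lt)//.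
by rewrite lee_fin powR_ge0.
Qed.

Lemma nc_tp_le n c (B : R) x : (forall m, (absz m <= n)%N -> nc (c m) <= B) ->
  nc (tp n c x) <= n.*2.+1%:R * B.
Proof.
move=> cB; rewrite (le_trans (nc_sum _ _ _))//.
apply: (@le_trans _ _ (\sum_(j < n.*2.+1) B)); last first.
  by rewrite sumr_const card_ord mulr_natl.
by apply: ler_sum => j _; rewrite Normc.normcM nc_cis mulr1 cB// index_range.
Qed.

Lemma Ip1_tp_le n c (B : R) : 0 <= B ->
  (forall m, (absz m <= n)%N -> nc (c m) <= B) ->
  (Ip 1 (tp n c) <= (n.*2.+1%:R * B * twopi)%:E)%E.
Proof.
move=> B0 cB; have mc := @measurable_circle R.
rewrite EFinM -[X in (_ * X)%E]circle_measure -integral_cst//.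
apply: ge0_le_integral => //.
- by move=> x _; rewrite lee_fin powR_ge0.
- exact: measurable_funTS (measurable_nc_powR 1 (cmeasurable_tp n c)).
- by move=> x _; rewrite /cst lee_fin powRr1 ?nc_ge0// nc_tp_le.
Qed.

(* Nikol'skii: [int |T| <= (sup |T|)^(1-p) int |T|^p] and [sup |T|] is at most
   [(2 n + 1) int |T|]. *)
Lemma nikolskii p n c : 0 < p -> p <= 1 ->
  fine (Ip 1 (tp n c)) <= (n.*2.+1%:R `^ (1 - p) * fine (Ip p (tp n c))) `^ p^-1.
Proof.
move=> p0 p1; set I1 := fine (Ip 1 _); set Ipp := fine (Ip p _).
have mc := @measurable_circle R.
have I10 : 0 <= I1 by rewrite fine_ge0// Ip_ge0.
have Ip0 : 0 <= Ipp by rewrite fine_ge0// Ip_ge0.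
have [->|I1n] := eqVneq I1 0; first exact: powR_ge0.
have I1p : 0 < I1 by rewrite lt0r I1n.
have sup x : nc (tp n c x) <= n.*2.+1%:R * I1.
  rewrite -tp_truncate; apply: nc_tp_le => m _; rewrite -fc_tp.
  by apply: nc_fc_le; exact: L1_tp.
pose B : R := (n.*2.+1%:R * I1) `^ (1 - p).
have H : I1 <= B * Ipp.
  rewrite -lee_fin EFinM !fineK ?Ip_tp_fin ?ltr01//.
  rewrite /Ip -ge0_integralZl_EFin//; first last.
  - exact: powR_ge0.
  - exact: measurable_funTS (measurable_nc_powR p (cmeasurable_tp n c)).
  - by move=> x _; rewrite lee_fin powR_ge0.
  apply: ge0_le_integral => //.
  - by move=> x _; rewrite lee_fin powR_ge0.
  - exact: measurable_funTS (measurable_nc_powR 1 (cmeasurable_tp n c)).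
  - apply: emeasurable_funM; first exact: measurable_cst.
    exact: measurable_funTS (measurable_nc_powR p (cmeasurable_tp n c)).
  move=> x _; rewrite -EFinM lee_fin powRr1 ?nc_ge0//.
  have [->|z] := eqVneq (nc (tp n c x)) 0.
    by rewrite mulr_ge0 ?powR_ge0.
  have e : nc (tp n c x) = nc (tp n c x) `^ (1 - p) * nc (tp n c x) `^ p.
    by rewrite -powRD ?z ?implybT// subrK powRr1 ?nc_ge0.
  rewrite [leLHS]e ler_wpM2r ?powR_ge0//.
  by rewrite le_powR ?subr_ge0 ?nc_ge0.
(* [I1] stands on both sides of [H]; dividing by [I1 ^ (1 - p)] and taking the power [1/p] solves
   for it. *)
have I1q : 0 < I1 `^ (1 - p) by rewrite powR_gt0.
have H' : I1 `^ p <= n.*2.+1%:R `^ (1 - p) * Ipp.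
  rewrite -(ler_pM2l I1q) -powRD ?I1n ?implybT// subrK powRr1//.
  by rewrite mulrA -powRM// (mulrC I1).
have -> : I1 = (I1 `^ p) `^ p^-1 by rewrite -powRrM mulfV ?gt_eqF// powRr1.
by rewrite le_powR ?powR_ge0// invr_ge0 ltW.
Qed.

(** The terms are bounded by the sum [B], so [b ^ s <= B ^ (s - 1) b]. *)
Lemma summable_powR (b : nat -> R) (s : R) : (forall k, 0 <= b k) -> 1 <= s ->
  (\sum_(0 <= k <oo) (b k)%:E < +oo)%E ->
  (\sum_(0 <= k <oo) (b k `^ s)%:E < +oo)%E.
Proof.
move=> b0 s1 by_; set B := (\sum_(0 <= k <oo) _)%E in by_.
have B0 : (0 <= B)%E by apply: nneseries_ge0 => k _ _; rewrite lee_fin.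
have Bf : B \is a fin_num by rewrite ge0_fin_numE.
have bB k : b k <= fine B.
  rewrite -lee_fin fineK//; apply: le_trans (nneseries_lim_ge k.+1 _).
    rewrite big_nat_recr//= leeDr// sume_ge0// => i _.
    by rewrite lee_fin.
  by move=> i _ _; rewrite lee_fin.
apply: (@le_lt_trans _ _ ((fine B `^ (s - 1))%:E * B)%E).
  rewrite -nneseriesZl//; last by move=> k _; rewrite lee_fin.
  apply: lee_nneseries => k _; first by rewrite lee_fin powR_ge0.
  rewrite -EFinM lee_fin; have [->|z] := eqVneq (b k) 0.
    by rewrite mulr0 powR0// gt_eqF// (lt_le_trans ltr01).
  have -> : b k `^ s = b k `^ (s - 1) * b k.
    by rewrite -[X in _ * X]powRr1// -powRD ?z ?implybT// subrK.
  by rewrite ler_wpM2r// le_powR ?subr_ge0.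
by rewrite lte_mul_pinfty ?lee_fin ?powR_ge0.
Qed.

Lemma mule3 (x : \bar R) : (0 <= x -> 3%:E * x = 2%:E * x + x)%E.
Proof.
move=> x0; rewrite -[X in (_ = _ + X)%E]mul1e -ge0_muleDl ?lee_fin// -EFinD.
by congr (_%:E * _)%E; ring.
Qed.

(** The loss [(2^k n)^(1 - p)] of the convolution at degree [2^k n], relative to degree [n]. *)
Definition wt p k : R := (2 ^ k)%:R `^ (1 - p).

Lemma wt_gt0 p k : 0 < wt p k.
Proof. by rewrite powR_gt0// ltr0n expn_gt0. Qed.

Lemma wt_ge1 p k : p <= 1 -> 1 <= wt p k.
Proof.
move=> p1; have -> : 1 = 1 `^ (1 - p) :> R by rewrite powR1.
by rewrite le_powR ?subr_ge0// ler1n expn_gt0.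
Qed.

Lemma wtS p k : 0 < p -> p <= 1 -> wt p k.+1 <= 2 * wt p k.
Proof.
move=> p0 p1; rewrite /wt expnS natrM powRM// ler_wpM2r ?powR_ge0//.
rewrite -[leRHS]powRr1// ler_powR ?ler1n// lerBlDr lerDl; exact: ltW.
Qed.

Lemma wt_le p k : 0 < p -> wt p k <= 2 ^+ k.
Proof.
move=> p0; rewrite /wt natrX -[leRHS]powRr1 ?exprn_ge0// ler_powR ?exprn_ege1 ?ler1n//.
by rewrite lerBlDr lerDl ltW.
Qed.

Section Blocks.
Variables (p : R) (n : nat) (fa : R -> R[i]) (u : nat -> int -> R[i]).
Hypotheses (p0 : 0 < p) (p1 : p < 1) (n0 : (0 < n)%N) (Lfa : L1 fa).
Hypothesis u0 : forall k m, (2 ^ k * n < absz m)%N -> u k m = 0.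

Let N k := (2 ^ k * n)%N.
Let U k := tp (N k) (u k).
Let q k m := u k.+1 m - u k m.
Let err k := Ip p (fun x => fa x - U k x).

(** The right-hand side of the theorem in dyadic form and in p-th powers, with [u] in place of best
    approximants. *)
Definition block_error : \bar R := (\sum_(0 <= k <oo) (wt p k)%:E * err k)%E.

Let term_ge0 k : (0 <= (wt p k)%:E * err k)%E.
Proof. by rewrite mule_ge0 ?Ip_ge0// lee_fin ltW ?wt_gt0. Qed.

Let bterm_ge0 k :
  (0 <= 2%:E * ((wt p k)%:E * err k) + (wt p k.+1)%:E * err k.+1)%E.
Proof. by apply: adde_ge0 (term_ge0 _); apply: mule_ge0 (term_ge0 _). Qed.

Lemma block_error_ge0 : (0 <= block_error)%E.
Proof. by apply: nneseries_ge0 => k _ _. Qed.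

Let NS k : (N k <= N k.+1)%N.
Proof. by rewrite /N leq_mul2r leq_exp2l// leqnSn orbT. Qed.

Let q0 k m : (N k.+1 < absz m)%N -> q k m = 0.
Proof. by move=> h; rewrite /q !u0 ?subrr// (leq_ltn_trans (NS k)). Qed.

Let QE k x : tp (N k.+1) (q k) x = U k.+1 x - U k x.
Proof. by rewrite tpB /U -(tp_widen (@u0 k) (NS k)). Qed.

Let LU k : L1 (U k). Proof. exact: L1_tp. Qed.

Let merr k : cmeasurable (fun x => fa x - U k x).
Proof. by apply: cmeasurableB; [have [] := Lfa|exact: cmeasurable_tp]. Qed.

Lemma Ip_block_le k :
  ((wt p k.+1)%:E * Ip p (tp (N k.+1) (q k)) <=
   2%:E * ((wt p k)%:E * err k) + (wt p k.+1)%:E * err k.+1)%E.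
Proof.
have : (Ip p (tp (N k.+1) (q k)) <= err k + err k.+1)%E.
  apply: le_trans (IpB p0 (ltW p1) (merr k) (merr k.+1)).
  rewrite le_eqVlt; apply/orP; left; apply/eqP; apply: eq_Ip => x.
  by rewrite QE; congr nc; ring.
have w1 : (0 <= (wt p k.+1)%:E)%E by rewrite lee_fin ltW ?wt_gt0.
move/(lee_wpmul2l w1)/le_trans; apply.
rewrite ge0_muleDr ?Ip_ge0// leeD2r// muleA -EFinM lee_wpmul2r ?Ip_ge0//.
by rewrite lee_fin wtS// ltW.
Qed.

(** Each error serves two neighbouring blocks, in one of them with a weight at most doubled:
    [3 = 2 + 1]. *)
Lemma sum_blocks_le :
  (\sum_(0 <= k <oo) (2%:E * ((wt p k)%:E * err k) + (wt p k.+1)%:E * err k.+1) <=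
   3%:E * block_error)%E.
Proof.
rewrite nneseriesD; last 2 first.
- by move=> k _ _; rewrite mule_ge0.
- by move=> k _ _; exact: (term_ge0 k.+1).
rewrite nneseriesZl//.
rewrite [leRHS](mule3 block_error_ge0).
apply: leeD; first exact: lexx.
have -> : (\sum_(0 <= k <oo) (wt p k.+1)%:E * err k.+1 =
    \sum_(1 <= k <oo) (wt p k)%:E * err k)%E.
  apply: etrans (nneseries_addn 1 term_ge0); apply: eq_eseriesr => k _.
  by rewrite addn1.
rewrite /block_error (nneseries_recl (P := xpredT) (fun k _ => term_ge0 k) isT).
exact: leeDr (term_ge0 0%N).
Qed.

Hypothesis Dy : (block_error < +oo)%E.

Let err_lty : (\sum_(0 <= k <oo) err k < +oo)%E.
Proof.
apply: le_lt_trans Dy; apply: lee_nneseries => k _; first by move=> _; exact: Ip_ge0.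
by rewrite -[leLHS]mul1e lee_wpmul2r ?Ip_ge0// lee_fin wt_ge1// ltW.
Qed.

Let bsum_lty : (\sum_(0 <= k <oo) (2%:E * ((wt p k)%:E * err k) +
  (wt p k.+1)%:E * err k.+1) < +oo)%E.
Proof. by apply: le_lt_trans sum_blocks_le _; rewrite lte_mul_pinfty ?block_error_ge0. Qed.

(** Nikol'skii bounds the [L_1] norm of a block by the power [1/p] of its weighted [Ip], and [l^1]
    is contained in [l^(1/p)]. The [3] in [L] comes from [2 N + 1 <= 3 N]. *)
Lemma Ip1_blocks_lty : (\sum_(0 <= k <oo) Ip 1 (tp (N k.+1) (q k)) < +oo)%E.
Proof.
pose L : R := (3 * n)%:R `^ (1 - p).
pose b k : R := L * (wt p k.+1 * fine (Ip p (tp (N k.+1) (q k)))).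
have b0 k : 0 <= b k.
  by rewrite !mulr_ge0 ?powR_ge0 ?(ltW (wt_gt0 _ _))// fine_ge0// Ip_ge0.
have s1 : 1 <= p^-1 by rewrite invf_ge1// ltW.
have := summable_powR b0 s1; have -> : (\sum_(0 <= k <oo) (b k)%:E < +oo)%E.
  apply: (@le_lt_trans _ _ (L%:E * \sum_(0 <= k <oo) (2%:E * ((wt p k)%:E * err k) +
     (wt p k.+1)%:E * err k.+1))%E); last first.
    by rewrite lte_mul_pinfty ?lee_fin ?powR_ge0.
  rewrite -nneseriesZl; last first.
    by move=> k _; exact: bterm_ge0.
  apply: lee_nneseries => k _; first by rewrite lee_fin.
  rewrite /b EFinM lee_wpmul2l ?lee_fin ?powR_ge0// EFinM fineK ?Ip_tp_fin//.
  exact: Ip_block_le.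
move=> /(_ isT); apply: le_lt_trans.
apply: lee_nneseries => k _; first by move=> _; exact: Ip_ge0.
rewrite -[leLHS]fineK ?Ip_tp_fin ?ltr01// lee_fin.
apply: (le_trans (nikolskii _ _ p0 (ltW p1))).
rewrite le_powR ?invr_ge0 ?(ltW p0)// ?mulr_ge0 ?powR_ge0 ?fine_ge0 ?Ip_ge0//.
rewrite /b mulrA ler_wpM2r ?fine_ge0 ?Ip_ge0// /L /wt -powRM//.
rewrite le_powR ?subr_ge0 ?(ltW p1)// -natrM ler_nat /N.
have : (0 < 2 ^ k.+1 * n)%N by rewrite muln_gt0 expn_gt0.
rewrite -mulnA (mulnC n); lia.
Qed.

Lemma coef_cvg m : nc (fc fa m - u k m) @[k --> \oo] --> (0 : R).
Proof.
have blocks : (\sum_(0 <= k <oo) Ip 1 (fun x => U k.+1 x - U k x)%R < +oo)%E.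
  apply: le_lt_trans Ip1_blocks_lty; apply: lee_nneseries => k _.
    by move=> _; exact: Ip_ge0.
  rewrite (@eq_Ip _ 1 (tp (N k.+1) (q k)) (fun x => U k.+1 x - U k x))//.
  by move=> x; rewrite QE.
have := fc_cvg_approx p0 (ltW p1) LU Lfa err_lty blocks m.
suff -> : (fun k => nc (fc fa m - fc (U k) m)) = (fun k => nc (fc fa m - u k m)) by [].
apply/funext => k; rewrite fc_tp /truncate; case: leqP => // h.
by rewrite u0.
Qed.

(** [h] stands for [f^(alpha) - W^(alpha)] when [g = 0] and for [f - W] when [g = -alpha]. The [L_1]
    convergence of the filtered blocks is a hypothesis because the two cases obtain it
    differently. *)
Lemma jackson_blocks (r i : nat) (g C : R) (h : R -> R[i]) : 0 < C ->
  (forall N' c, (n <= N')%N ->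
    (Ip p (tp N' (fun m => ((1 - cutoff r.*2 (2 ^ i) `|m%:~R|)%:C%C *
       ik_pow g m * c m)%R)) <=
     (C * (n%:R `^ (g * p + p - 1) * N'%:R `^ (1 - p)))%:E * Ip p (tp N' c))%E) ->
  L1 h ->
  (\sum_(0 <= k <oo) Ip 1 (tp (N k.+1) (fun m =>
     ((1 - cutoff r.*2 (2 ^ i) `|m%:~R|)%:C%C * ik_pow g m * q k m)%R)) < +oo)%E ->
  (forall m, fc h m = (1 - cutoff r.*2 (2 ^ i) `|m%:~R|)%:C%C * ik_pow g m *
     (fc fa m - u 0%N m)) ->
  (Ip p h <= (3 * C * n%:R `^ (g * p))%:E * block_error)%E.
Proof.
move=> C0 HC Lh G1 fh.
have n0' : 0 < n%:R :> R by rewrite ltr0n.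
pose H m : R[i] := (1 - cutoff r.*2 (2 ^ i) `|m%:~R|)%:C%C * ik_pow g m.
pose G k := tp (N k.+1) (fun m => H m * q k m).
have LG k : L1 (G k) by exact: L1_tp.
have cc m : ccvg (fun k => fc (G k) m) (fc h m).
  rewrite /ccvg.
  have -> : (fun J => nc (fc h m - csum (fun k => fc (G k) m) J)) =
     (fun J => nc (H m) * nc (fc fa m - u J m)).
    apply/funext => J; rewrite -Normc.normcM fh -/(H m); congr nc.
    have -> : csum (fun k => fc (G k) m) J = H m * (u J m - u 0%N m).
      rewrite /csum (eq_bigr (fun k : 'I_J => H m * q k m)); last first.
        move=> k _; rewrite fc_tp /truncate; case: leqP => // h'.
        by rewrite q0 ?mulr0.
      rewrite -mulr_sumr -(big_mkord xpredT (fun k => u k.+1 m - u k m)).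
      by rewrite telescope_sumr.
    ring.
  rewrite -(mulr0 (nc (H m))); apply: cvgM; first exact: cvg_cst.
  exact: coef_cvg.
apply: (le_trans (Ip_series p0 (ltW p1) LG G1 Lh cc)).
apply: (@le_trans _ _ ((C * n%:R `^ (g * p))%:E *
   \sum_(0 <= k <oo) (2%:E * ((wt p k)%:E * err k) + (wt p k.+1)%:E * err k.+1))%E); last first.
  rewrite -mulrA (EFinM 3) -muleA (muleC 3%:E) -muleA lee_wpmul2l//.
    by rewrite lee_fin mulr_ge0 ?powR_ge0 ?(ltW C0).
  by rewrite muleC; exact: sum_blocks_le.
rewrite -nneseriesZl; last first.
  by move=> k _; exact: bterm_ge0.
apply: lee_nneseries => k _; first by move=> _; exact: Ip_ge0.
have nN : (n <= N k.+1)%N by rewrite /N leq_pmull// expn_gt0.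
apply: (le_trans (HC _ (q k) nN)).
(* The loss of the convolution is exactly the weight of the block. *)
have -> : C * (n%:R `^ (g * p + p - 1) * (N k.+1)%:R `^ (1 - p)) =
   C * n%:R `^ (g * p) * wt p k.+1.
  rewrite /N natrM powRM// -/(wt p k.+1) (mulrC (wt p k.+1)) mulrA mulrA; congr (_ * _).
  rewrite -mulrA -powRD ?(gt_eqF n0') ?implybT//; congr (_ * _ `^ _); ring.
rewrite EFinM -muleA lee_wpmul2l ?Ip_block_le//.
by rewrite lee_fin mulr_ge0 ?powR_ge0 ?(ltW C0).
Qed.

End Blocks.

End Approximation.

(** * Construction of [W] and comparison with [T] *)

Section Main.
Variable R : realType.
Implicit Types (f g h : R -> R[i]) (p x alpha : R) (k n : nat) (m : int).
Implicit Types (c : int -> R[i]) (u : nat -> int -> R[i]).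
Notation mu := (@lebesgue_measure R).
Notation twopi := (pi *+ 2 : R).
Notation fc := (@fourier_coef R).

(** The scale of [eta]: its support must stay within [|k| <= n], so that [W] has degree [n], while
    [2^i] remains comparable to [n]. The form [2^i - 1] follows the exact end of the support and
    admits [i = 0] for [n] below [q + 1]. *)
Lemma ex_level q n : (0 < n)%N ->
  exists i, (n < q.+1 * 2 ^ i.+1)%N /\ (q.+1 * (2 ^ i).-1 <= n)%N.
Proof.
move=> n0; exists (trunc_log 2 (n %/ q.+1).+1).
have /andP[h1 h2] := trunc_log_bounds (isT : 1 < 2)%N (ltn0Sn (n %/ q.+1)).
set i := trunc_log _ _ in h1 h2 *.
split.
  apply: (@leq_trans (q.+1 * (n %/ q.+1).+1)); first by rewrite mulnC ltn_ceil.
  by rewrite leq_mul2l ltnW.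
have : ((2 ^ i).-1 <= n %/ q.+1)%N by rewrite -ltnS prednK ?expn_gt0.
by rewrite leq_divRL// mulnC.
Qed.

Lemma level_le q n i : (q.+1 * (2 ^ i).-1 <= n)%N -> (2 ^ i <= n.+1)%N.
Proof.
move=> h; rewrite -(prednK (_ : 0 < 2 ^ i)%N) ?expn_gt0// ltnS.
by rewrite (leq_trans _ h)// leq_pmull.
Qed.

Lemma cutoff_level_eq0 q n i m : (q.+1 * (2 ^ i).-1 <= n)%N -> (n < absz m)%N ->
  cutoff q (2 ^ i) `|m%:~R : R| = 0.
Proof.
move=> h nm; have i0 : (0 < 2 ^ i)%N by rewrite expn_gt0.
set K := (2 ^ i).-1 in h.
have e : (2 ^ i)%:R = K%:R + 1 :> R by rewrite natr1 prednK.
apply: cutoff_eq0 => //; rewrite norm_intr e addrK.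
have : (q.+1 * K).+1%:R <= (absz m)%:R :> R by rewrite ler_nat (leq_ltn_trans h).
by apply: le_trans; rewrite -natr1 mulSn natrD natrM; lra.
Qed.

(** For [g = 0] and [p = 1] the exponent [g p + p - 1] is 0, out of reach of [highpass]. Only
    finiteness of a sum is at stake, so a constant depending on [n] will do. *)
Lemma Ip1_highpass_crude n (N i q : nat) c : (q.+1 * (2 ^ i).-1 <= n)%N -> (n <= N)%N ->
  (forall m, (N < absz m)%N -> c m = 0) ->
  (Ip 1 (tp N (fun m => (1 - cutoff q (2 ^ i) `|m%:~R|)%:C%C * c m)%R) <=
   (1 + n.*2.+1%:R * twopi)%:E * Ip 1 (tp N c))%E.
Proof.
move=> hn nN c0.
pose d m := (cutoff q (2 ^ i) `|m%:~R : R|)%:C%C * c m.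
have d0 m : (n < absz m)%N -> d m = 0.
  by move=> nm; rewrite /d (cutoff_level_eq0 hn nm) mul0r.
have e x : tp N (fun m => (1 - cutoff q (2 ^ i) `|m%:~R|)%:C%C * c m) x =
    tp N c x - tp n d x.
  rewrite -(tp_widen d0 nN) -tpB; congr (tp _ _ x); apply/funext => m.
  by rewrite /d rmorphB rmorph1 mulrBl mul1r.
rewrite (@eq_Ip _ 1 _ (fun x => tp N c x - tp n d x)); last by move=> x; rewrite e.
apply: (le_trans (IpB ltr01 (lexx 1) (cmeasurable_tp _ _) (cmeasurable_tp _ _))).
have I0 := Ip_ge0 1 (tp N c).
have Ifin := Ip_tp_fin N c (@ltr01 R).
rewrite EFinD ge0_muleDl ?lee_fin ?mulr_ge0 ?(ltW (twopi_gt0 R))// mul1e leeD2l//.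
have B0 : 0 <= fine (Ip 1 (tp N c)) by rewrite fine_ge0.
apply: (le_trans (Ip1_tp_le (n := n) (c := d) B0 _)) => [m mn|].
  rewrite /d Normc.normcM nc_real ger0_norm ?cutoff_ge0//.
  rewrite (le_trans (ler_piMl (nc_ge0 _) (cutoff_le1 _ _ _)))//.
  have <- : fc (tp N c) m = c m.
    by rewrite fc_tp /truncate (leq_trans mn nN).
  by apply: nc_fc_le; exact: L1_tp.
by rewrite -[X in (_ <= _ * X)%E]fineK// -EFinM lee_fin mulrAC.
Qed.

(** The smallest value occurs in the logarithmic case at [n = 1]. This bound absorbs the part of the
    estimate that is free of [rho]. *)
Lemma rho_lower p alpha n : 0 < p -> p < 1 -> (0 < n)%N ->
  ln 2 <= rho alpha p n `^ p.
Proof.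
move=> p0 p1 n0; have l1 : ln 2 <= 1 :> R.
  rewrite -[leRHS](expRK 1) ler_ln ?posrE ?expR_gt0//.
  by have := @expR_ge1Dx R 1; apply: le_trans; rewrite -natr1.
rewrite /rho; case: ifP => [_|/negbT]; first by rewrite powR1.
rewrite negb_or -leNgt => /andP[_ ale]; case: ifP => [_|_].
  rewrite -powRrM mulVf ?gt_eqF// powRr1 ?ln_ge0 ?ler1n//.
  by rewrite ler_ln ?posrE// ler_nat.
apply: (@le_trans _ _ (n%:R `^ 0)); first by rewrite powRr0.
by rewrite -powRrM ler_powR ?ler1n// mulr_ge0 ?subr_ge0 ?(ltW p0).
Qed.

Lemma rho_gt0 p alpha n : 0 < p -> p < 1 -> (0 < n)%N -> 0 < rho alpha p n.
Proof.
move=> p0 p1 n0; rewrite lt0r; apply/andP; split.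
  apply: contraTneq (rho_lower alpha p0 p1 n0) => ->.
  by rewrite powR0 ?gt_eqF// -ltNge ln_gt0// ltr1n.
rewrite /rho; case: ifP => _; first exact: ler01.
by case: ifP => _; exact: powR_ge0.
Qed.

Lemma main_estimate p alpha : 0 < p -> p < 1 -> 0 < alpha ->
  exists2 C : R, 0 < C & forall f fa n u T Ta, (0 < n)%N ->
  L1 f -> weyl_derivative alpha f fa ->
  trig_poly n T -> normLp p (f \- T) = best_approx p n f ->
  weyl_derivative alpha T Ta ->
  (forall k m, (2 ^ k * n < absz m)%N -> u k m = 0) ->
  (block_error p n fa u < +oo)%E ->
  (Ip p (fun x => fa x - Ta x)%R <=
    (C * rho alpha p n `^ p)%:E * block_error p n fa u)%E.
Proof.
move=> p0 p1 a0; have [r rp] := ex_order p0.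
have r1 : 1 <= r%:R * 1 :> R.
  by rewrite mulr1 (le_trans rp)// ler_piMr// ltW.
have tA : 0 * p + p - 1 < 0 by rewrite mul0r add0r subr_lt0.
have tB : - alpha * p + p - 1 < 0.
  by have : 0 < alpha * p by [rewrite mulr_gt0]; rewrite mulNr => ?; lra.
have t1 : - alpha * 1 + 1 - 1 < 0 by rewrite mulr1 addrK oppr_lt0.
have [A A0 HA] := highpass p0 (ltW p1) rp tA.
have [B B0 HB] := highpass p0 (ltW p1) rp tB.
have [D D0 HD] := highpass (@ltr01 R) (lexx 1) r1 t1.
have [E E0 HE] := bernstein p0 p1 a0.
have l2 : 0 < ln 2 :> R by rewrite ln_gt0// ltr1n.
(* First summand: the estimate of [f^(alpha) - W^(alpha)], divided by the lower bound [ln 2] of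
   [rho ^ p]. Second: Bernstein for [W - T], the 2 coming from the two errors [f - T] and
   [f - W]. *)
exists (3 * A / ln 2 + E * (2 * (3 * B))).
  by rewrite addr_gt0 ?divr_gt0 ?mulr_gt0.
move=> f fa n u T Ta n0 Lf [fain fafc] /trig_polyP[tc -> tc0] Tbest [Tain Tafc] u0 Dy.
have n0' : 0 < n%:R :> R by rewrite ltr0n.
have Lfa := in_Lp1_L1 fain; have LTa := in_Lp1_L1 Tain.
have [i [ni ni']] := ex_level r.*2 n0; have ni2 := level_le ni'.
pose eta m : R := cutoff r.*2 (2 ^ i) `|m%:~R|.
have eta0 m : (n < absz m)%N -> eta m = 0 by exact: cutoff_level_eq0.
have etaz : eta 0 = 1 by rewrite /eta cutoff_eq1 ?expn_gt0// normr0 ltr0n expn_gt0.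
have u00 m : (n < absz m)%N -> u 0%N m = 0 by move=> h; apply: u0; rewrite mul1n.
have ik0 m : ik_pow (0 : R) m = 1.
  by rewrite /ik_pow powRr0 !mul0r cis0 mulr1.
have ikN m : m != 0 -> ik_pow alpha m * ik_pow (- alpha) m = 1 :> R[i].
  move=> m0; rewrite /ik_pow mulrACA -rmorphM /= -powRD; last first.
    by rewrite normr_eq0 intr_eq0 m0 implybT.
  rewrite subrr powRr0 mul1r -cisD !mulNr subrr cis0//.
have ika0 : ik_pow alpha 0 = 0 :> R[i].
  by rewrite /ik_pow normr0 powR0 ?gt_eqF// mul0r.
(* [w] and [wa] are the coefficients of [W] and [W^(alpha)]. As [eta 0 = 1], the mean of [f] goes
   into [W] and the value of [(ik)^(-alpha)] at 0 is multiplied by 0. *)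
pose w m := (eta m)%:C%C * fc f m + (1 - eta m)%:C%C * (ik_pow (- alpha) m * u 0%N m).
pose wa m := (eta m)%:C%C * fc fa m + (1 - eta m)%:C%C * u 0%N m.
have waE m : wa m = ik_pow alpha m * w m.
  rewrite /wa /w; have [->|m0] := eqVneq m 0.
    by rewrite ika0 mul0r etaz subrr mul0r addr0 fafc eqxx mulr0.
  rewrite fafc (negbTE m0) mulrDr mulrCA; congr (_ + _).
  by rewrite mulrCA; congr (_ * _); rewrite mulrA ikN// mul1r.
have trw d : (forall m, (n < absz m)%N -> d m = 0) -> forall m, truncate n d m = d m.
  by move=> d0 m; rewrite /truncate; case: leqP => // /d0.
have w0 m : (n < absz m)%N -> w m = 0.
  by move=> h; rewrite /w eta0// u00// rmorph0 mul0r !mulr0 addr0.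
have wa0 m : (n < absz m)%N -> wa m = 0.
  by move=> h; rewrite /wa eta0// u00// rmorph0 mul0r !mulr0 addr0.
have Q1 := Ip1_blocks_lty p0 p1 n0 Lfa u0 Dy.
pose q k m := u k.+1 m - u k m.
have q0 k m : (2 ^ k.+1 * n < absz m)%N -> q k m = 0.
  move=> h; rewrite /q !u0 ?subrr// (leq_ltn_trans _ h)//.
  by rewrite leq_mul2r leq_exp2l// leqnSn orbT.
have nN k : (n <= 2 ^ k.+1 * n)%N by rewrite leq_pmull// expn_gt0.
have estA : (Ip p (fun x => fa x - tp n wa x)%R <= (3 * A)%:E * block_error p n fa u)%E.
  have -> : 3 * A = 3 * A * n%:R `^ (0 * p) by rewrite mul0r powRr0 mulr1.
  apply: (@jackson_blocks _ p n fa u p0 p1 n0 Lfa u0 Dy r i 0 A (fun x => fa x - tp n wa x) A0).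
  - by move=> N' c nN'; exact: HA.
  - exact: (L1B Lfa (L1_tp n wa)).
  - apply: (@le_lt_trans _ _ ((1 + n.*2.+1%:R * twopi)%:E *
       \sum_(0 <= k <oo) Ip 1 (tp (2 ^ k.+1 * n) (q k)))%E); last first.
      by rewrite lte_mul_pinfty ?lee_fin ?addr_ge0 ?mulr_ge0 ?(ltW (twopi_gt0 R)).
    rewrite -nneseriesZl; last by move=> k _; exact: Ip_ge0.
    apply: lee_nneseries => k _; first by move=> _; exact: Ip_ge0.
    apply: le_trans (Ip1_highpass_crude ni' (nN k) (@q0 k)).
    rewrite le_eqVlt; apply/orP; left; apply/eqP; congr (Ip 1 (tp _ _)).
    by apply/funext => m; rewrite ik0 mulr1.
  - move=> m; rewrite (fcB m Lfa (L1_tp n wa)) fc_tp trw// ik0 mulr1 -/(eta m) /wa.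
    by rewrite rmorphB rmorph1; ring.
have estB : (Ip p (fun x => f x - tp n w x)%R <=
    (3 * B * n%:R `^ (- alpha * p))%:E * block_error p n fa u)%E.
  apply: (@jackson_blocks _ p n fa u p0 p1 n0 Lfa u0 Dy r i (- alpha) B (fun x => f x - tp n w x) B0).
  - by move=> N' c nN'; exact: HB.
  - exact: (L1B Lf (L1_tp n w)).
  - apply: (@le_lt_trans _ _ ((D * n%:R `^ (- alpha * 1 + 1 - 1))%:E *
       \sum_(0 <= k <oo) Ip 1 (tp (2 ^ k.+1 * n) (q k)))%E); last first.
      by rewrite lte_mul_pinfty ?lee_fin ?mulr_ge0 ?powR_ge0 ?(ltW D0).
    rewrite -nneseriesZl; last by move=> k _; exact: Ip_ge0.
    apply: lee_nneseries => k _; first by move=> _; exact: Ip_ge0.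
    have := HD n (2 ^ k.+1 * n)%N i (q k) n0 (nN k) ni ni2.
    by rewrite subrr powRr0 mulr1.
  - move=> m; rewrite (fcB m Lf (L1_tp n w)) fc_tp trw// -/(eta m) /w.
    have [->|m0] := eqVneq m 0.
      by rewrite etaz subrr rmorph1 rmorph0 !mul0r mul1r addr0 subrr.
    have -> : fc f m = ik_pow (- alpha) m * fc fa m.
      by rewrite fafc (negbTE m0) mulrA (mulrC (ik_pow (- alpha) m)) ikN// mul1r.
    by rewrite rmorphB rmorph1; ring.
have fT : (Ip p (fun x => f x - tp n tc x)%R <= Ip p (fun x => f x - tp n w x)%R)%E.
  apply: (normLp_le p0); rewrite -/(f \- tp n tc) Tbest.
  exact: best_approx_tp.
(* [Ta] is an arbitrary representative with the right coefficients, so it equals the termwise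
   derivative of [T] only almost everywhere. *)
have Ta_ae : {ae mu, forall x, (@circle R) x ->
    Ta x - tp n (fun m => ik_pow alpha m * tc m) x = 0}.
  apply: fourier_unique.
    exact: (L1B LTa (L1_tp n _)).
  move=> m; rewrite (fcB m LTa (L1_tp _ _)) fc_tp trw; last first.
    by move=> m' h; rewrite tc0 ?mulr0.
  rewrite Tafc fc_tp trw//; case: eqVneq => [->|_]; last by rewrite subrr.
  by rewrite ika0 mul0r subrr.
have [mfa _] := Lfa; have [mTa _] := LTa; have [mf _] := Lf.
have -> : Ip p (fun x => fa x - Ta x) =
    Ip p (fun x => fa x - tp n (fun m => ik_pow alpha m * tc m) x).
  apply: ge0_ae_eq_integral.
  - exact: measurable_circle.
  - exact: measurable_funTS (measurable_nc_powR p (cmeasurableB mfa mTa)).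
  - exact: measurable_funTS (measurable_nc_powR p (cmeasurableB mfa (cmeasurable_tp _ _))).
  - by move=> x _; rewrite lee_fin powR_ge0.
  - by move=> x _; rewrite lee_fin powR_ge0.
  - apply: ae_imp Ta_ae => x h cx; have /eqP := h cx.
    by rewrite subr_eq0 => /eqP ->.
pose V := tp n (fun m => ik_pow alpha m * (w m - tc m)).
have VE x : fa x - tp n (fun m => ik_pow alpha m * tc m) x = (fa x - tp n wa x) + V x.
  have -> : V x = tp n wa x - tp n (fun m => ik_pow alpha m * tc m) x.
    rewrite -tpB; congr (tp _ _ x); apply/funext => m.
    by rewrite waE mulrBr.
  by rewrite addrA subrK.
rewrite (@eq_Ip _ p _ (fun x => (fa x - tp n wa x) + V x)); last by move=> x; rewrite VE.
apply: (le_trans (IpD p0 (ltW p1) (cmeasurableB mfa (cmeasurable_tp _ _)) (cmeasurable_tp _ _))).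
have wT : (Ip p (tp n (fun m => w m - tc m)%R) <= 2%:E * Ip p (fun x => f x - tp n w x)%R)%E.
  rewrite (@eq_Ip _ p _ (fun x => (f x - tp n tc x) - (f x - tp n w x))); last first.
    by move=> x; rewrite tpB; congr nc; ring.
  apply: (le_trans (IpB p0 (ltW p1) (cmeasurableB mf (cmeasurable_tp _ _))
     (cmeasurableB mf (cmeasurable_tp _ _)))).
  rewrite mule_natl mule2n.
  by apply: leeD; [exact: fT|exact: lexx].
have rho0 : 0 <= rho alpha p n `^ p by exact: powR_ge0.
have D00 := block_error_ge0 p n fa u.
rewrite mulrDl EFinD ge0_muleDl; last 2 first.
- by rewrite lee_fin mulr_ge0// divr_ge0 ?(ltW l2)// mulr_ge0 ?(ltW A0).
- by rewrite lee_fin !mulr_ge0 ?(ltW E0) ?(ltW B0).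
apply: leeD.
  apply: (le_trans estA); rewrite lee_wpmul2r// lee_fin mulrAC ler_pdivlMr//.
  by rewrite ler_pM2l ?mulr_gt0//; exact: rho_lower.
apply: (le_trans (HE n _ n0)).
apply: (@le_trans _ _ ((E * (n%:R `^ (alpha * p) * rho alpha p n `^ p))%:E *
   (2%:E * ((3 * B * n%:R `^ (- alpha * p))%:E * block_error p n fa u)))%E).
  rewrite lee_wpmul2l ?lee_fin ?mulr_ge0 ?powR_ge0 ?(ltW E0)//.
  by apply: (le_trans wT); rewrite lee_wpmul2l ?lee_fin.
rewrite !muleA -!EFinM lee_wpmul2r// lee_fin.
(* The power of [n] lost by Bernstein cancels the one gained in [estB], leaving [rho] alone. *)
have e : n%:R `^ (alpha * p) * n%:R `^ (- alpha * p) = 1 :> R.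
  rewrite -powRD; last by rewrite (gt_eqF n0') implybT.
  by rewrite mulNr subrr powRr0.
rewrite le_eqVlt; apply/orP; left; apply/eqP.
transitivity (E * (2 * (3 * B)) * rho alpha p n `^ p *
  (n%:R `^ (alpha * p) * n%:R `^ (- alpha * p))); last by rewrite e mulr1.
ring.
Qed.

End Main.

(** * From dyadic blocks to the sum over [nu] *)

Section BlockErrorBound.
Variable R : realType.
Implicit Types (f g h : R -> R[i]) (p x alpha : R) (k n : nat) (m : int).
Notation twopi := (pi *+ 2 : R).

(** Cauchy condensation: the block [(M, 2M]] has [M] terms, each at least the one at [2M] by
    monotonicity, and [2 M (2M)^(-p) = (2M)^(1 - p)]. *)
Lemma dyadic_block_sum (e : nat -> R) p n K : 0 < p -> (0 < n)%N ->
  (forall k, 0 <= e k) -> (forall k l, (k <= l)%N -> e l <= e k) ->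
  \sum_(k < K) (2 ^ k.+1 * n)%:R `^ (1 - p) * e (2 ^ k.+1 * n)%N `^ p <=
  2 * \sum_(n.+1 <= nu < (2 ^ K * n).+1) e nu `^ p * (nu%:R `^ p)^-1.
Proof.
move=> p0 n0 e0 eE; elim: K => [|K IH].
  by rewrite big_ord0 mul1n big_geq// mulr0.
have nK : (n.+1 <= (2 ^ K * n).+1)%N by rewrite ltnS leq_pmull// expn_gt0.
have KK : ((2 ^ K * n).+1 <= (2 ^ K.+1 * n).+1)%N.
  by rewrite ltnS leq_mul2r leq_exp2l// leqnSn orbT.
rewrite big_ord_recr/= (big_cat_nat nK KK)/= mulrDr; apply: lerD => //.
set M := (2 ^ K * n)%N; have M0 : (0 < M)%N by rewrite muln_gt0 expn_gt0.
have -> : (2 ^ K.+1 * n = 2 * M)%N by rewrite expnS mulnA.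
have M2 : 0 < (2 * M)%:R :> R by rewrite ltr0n muln_gt0.
apply: (@le_trans _ _ (2 * \sum_(M.+1 <= nu < (2 * M).+1)
    (e (2 * M)%N `^ p * ((2 * M)%:R `^ p)^-1))); last first.
  rewrite ler_pM2l// big_seq [leRHS]big_seq; apply: ler_sum => nu.
  rewrite mem_index_iota => /andP[n1 n2].
  have nu0 : 0 < nu%:R :> R by rewrite ltr0n (leq_trans _ n1).
  apply: ler_pM; rewrite ?powR_ge0 ?invr_ge0//.
    by rewrite le_powR ?(ltW p0)// eE.
  rewrite lef_pV2 ?posrE ?powR_gt0//.
  by rewrite le_powR ?(ltW p0)// ler_nat.
rewrite sumr_const_nat.
have -> : ((2 * M).+1 - M.+1 = M)%N by rewrite subSS mul2n -addnn addnK.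
rewrite powRB ?(gt_eqF M2) ?implybT// powRr1 ?(ltW M2)//.
rewrite -[X in _ <= 2 * X]mulr_natl natrM le_eqVlt; apply/orP; left; apply/eqP; ring.
Qed.

Lemma nneseries_le (s : nat -> \bar R) (N : nat) (B : \bar R) :
  (forall k, (0 <= s k)%E) ->
  (forall K, \sum_(N <= k < K) s k <= B)%E -> (\sum_(N <= k <oo) s k <= B)%E.
Proof.
move=> s0 sB; apply: lime_le; first by apply: is_cvg_nneseries => k _ _.
by apply: nearW => K.
Qed.

Lemma block_error_le p n (fa : R -> R[i]) (X eps : R) : 0 < p -> p < 1 ->
  (0 < n)%N -> L1 fa -> 0 < eps ->
  (((n%:R `^ (1 - p))^-1)%:E * \sum_(n.+1 <= nu <oo)
     best_approx p nu fa `^ p * ((nu%:R `^ p)^-1)%:E = X%:E)%E ->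
  exists2 u : nat -> int -> R[i],
    (forall k m, (2 ^ k * n < absz m)%N -> u k m = 0) &
    (block_error p n fa u <=
       (twopi * (fine (best_approx p n fa) `^ p + 2 * X) + 2 * eps)%:E)%E.
Proof.
move=> p0 p1 n0 Lfa eps0 HX.
have n0' : 0 < n%:R `^ (1 - p) :> R by rewrite powR_gt0 ?ltr0n.
pose e k := fine (best_approx p k fa).
have bE k : best_approx p k fa = (e k)%:E by rewrite fineK// best_approx_fin// ltW.
have e0 k : 0 <= e k by rewrite fine_ge0// best_approx_ge0.
have eE k l : (k <= l)%N -> e l <= e k.
  by move=> kl; rewrite -lee_fin -!bE best_approx_antitone.
(* The slack [eps 4^(-k)] beats the weight, which is at most [2^k]: the weighted slacks add up to at
   most [2 eps]. *)
have /choice[u Hu] : forall k, exists c, (Ip p (fun x => fa x - tp (2 ^ k * n) c x)%R <=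
    (twopi * e (2 ^ k * n)%N `^ p + eps * (4^-1) ^+ k)%:E)%E /\
    forall m, (2 ^ k * n < absz m)%N -> c m = 0.
  move=> k; have ek : 0 < eps * (4^-1) ^+ k by rewrite mulr_gt0// exprn_gt0// invr_gt0.
  by have [c c1 c2] := near_best (2 ^ k * n) p0 (ltW p1) Lfa ek; exists c.
exists u; first by move=> k; have [] := Hu k.
have sE nu : (best_approx p nu fa `^ p * ((nu%:R `^ p)^-1)%:E)%E =
    (e nu `^ p * (nu%:R `^ p)^-1)%:E by rewrite bE poweR_EFin -EFinM.
have s0 nu : 0 <= e nu `^ p * (nu%:R `^ p)^-1 by rewrite mulr_ge0 ?invr_ge0 ?powR_ge0.
have part K : \sum_(n.+1 <= nu < K) e nu `^ p * (nu%:R `^ p)^-1 <= X * n%:R `^ (1 - p).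
  rewrite -ler_pdivrMr// mulrC -lee_fin -HX EFinM lee_wpmul2l ?lee_fin ?invr_ge0 ?(ltW n0')//.
  rewrite -sumEFin; under eq_bigr do rewrite -sE.
  by apply: nneseries_lim_ge => nu _ _; rewrite sE lee_fin.
apply: nneseries_le => [k|K]; first by rewrite mule_ge0 ?Ip_ge0// lee_fin ltW ?wt_gt0.
(* One more term makes the sum nonempty: the term [k = 0] produces [E_n], the others are
   condensed. *)
apply: (@le_trans _ _ (\sum_(0 <= k < K.+1) (wt p k)%:E *
    Ip p (fun x => fa x - tp (2 ^ k * n) (u k) x)%R)%E).
  rewrite [leRHS]big_nat_recr//= leeDl// mule_ge0 ?Ip_ge0// lee_fin ltW ?wt_gt0//.
apply: (@le_trans _ _ (\sum_(0 <= k < K.+1) (wt p k *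
    (twopi * e (2 ^ k * n)%N `^ p + eps * (4^-1) ^+ k))%:E)%E).
  apply: lee_sum => k _; rewrite EFinM lee_wpmul2l ?lee_fin ?(ltW (wt_gt0 _ _))//.
  by have [] := Hu k.
rewrite sumEFin lee_fin; under eq_bigr do rewrite mulrDr.
rewrite big_split /=; apply: lerD.
  rewrite big_mkord big_ord_recl /= mulrDr; apply: lerD.
    by rewrite /wt expn0 powR1 mul1r mul1n.
  rewrite (eq_bigr (fun k : 'I_K => (twopi / n%:R `^ (1 - p)) *
     ((2 ^ k.+1 * n)%:R `^ (1 - p) * e (2 ^ k.+1 * n)%N `^ p))); last first.
    move=> k _; rewrite /wt /bump /= add1n natrM powRM//.
    by field; rewrite gt_eqF.
  rewrite -mulr_sumr.
  apply: (@le_trans _ _ (twopi / n%:R `^ (1 - p) * (2 * (X * n%:R `^ (1 - p))))).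
    rewrite ler_wpM2l ?divr_ge0 ?(ltW (twopi_gt0 R)) ?(ltW n0')//.
    by rewrite (le_trans (dyadic_block_sum K p0 n0 e0 eE))// ler_wpM2l.
  by rewrite le_eqVlt; apply/orP; left; apply/eqP; field; rewrite gt_eqF.
apply: (@le_trans _ _ (eps * \sum_(0 <= k < K.+1) (2^-1) ^+ k)).
  rewrite mulr_sumr; apply: ler_sum => k _; rewrite mulrCA ler_wpM2l ?(ltW eps0)//.
  rewrite (le_trans (ler_wpM2r _ (wt_le k p0))) ?exprn_ge0 ?invr_ge0//.
  by rewrite -exprMn le_eqVlt; apply/orP; left; apply/eqP; congr (_ ^+ _); field.
rewrite mulrC ler_wpM2r ?(ltW eps0)//.
have h0 : 0 < 2^-1 :> R by rewrite invr_gt0.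
have h1 : 2^-1 < 1 :> R by rewrite invf_lt1 ?ltr1n.
apply: (le_trans (geometric_sum_le 0 K.+1 h0 h1)); rewrite expr0.
by rewrite le_eqVlt; apply/orP; left; apply/eqP; field.
Qed.

(** Leads back from p-th powers to quasi-norms: [x ^ p] and [y] are each at most
    [(x + y ^ (1/p)) ^ p]. *)
Lemma powR_split_le (x y p : R) : 0 < p -> 0 <= x -> 0 <= y ->
  x `^ p + 2 * y <= 3 * (x + y `^ p^-1) `^ p.
Proof.
move=> p0 x0 y0; have y1 := powR_ge0 y p^-1.
have h1 : x `^ p <= (x + y `^ p^-1) `^ p.
  by rewrite le_powR ?(ltW p0)// lerDl.
have h2 : y <= (x + y `^ p^-1) `^ p.
  rewrite -[leLHS]powRr1// -[X in y `^ X](mulVf (_ : p != 0)) ?gt_eqF// powRrM.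
  by rewrite le_powR ?(ltW p0)// lerDr.
lra.
Qed.

End BlockErrorBound.

(** * Removal of the slack and return to quasi-norms *)

Theorem theorem2p4 (R : realType) (p alpha : R)
    (p0 : 0 < p) (p1 : p < 1) (alpha0 : 0 < alpha) :
  exists C : R, 0 < C /\
    forall f fa : R -> R[i],
      in_Lp 1 f -> weyl_derivative alpha f fa ->
    forall n : nat, (0 < n)%N ->
    forall T Ta : R -> R[i],
      trig_poly n T -> normLp p (f \- T) = best_approx p n f ->
      weyl_derivative alpha T Ta ->
      (normLp p (fa \- Ta)%R <=
        C%:E * (rho alpha p n)%:E *
        (best_approx p n fa +
         (((n%:R `^ (1 - p))^-1)%:E *
          \sum_(n.+1 <= nu <oo)
             best_approx p nu fa `^ p * ((nu%:R `^ p)^-1)%:E) `^ p^-1))%E.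
Proof.
have [C C0 HC] := main_estimate p0 p1 alpha0.
have pV0 : 0 < p^-1 by rewrite invr_gt0.
have C3 : 0 < 3 * C by rewrite mulr_gt0.
(* [C] bounds p-th powers and the 3 comes from [powR_split_le]. *)
exists ((3 * C) `^ p^-1); split; first exact: powR_gt0.
move=> f fa fin Hfa n n0 T Ta HT Tbest HTa.
have Lf := in_Lp1_L1 fin; have Lfa : L1 fa by case: Hfa => /in_Lp1_L1.
set S := (\sum_(_ <= _ <oo) _)%E.
set Y := (_ * S)%E.
have r0 := rho_gt0 alpha p0 p1 n0.
have cr0 : 0 < (3 * C) `^ p^-1 * rho alpha p n by rewrite mulr_gt0 ?powR_gt0.
have S0 : (0 <= S)%E.
  by apply: nneseries_ge0 => nu _ _; rewrite mule_ge0 ?poweR_ge0// lee_fin invr_ge0 powR_ge0.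
have Y0 : (0 <= Y)%E by rewrite mule_ge0// lee_fin invr_ge0 powR_ge0.
(* A divergent tail sum makes the right-hand side infinite, as [rho] is positive; otherwise the
   block error is finite and the main estimate applies. *)
rewrite -EFinM; case: (eqVneq Y +oo%E) => [->|Yoo].
  rewrite poweRyr ?gt_eqF// addey; last first.
    by rewrite -ltNye (lt_le_trans _ (best_approx_ge0 _ _ _)).
  by rewrite gt0_muley ?lte_fin// leey.
have Yfin : Y \is a fin_num by rewrite ge0_fin_numE// ltey.
pose X := fine Y; have YX : Y = X%:E by rewrite fineK.
have X0 : 0 <= X by rewrite fine_ge0.
have e0 : 0 <= fine (best_approx p n fa) by rewrite fine_ge0// best_approx_ge0.
have /fineK := best_approx_fin n p0 (ltW p1) Lfa.
set e := fine _ in e0 *; move=> /esym bE.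
pose M := e + X `^ p^-1; have M0 : 0 <= M by rewrite addr_ge0// powR_ge0.
have tp0 := twopi_gt0 R.
have rp0 : 0 < rho alpha p n `^ p by rewrite powR_gt0.
have key : (Ip p (fun x => fa x - Ta x)%R <=
    (C * rho alpha p n `^ p * (pi *+ 2 * (e `^ p + 2 * X)))%:E)%E.
  apply/lee_addgt0Pr => d d0.
  (* [K] turns the slack [2 eps], once multiplied by [C rho^p], into exactly [d], which is
     arbitrary. *)
  pose K := C * rho alpha p n `^ p * 2; have K0 : 0 < K by rewrite !mulr_gt0.
  have dK : 0 < d / K by rewrite divr_gt0.
  have [u u0 Hu] := block_error_le p0 p1 n0 Lfa dK YX.
  have uy : (block_error p n fa u < +oo)%E by rewrite (le_lt_trans Hu)// ltry.
  apply: (le_trans (HC f fa n u T Ta n0 Lf Hfa HT Tbest HTa u0 uy)).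
  have : (0 <= (C * rho alpha p n `^ p)%:E)%E by rewrite lee_fin mulr_ge0// ltW.
  move/lee_wpmul2l => /(_ _ _ Hu)/le_trans; apply.
  rewrite -EFinM -EFinD lee_fin le_eqVlt; apply/orP; left; apply/eqP.
  by rewrite /K; field; rewrite !gt_eqF.
rewrite YX bE poweR_EFin -EFinD -EFinM -/M /normLp.
rewrite -/(Ip p (fun x => fa x - Ta x)).
have -> : (3 * C) `^ p^-1 * rho alpha p n * M =
    (3 * C * rho alpha p n `^ p * M `^ p) `^ p^-1.
  rewrite !powRM ?mulr_ge0 ?powR_ge0 ?(ltW C0) ?(ltW C3)//.
  by rewrite -!(powRrM _ p p^-1) mulfV ?gt_eqF// !powRr1 ?(ltW r0).
rewrite -poweR_EFin gt0_ler_poweR ?(ltW pV0)//.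
- by rewrite in_itv /= leey andbT mule_ge0 ?Ip_ge0// lee_fin invr_ge0 ltW.
- by rewrite in_itv /= leey andbT lee_fin !mulr_ge0 ?powR_ge0 ?(ltW C0).
apply: (@le_trans _ _ (((pi *+ 2)^-1)%:E *
   (C * rho alpha p n `^ p * (pi *+ 2 * (e `^ p + 2 * X)))%:E)%E).
  by rewrite lee_wpmul2l ?lee_fin ?invr_ge0 ?(ltW tp0).
rewrite -EFinM lee_fin.
have -> : (pi *+ 2)^-1 * (C * rho alpha p n `^ p * (pi *+ 2 * (e `^ p + 2 * X))) =
   (C * rho alpha p n `^ p) * (e `^ p + 2 * X).
  by rewrite mulrCA mulKf ?gt_eqF.
have -> : 3 * C * rho alpha p n `^ p * M `^ p = (C * rho alpha p n `^ p) * (3 * M `^ p).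
  by ring.
by rewrite ler_wpM2l ?mulr_ge0 ?powR_ge0 ?(ltW C0)// powR_split_le.
Qed.
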